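(* Let $P_A$ be a combinatorial decision problem with $P_A\in\mathsf{NP}$. Then $P_A^{HDRR}$ with $\Gamma$-set scenarios is in $\Sigma^p_3$.
   Context: A combinatorial decision problem $P_A$ has instances given by a finite universe $U$ and a tuple of relations $R=(R_1,\dots,R_r)$ with $R_1=U$, each a relation built from $U$, with a set $F(R)$ of feasible solutions; YES-instance iff $F(R)\neq\emptyset$. A scenario is an instance of $P_A$, obtained by activating/deactivating universe and relation elements (deactivating an element removes every relation element containing it). $H(A,B)=|A\triangle B|$. $P_A^{HDRR}$: given a base scenario $\sigma_0$, a set $\mathsf S$ of recovery scenarios and an integer $\kappa$, decide whether there are a feasible solution $s_0$ of $\sigma_0$ and for every $\sigma\in\mathsf S$ a feasible solution $s_\sigma$ of $\sigma$ with $H(s_0,s_\sigma)\le\kappa$ (over universe elements in the solutions). $\Gamma$-set scenarios: the recovery scenarios are encoded by $(E',\{E_1,\dots,E_n\})$ with pairwise disjoint sets of combinatorial elements and a number $\Gamma$; the scenario set consists of all $\sigma=E'\cup\bigcup_{E\in\mathcal E}E$ with $\mathcal E\subseteq\{E_1,\dots,E_n\}$, $|\mathcal E|\le\Gamma$, where $E'$ is a fixed set of elements common to all scenarios.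
   Formalization: ''P_A in NP'' is taken to include that membership of s in F(R) can itself be verified in NP; with only the decision problem in NP the claim fails, e.g. when F(R) is {U} or {∅} according to an undecidable property of R. *)

(* Defs.v *)
From HB Require Import structures.
From mathcomp Require Import all_boot all_order all_algebra.
From mathcomp Require Import finmap.
Set Implicit Arguments.
Unset Strict Implicit.
Unset Printing Implicit Defensive.
Import Order.TTheory GRing.Theory Num.Theory.

Definition bits := seq bool.
Definition language := bits -> Prop.

Variant move := Left | Stay | Right.

(* The tape alphabet is [option (bool + tm_extra)]: [None] is the blank, the
   input symbols are [Some (inl b)], and [tm_extra] holds any further working
   symbols.  [tm_verdict q = Some b] means that [q] is a halting state, which is
   accepting if [b] and rejecting otherwise. *)
Record tm := TM {
  tm_tapes : nat;
  tm_extra : finType;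
  tm_state : finType;
  tm_start : tm_state;
  tm_verdict : tm_state -> option bool;
  tm_trans : tm_state -> {ffun 'I_tm_tapes -> option (bool + tm_extra)} ->
    tm_state * {ffun 'I_tm_tapes -> option (bool + tm_extra) * move}
}.

Section Machines.
Variable M : tm.

Definition symbol := option (bool + tm_extra M).

(* Two-way infinite tape: the part left of the head (nearest cell first), the
   scanned cell, the part right of the head; all other cells are blank. *)
Record tape := Tape { left_of : seq symbol; scanned : symbol; right_of : seq symbol }.

Definition tape_write (t : tape) (a : symbol) : tape :=
  Tape (left_of t) a (right_of t).

Definition tape_move (t : tape) (d : move) : tape :=
  match d with
  | Left => Tape (behead (left_of t)) (head None (left_of t))
                 (scanned t :: right_of t)
  | Stay => t
  | Right => Tape (scanned t :: left_of t) (head None (right_of t))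
                  (behead (right_of t))
  end.

Definition input_tape (w : bits) : tape :=
  let u : seq symbol := [seq Some (inl b) | b <- w] in
  Tape [::] (head None u) (behead u).

Definition config := (tm_state M * {ffun 'I_(tm_tapes M) -> tape})%type.

(* The i-th input is written on the i-th tape; the remaining tapes are blank. *)
Definition tm_init (xs : seq bits) : config :=
  (tm_start M, [ffun i : 'I_(tm_tapes M) => input_tape (nth [::] xs i)]).

Definition tm_step (c : config) : config :=
  if tm_verdict c.1 is Some _ then c else
  let: (q, act) := tm_trans c.1 [ffun i => scanned (c.2 i)] in
  (q, [ffun i => tape_move (tape_write (c.2 i) (act i).1) (act i).2]).

Definition tm_run (t : nat) (xs : seq bits) : config :=
  iter t tm_step (tm_init xs).

End Machines.

(* [V], a [k]-ary relation on bit strings, is decidable in time polynomial in the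
   total length of its arguments.  Halting configurations are fixed by [tm_step],
   so having a verdict after [n] steps means halting within [n] steps. *)
Definition polytime (k : nat) (V : seq bits -> Prop) : Prop :=
  exists (M : tm) (q : {poly nat}), forall xs : seq bits, size xs = k ->
    exists b : bool,
      tm_verdict (tm_run M q.[(\sum_(x <- xs) size x)%N]%R xs).1 = Some b /\
      (b <-> V xs).

(* [alternation ex k n V xs]: Q y_1, ..., Q y_k, V (xs ++ [:: y_1; ...; y_k]) with
   [k] alternating quantifiers over strings of length at most [n], the first one
   existential if [ex] and universal otherwise. *)
Fixpoint alternation (ex : bool) (k n : nat) (V : seq bits -> Prop)
    (xs : seq bits) : Prop :=
  if k is k'.+1 then
    if ex then
      exists y : bits, size y <= n /\ alternation false k' n V (rcons xs y)
    else
      forall y : bits, size y <= n -> alternation true k' n V (rcons xs y)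
  else V xs.

Definition SigmaP (k : nat) (L : language) : Prop :=
  exists (V : seq bits -> Prop) (p : {poly nat}),
    polytime k.+1 V /\
    forall x : bits, L x <-> alternation true k p.[size x]%R V [:: x].

Definition NP : language -> Prop := SigmaP 1.

(* Universe elements are named by bit strings.  A relation element is a tuple
   built from universe elements; components may themselves be tuples, so that
   relations over earlier relations, or over sets of elements given by a listing,
   are covered. *)
Inductive term := Atom of bits | Tuple of seq term.

Fixpoint gentree_of_term (t : term) : GenTree.tree bits :=
  match t with
  | Atom w => GenTree.Leaf w
  | Tuple ts => GenTree.Node 0 (map gentree_of_term ts)
  end.

Fixpoint term_of_gentree (t : GenTree.tree bits) : term :=
  match t with
  | GenTree.Leaf w => Atom w
  | GenTree.Node _ ts => Tuple (map term_of_gentree ts)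
  end.

Lemma gentree_of_termK : cancel gentree_of_term term_of_gentree.
Proof.
rewrite /cancel; fix IH 1 => -[w|ts] //=; congr Tuple.
by elim: ts => [|t ts IHts] //=; rewrite IH IHts.
Qed.

HB.instance Definition _ := Countable.copy term (can_type gentree_of_termK).

Fixpoint subterms (t : term) : seq term :=
  t :: (if t is Tuple ts then flatten (map subterms ts) else [::]).

(* The objects contained in [t], at any depth, [t] itself excluded. *)
Definition constituents (t : term) : seq term := behead (subterms t).

Definition is_atom (t : term) : bool := if t is Atom _ then true else false.

Local Open Scope fset_scope.

(* A tuple (R_1, ..., R_r) of relations.  The relation R_(j+1) is at position [j];
   the universe R_1 is at position 0. *)
Definition relations := seq {fset term}.

Definition rel_at (R : relations) (j : nat) : {fset term} := nth fset0 R j.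

Definition universe (R : relations) : {fset term} := rel_at R 0.

(* A combinatorial element is an element of one of the relations, together with
   the position of that relation: equal tuples occurring in two relations are two
   combinatorial elements, which can be (de)activated separately.  Universe
   elements are those at position 0. *)
Definition celem := (nat * term)%type.

Definition celems (R : relations) : pred celem :=
  [pred c : celem | c.2 \in rel_at R c.1].

(* Elements of a relation other than the universe are required to be tuples: a
   unary relation consists of 1-tuples [Tuple [:: u]], which unlike [u] are not
   contained in every tuple having [u] as a component. *)
Definition is_instance (R : relations) : Prop :=
  0 < size R /\
  forall j t, t \in rel_at R j ->
    if j == 0 then is_atom t : Prop
    else ~~ is_atom t /\
         forall u, u \in constituents t -> is_atom u -> u \in universe R.

(* F(R) is given by [feasible R]; it is empty if [R] is not an instance. *)
Record problem := Problem {
  feasible : relations -> {fset celem} -> Prop;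
  feasible_sub : forall R s, feasible R s ->
        is_instance R /\ {subset s <= celems R}
}.

Definition yes_instance (P : problem) (R : relations) : Prop :=
  exists s, feasible P R s.

(* The scenario of the instance [R] with active combinatorial elements [A]: an
   element stays if it is active and does not contain a deactivated element. *)
Definition scenario (R : relations) (A : {fset celem}) : relations :=
  mkseq (fun j =>
    [fset t in rel_at R j | ((j, t) \in A) &&
       all (fun u => all (fun i => (u \in rel_at R i) ==> ((i, u) \in A))
                         (iota 0 (size R)))
           (constituents t)])
    (size R).

Definition symdiff (T : choiceType) (A B : {fset T}) : {fset T} :=
  (A `\` B) `|` (B `\` A).

Definition universe_part (s : {fset celem}) : {fset celem} :=
  [fset c in s | c.1 == 0].

Definition hamming (s s' : {fset celem}) : nat :=
  #|` symdiff (universe_part s) (universe_part s')|.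

Definition HDRR (P : problem) (R : relations) (sigma0 : {fset celem})
    (S : {fset celem} -> Prop) (kappa : int) : Prop :=
  exists s0, feasible P (scenario R sigma0) s0 /\
    forall sigma, S sigma ->
      exists s, feasible P (scenario R sigma) s /\
        ((hamming s0 s)%:Z <= kappa)%R.

(* [E'] is common to all scenarios; [E] lists E_1, ..., E_n. *)
Definition gamma_set (E' : {fset celem}) (E : seq {fset celem}) (Gamma : nat)
    (sigma : {fset celem}) : Prop :=
  exists J : {set 'I_(size E)}, #|J| <= Gamma /\
    sigma = E' `|` \bigcup_(i in J) nth fset0 E i.

Definition gamma_encoding_ok (R : relations) (E' : {fset celem})
    (E : seq {fset celem}) : Prop :=
  {in E' :: E, forall A : {fset celem}, {subset A <= celems R}} /\
  pairwise (fun A B : {fset celem} => [disjoint A & B]) (E' :: E).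

(* All codes below are prefix-free, so tuples are encoded by concatenation. *)
Definition enc_seq (T : Type) (f : T -> bits) (s : seq T) : bits :=
  foldr (fun x w => true :: f x ++ w) [:: false] s.

Definition enc_bits : bits -> bits := enc_seq (fun b => [:: b]).

Fixpoint enc_term (t : term) : bits :=
  match t with
  | Atom w => false :: enc_bits w
  | Tuple ts => true :: enc_seq enc_term ts
  end.

(* The position of the relation is in unary; it is smaller than the number of
   relations, which are all listed in the input. *)
Definition enc_celem (c : celem) : bits :=
  nseq c.1 true ++ false :: enc_term c.2.

Definition enc_relations : seq (seq term) -> bits := enc_seq (enc_seq enc_term).
Definition enc_celems : seq celem -> bits := enc_seq enc_celem.

(* A finite set is encoded through any sequence listing its elements. *)
Definition set_of (T : choiceType) (s : seq T) : {fset T} := [fset x in s].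

Definition relations_of (Rl : seq (seq term)) : relations :=
  map (@set_of term) Rl.

(* Binary numerals, least significant digit first, and signed numerals. *)
Definition nat_of_numeral (w : bits) : nat :=
  foldr (fun (b : bool) n => (b + n.*2)%N) 0 w.

Definition int_of_numeral (sgn : bool) (w : bits) : int :=
  (if sgn then - (nat_of_numeral w)%:Z else (nat_of_numeral w)%:Z)%R.

Definition yes_language (P : problem) : language := fun x =>
  exists Rl : seq (seq term),
    x = enc_relations Rl /\ yes_instance P (relations_of Rl).

Definition solution_language (P : problem) : language := fun x =>
  exists (Rl : seq (seq term)) (sl : seq celem),
    x = enc_relations Rl ++ enc_celems sl /\
    feasible P (relations_of Rl) (set_of sl).

(* Membership in NP with the feasible solutions as certificates.  For an arbitrary
   family of sets F(R), the first clause says nothing about which sets are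
   feasible, e.g. if F(R) is always a singleton; the second one states that
   "s is in F(R)" is itself verifiable in polynomial time, possibly with the help of
   a further certificate.  Since the elements of F(R) are sets of combinatorial
   elements of R, the second clause implies the first. *)
Definition problem_in_NP (P : problem) : Prop :=
  NP (yes_language P) /\ NP (solution_language P).

Definition HDRR_gamma_language (P : problem) : language := fun x =>
  exists (Rl : seq (seq term)) (l0 l' : seq celem) (ls : seq (seq celem))
         (g : bits) (sgn : bool) (k : bits),
    x = enc_relations Rl ++ enc_celems l0 ++
        enc_celems l' ++ enc_seq enc_celems ls ++ enc_bits g ++
        sgn :: enc_bits k /\
    let R := relations_of Rl in
    let sigma0 := set_of l0 in
    let E' := set_of l' in
    let E := map (@set_of celem) ls in
    [/\ is_instance R, {subset sigma0 <= celems R}, gamma_encoding_ok R E' E &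
        HDRR P R sigma0 (gamma_set E' E (nat_of_numeral g))
             (int_of_numeral sgn k)].

(* Main.v *)
From HB Require Import structures.
From mathcomp Require Import all_boot all_order all_algebra.
From mathcomp Require Import finmap zify.
From Stdlib Require Import FunctionalExtensionality.
Require Import Defs.
Set Implicit Arguments.
Unset Strict Implicit.
Unset Printing Implicit Defensive.
Import Order.TTheory GRing.Theory Num.Theory.

(** Membership of [x] in the language reads: there is [s_0] such that for every
admissible index set [J] there is [s] with [s_0], [s] feasible and close. Index sets
exist, so the certificates of feasibility of both [s_0] and [s] can be guessed under
the last quantifier: [y_1] codes [s_0], [y_2] is a mask for [J], and [y_3] consists of
the two certificates and the code of [s].

What remains is deterministic: check the input, compute the codes of the two scenario
instances, compare the solutions, and run the verifier of "[s] is in [F(R)]" twice.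
All but the last part only handles positions in the strings, and is expressed by
primitive recursion on naturals saturating at a bound [N] linear in the input length.
With unary counters on tapes such a recursion takes time polynomial in [N], whatever
its nesting, so that no running time has to be analysed for individual functions. *)

(** * Tapes and machines *)

(** The verifier of feasibility is an arbitrary machine, so it cannot be absorbed into the recursion
    on naturals: its two pairs of inputs have to be written on tapes exactly as in an initial
    configuration, and the machine is then run on both pairs side by side. Hence a language of
    string-producing programs stands next to the language of numbers. Three points need care. The
    strings under the quantifiers have no structure: every $y_2$ must denote an admissible $J$;
    $y_1$ and the end of $y_3$ are handed over undecoded, because their acceptance as solutions
    forces them to be codes of lists; and the lengths of the certificates must be tested, since an
    overlong accepted certificate proves nothing. The numbers $\Gamma$ and $\kappa$ are binary and
    may be exponentially large; they are compared only with quantities not exceeding the bound, so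
    saturation does no harm. Finally, decoding is partial while recursion is total: the bound itself
    signals failure, which is unambiguous because it exceeds every position in the strings. *)

Section AbstractTapes.
Variable X : Type.

(* Cells are indexed by integers; the second component is the head position. *)
Definition atape := ((int -> option X) * int)%type.

Definition shift (d : move) : int :=
  match d with Left => (-1)%R | Stay => 0%R | Right => 1%R end.

Definition ascan (a : atape) : option X := a.1 a.2.

Definition aact (a : atape) (s : option X) (d : move) : atape :=
  (fun i => if i == a.2 then s else a.1 i, (a.2 + shift d)%R).

Lemma aact_stay (a : atape) : aact a (ascan a) Stay = a.
Proof.
case: a => c h; rewrite /aact /ascan /= addr0; congr pair.
by apply: functional_extensionality => i; case: eqP => [->|].
Qed.

Lemma aact_move (c : int -> option X) h d :
  aact (c, h) (c h) d = (c, (h + shift d)%R).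
Proof.
rewrite /aact /=; congr pair.
by apply: functional_extensionality => i; case: eqP => [->|].
Qed.

Definition upd (T : nat -> atape) (i : nat) (a : atape) : nat -> atape :=
  fun j => if j == i then a else T j.

Lemma updE T i a : upd T i a i = a.
Proof. by rewrite /upd eqxx. Qed.

Lemma upd_ne T i a j : j != i -> upd T i a j = T j.
Proof. by rewrite /upd => /negbTE->. Qed.

Lemma upd_id T i a : T i = a -> upd T i a = T.
Proof.
by move=> <-; apply: functional_extensionality => j; rewrite /upd; case: eqP => // ->.
Qed.

Lemma upd_upd T i a b : upd (upd T i a) i b = upd T i b.
Proof. by apply: functional_extensionality => j; rewrite /upd; case: eqP. Qed.

Lemma updC T i j a b : i != j -> upd (upd T i a) j b = upd (upd T j b) i a.
Proof.
move=> ij; apply: functional_extensionality => k; rewrite /upd.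
by case: (eqVneq k j) => // ->; rewrite eq_sym (negbTE ij).
Qed.

End AbstractTapes.

Section Represent.
Variable M : tm.

(** Blanks at the far end of a list are invisible to [nth None]. So [rep] leads from lists, which
    represent a tape in many ways, to functions on cells, for which rewriting the scanned symbol is
    an equality. *)
Definition rep (t : tape M) (a : atape (bool + tm_extra M)) : Prop :=
  [/\ forall i : nat, nth None (left_of t) i = a.1 (a.2 - 1 - i%:Z)%R,
      scanned t = a.1 a.2 &
      forall i : nat, nth None (right_of t) i = a.1 (a.2 + 1 + i%:Z)%R].

Lemma nth_behead (T : Type) (x0 : T) s i : nth x0 (behead s) i = nth x0 s i.+1.
Proof. by case: s => //=; rewrite nth_nil. Qed.

Lemma rep_act t a s d : rep t a ->
  rep (tape_move (tape_write t s) d) (aact a s d).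
Proof.
case: t a => l c r [f h] [/= Hl Hc Hr]; rewrite /aact; case: d; split=> /=.
- by move=> i; rewrite nth_behead Hl; case: eqP => [|_]; [lia | congr f; lia].
- by rewrite -nth0 Hl; case: eqP => [|_]; [lia | congr f; lia].
- by case=> [|i] /=; [case: eqP => //; lia |];
    rewrite Hr; case: eqP => [|_]; [lia | congr f; lia].
- by move=> i; rewrite Hl; case: eqP => [|_]; [lia | congr f; lia].
- by rewrite addr0 eqxx.
- by move=> i; rewrite Hr; case: eqP => [|_]; [lia | congr f; lia].
- by case=> [|i] /=; [case: eqP => //; lia |];
    rewrite Hl; case: eqP => [|_]; [lia | congr f; lia].
- by rewrite -nth0 Hr; case: eqP => [|_]; [lia | congr f; lia].
- by move=> i; rewrite nth_behead Hr; case: eqP => [|_]; [lia | congr f; lia].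
Qed.

Definition aconfig := (tm_state M * ('I_(tm_tapes M) -> atape (bool + tm_extra M)))%type.

Definition astep (c : aconfig) : aconfig :=
  if tm_verdict c.1 is Some _ then c else
  let r := tm_trans c.1 [ffun i => ascan (c.2 i)] in
  (r.1, fun i => aact (c.2 i) (r.2 i).1 (r.2 i).2).

Definition crep (c : config M) (a : aconfig) : Prop :=
  c.1 = a.1 /\ forall i, rep (c.2 i) (a.2 i).

Lemma crep_step c a : crep c a -> crep (tm_step c) (astep a).
Proof.
case: c a => q t [_ a] [/= <- R]; rewrite /tm_step /astep /=.
case: (tm_verdict q) => [//|].
have -> : [ffun i => scanned (t i)] = [ffun i => ascan (a i)].
  by apply/ffunP=> i; rewrite !ffunE; case: (R i).
case: (tm_trans q _) => q' ac; split=> //= i; rewrite ffunE.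
exact: rep_act.
Qed.

Lemma crep_iter n c a :
  crep c a -> crep (iter n (@tm_step M) c) (iter n astep a).
Proof. by move=> H; elim: n => //= n; apply: crep_step. Qed.

End Represent.

Definition bitcells (X : Type) (w : bits) (i : int) : option (bool + X) :=
  if i is Posz n then nth None [seq Some (inl b) | b <- w] n else None.

Definition atape_of (X : Type) (w : bits) : atape (bool + X) := (@bitcells X w, 0%R).

Lemma rep_input (M : tm) (w : bits) : rep (input_tape M w) (atape_of (tm_extra M) w).
Proof.
split=> [[|i]||i] //=.
by rewrite nth_behead.
Qed.

Definition ainit (M : tm) (xs : seq bits) : aconfig M :=
  (tm_start M, fun i : 'I_(tm_tapes M) => atape_of (tm_extra M) (nth [::] xs i)).

Lemma crep_run (M : tm) n xs :
  crep (tm_run M n xs) (iter n (@astep M) (ainit M xs)).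
Proof. by apply: crep_iter; split=> //= i; rewrite ffunE; apply: rep_input. Qed.

Section Machines.
Variable X : Type.
Local Notation tapes := (nat -> atape X).

(* In each state the machine accesses the single tape [sel q]. *)
Record mach := Mach {
  st : finType;
  st0 : st;
  out : st -> option bool;
  sel : st -> nat;
  tr : st -> option X -> st * (option X * move)
}.

Definition mnext (A : mach) (q : st A) (T : tapes) : st A * tapes :=
  let r := tr q (ascan (T (sel q))) in
  (r.1, upd T (sel q) (aact (T (sel q)) r.2.1 r.2.2)).

Fixpoint reach (A : mach) (t : nat) (q : st A) (T : tapes) (b : bool) (T' : tapes) : Prop :=
  if out q is Some b' then b' = b /\ T = T' else
  if t is t'.+1 then reach t' (mnext q T).1 (mnext q T).2 b T' else False.

Lemma reach_out (A : mach) t (q : st A) T b T' b' :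
  out q = Some b' -> reach t q T b T' = (b' = b /\ T = T').
Proof. by case: t => /= [|t] ->. Qed.

Lemma reach_next (A : mach) t (q : st A) T b T' :
  out q = None ->
  reach t.+1 q T b T' = reach t (mnext q T).1 (mnext q T).2 b T'.
Proof. by move=> /= ->. Qed.

Definition exec (A : mach) (T : tapes) (b : bool) (T' : tapes) (t : nat) : Prop :=
  reach t (st0 A) T b T'.

Lemma reach_le (A : mach) t t' (q : st A) T b T' :
  t <= t' -> reach t q T b T' -> reach t' q T b T'.
Proof.
elim: t t' q T => [|t IH] [|t'] q T //=; case: (out q) => //.
by rewrite ltnS => le; apply: IH.
Qed.

Lemma exec_le A T b T' t t' : t <= t' -> exec A T b T' t -> exec A T b T' t'.
Proof. exact: reach_le. Qed.

Definition skip : mach :=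
  @Mach unit tt (fun=> Some true) (fun=> 0) (fun _ s => (tt, (s, Stay))).

Lemma exec_skip T t : exec skip T true T t.
Proof. by case: t. Qed.

Definition stop : mach :=
  @Mach unit tt (fun=> Some false) (fun=> 0) (fun _ s => (tt, (s, Stay))).

Lemma exec_stop T t : exec stop T false T t.
Proof. by case: t. Qed.

Definition act (i : nat) (g : option X -> bool * (option X * move)) : mach :=
  @Mach (option bool) None id (fun=> i) (fun _ s => (Some (g s).1, (g s).2)).

Lemma exec_act i g (T : tapes) :
  exec (act i g) T (g (ascan (T i))).1
    (upd T i (aact (T i) (g (ascan (T i))).2.1 (g (ascan (T i))).2.2)) 1.
Proof. by []. Qed.

(** Handing over to [B] or [C] takes a step of its own, which rewrites the scanned symbol and stays;
    this is the extra step in [exec_branch]. *)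
Definition branch (A B C : mach) : mach :=
  @Mach (st A + (st B + st C))%type (inl (st0 A))
    (fun q => match q with
              | inl _ => None | inr (inl q) => out q | inr (inr q) => out q end)
    (fun q => match q with
              | inl q => sel q | inr (inl q) => sel q | inr (inr q) => sel q end)
    (fun q s => match q with
       | inl q => if out q is Some b
                  then (if b then inr (inl (st0 B)) else inr (inr (st0 C)), (s, Stay))
                  else let r := tr q s in (inl r.1, r.2)
       | inr (inl q) => let r := tr q s in (inr (inl r.1), r.2)
       | inr (inr q) => let r := tr q s in (inr (inr r.1), r.2) end).

Lemma reach_branchl A B C t (q : st B) T b T' :
  reach t q T b T' -> @reach (branch A B C) t (inr (inl q)) T b T'.
Proof. by elim: t q T => [|t IH] q T /=; case: (out q) => // H; apply: IH. Qed.

Lemma reach_branchr A B C t (q : st C) T b T' :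
  reach t q T b T' -> @reach (branch A B C) t (inr (inr q)) T b T'.
Proof. by elim: t q T => [|t IH] q T /=; case: (out q) => // H; apply: IH. Qed.

Lemma exec_branch A B C T b T1 t1 b2 T2 t2 :
  exec A T b T1 t1 -> exec (if b then B else C) T1 b2 T2 t2 ->
  exec (branch A B C) T b2 T2 (t1 + t2).+1.
Proof.
have switch (q : st A) t : out q = Some b -> t2 <= t ->
    exec (if b then B else C) T1 b2 T2 t2 ->
    @reach (branch A B C) t.+1 (inl q) T1 b2 T2.
  move=> oq le H; rewrite reach_next // /mnext /= oq /= aact_stay upd_id //.
  apply: reach_le le _.
  by case: b H {oq}; [apply: reach_branchl | apply: reach_branchr].
rewrite {1}/exec => H1 H2.
rewrite {1}/exec [st0 (branch _ _ _)]/=; move: (st0 A) H1 => q.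
elim: t1 q T => [|t1 IH] q T.
  case oq: (out q) => [b'|]; last by rewrite /= oq.
  by rewrite (reach_out _ _ _ _ oq) => -[eb ->]; apply: switch; rewrite ?oq ?eb.
case oq: (out q) => [b'|].
  by rewrite (reach_out _ _ _ _ oq) => -[eb ->]; apply: switch; rewrite ?oq ?eb //; lia.
rewrite reach_next // => H1.
by rewrite addSn reach_next // {1 2}/mnext /= oq; exact: IH H1.
Qed.

Definition seqm (A B : mach) : mach := branch A B B.

Lemma exec_seq A B T b T1 t1 b2 T2 t2 :
  exec A T b T1 t1 -> exec B T1 b2 T2 t2 -> exec (seqm A B) T b2 T2 (t1 + t2).+1.
Proof. by move=> H1 H2; apply: exec_branch H1 _; case: (b). Qed.

Definition loop (A : mach) : mach :=
  @Mach (option (st A)) (Some (st0 A))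
    (fun q => if q is Some _ then None else Some true)
    (fun q => if q is Some q then sel q else 0)
    (fun q s => if q is Some q then
       if out q is Some b then (if b then Some (st0 A) else None, (s, Stay))
       else let r := tr q s in (Some r.1, r.2)
     else (None, (s, Stay))).

(** Starting from an arbitrary state of the body makes the induction on its running time go through;
    the [if] covers both a further round and the exit. *)
Lemma reach_loop A (q : st A) T b T1 t1 b2 T2 t2 :
  reach t1 q T b T1 ->
  @reach (loop A) t2 (if b then Some (st0 A) else None) T1 b2 T2 ->
  @reach (loop A) (t1 + t2).+1 (Some q) T b2 T2.
Proof.
move=> H1 H2.
have switch (q' : st A) t : out q' = Some b -> t2 <= t ->
    @reach (loop A) t.+1 (Some q') T1 b2 T2.
  move=> oq le; rewrite reach_next // /mnext /= oq /= aact_stay upd_id //.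
  exact: reach_le le _.
elim: t1 q T H1 => [|t1 IH] q T.
  case oq: (out q) => [b'|]; last by rewrite /= oq.
  by rewrite (reach_out _ _ _ _ oq) => -[eb ->]; apply: switch; rewrite ?oq ?eb.
case oq: (out q) => [b'|].
  by rewrite (reach_out _ _ _ _ oq) => -[eb ->]; apply: switch; rewrite ?oq ?eb //; lia.
rewrite reach_next // => H1.
by rewrite addSn reach_next // {1 2}/mnext /= oq; exact: IH H1.
Qed.

Lemma exec_loop_end A T T1 t : exec A T false T1 t -> exec (loop A) T true T1 t.+1.
Proof.
move=> H; rewrite -[t]addn0; exact: (@reach_loop A _ _ _ _ _ _ _ 0 H).
Qed.

Lemma exec_loop_next A T T1 t1 T2 t2 :
  exec A T true T1 t1 -> exec (loop A) T1 true T2 t2 ->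
  exec (loop A) T true T2 (t1 + t2).+1.
Proof. by move=> H1 H2; apply: (@reach_loop A _ _ true _ _ _ _ _ H1). Qed.

End Machines.

(* Unification must not run machines. *)
#[global] Opaque exec.

(** * Unary counters *)

Section Counters.
Variable E : finType.
Local Notation X := (bool + E)%type.
Local Notation tapes := (nat -> atape X).

(* A counter is a tape with a mark in cell 0; its value is the head position. *)
Definition ctr (v : nat) : atape X :=
  (fun i => if i == 0%R then Some (inl true) else None, Posz v).

Definition blank : atape X := (fun=> None, 0%R).

Definition mark r := act r (fun _ : option X => (true, (Some (inl true), Stay))).
Definition unmark r := act r (fun _ : option X => (true, (None, Stay))).
Definition step d r := act r (fun s : option X => (true, (s, d))).
(** On a counter this tests for zero, since only cell 0 is marked; on an input tape it tests whether
    the head is still on the string. *)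
Definition filled r := act r (fun s : option X => (isSome s, (s, Stay))).
Local Notation stop := (stop X).

Lemma exec_mark (T : tapes) r : T r = blank -> exec (mark r) T true (upd T r (ctr 0)) 1.
Proof. by move=> Tr; have := @exec_act X r (fun=> (true, (Some (inl true), Stay))) T; rewrite Tr. Qed.

Lemma exec_unmark (T : tapes) r : T r = ctr 0 -> exec (unmark r) T true (upd T r blank) 1.
Proof.
move=> Tr; have := @exec_act X r (fun=> (true, (None, Stay))) T; rewrite Tr /=.
congr (exec _ _ _ (upd _ _ _) _); rewrite /aact /blank; congr pair.
by apply: functional_extensionality => i /=; case: eqP.
Qed.

Lemma exec_step (T : tapes) d r :
  exec (step d r) T true (upd T r ((T r).1, ((T r).2 + shift d)%R)) 1.
Proof.
have := @exec_act X r (fun s => (true, (s, d))) T.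
by rewrite /ascan; case: (T r) => c h; rewrite aact_move.
Qed.

Lemma exec_inc (T : tapes) r v :
  T r = ctr v -> exec (step Right r) T true (upd T r (ctr v.+1)) 1.
Proof.
by move=> Tr; have := exec_step T Right r; rewrite Tr /= -PoszD addn1.
Qed.

Lemma exec_dec (T : tapes) r v :
  T r = ctr v.+1 -> exec (step Left r) T true (upd T r (ctr v)) 1.
Proof.
move=> Tr; have := exec_step T Left r; rewrite Tr /=.
by have -> : (Posz v.+1 + (-1) = Posz v)%R by lia.
Qed.

Lemma exec_filled (T : tapes) r v : T r = ctr v -> exec (filled r) T (v == 0) T 1.
Proof.
move=> Tr; have := @exec_act X r (fun s => (isSome s, (s, Stay))) T.
by rewrite /= aact_stay upd_id // Tr /ascan /=; case: v {Tr}.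
Qed.

Definition consume r (A : mach X) : mach X :=
  loop (branch (filled r) stop (seqm (step Left r) A)).

(** [I j] describes the tapes after [j] rounds, except for the counter [r], which is overwritten.
    The constant 6 covers the test for zero, the decrement and the changes of machine in each
    round. *)
Lemma exec_consume r A v t (I : nat -> tapes) T T' :
  T = upd (I 0) r (ctr v) -> T' = upd (I v) r (ctr 0) ->
  (forall j, j < v -> exec A (upd (I j) r (ctr (v - j.+1))) true
                             (upd (I j.+1) r (ctr (v - j.+1))) t) ->
  exec (consume r A) T true T' (v * (t + 6) + 4).
Proof.
move=> -> ->; elim: v I => [|v IH] I H.
  have Z := exec_filled (updE (I 0) r (ctr 0)).
  have S : exec (if 0 == 0 then stop else seqm (step Left r) A)
     (upd (I 0) r (ctr 0)) false (upd (I 0) r (ctr 0)) 0 by apply: exec_stop.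
  exact: exec_le (exec_loop_end (exec_branch Z S)).
have H0 := H 0 isT; rewrite subSS subn0 in H0.
have {}IH : exec (consume r A) (upd (I 1) r (ctr v)) true
    (upd (I v.+1) r (ctr 0)) (v * (t + 6) + 4).
  by apply: (IH (fun j => I j.+1)) => j lt; apply: (H j.+1).
have D := exec_dec (updE (I 0) r (ctr v.+1)); rewrite upd_upd in D.
have Z := exec_filled (updE (I 0) r (ctr v.+1)).
have S : exec (if v.+1 == 0 then stop else seqm (step Left r) A)
   (upd (I 0) r (ctr v.+1)) true (upd (I 1) r (ctr v)) (1 + t).+1.
  exact: exec_seq D H0.
by have := exec_loop_next (exec_branch Z S) IH; apply: exec_le; lia.
Qed.

Definition drain r := consume r (skip X).

Lemma exec_drain (T : tapes) r v :
  T r = ctr v -> exec (drain r) T true (upd T r (ctr 0)) (v * 6 + 4).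
Proof.
move=> Tr; apply: (exec_consume (t := 0) (I := fun=> T)) => //.
by rewrite upd_id.
Qed.

(** Allocation of the register [f]: a free register is a blank tape, whereas a register in use needs
    its mark, without which zero could not be detected. [A] has to return it with value 0. *)
Definition local f A := seqm (mark f) (seqm A (unmark f)).

Lemma exec_local f A (T T' : tapes) t :
  T f = blank -> T' f = blank ->
  exec A (upd T f (ctr 0)) true (upd T' f (ctr 0)) t ->
  exec (local f A) T true T' (t + 4).
Proof.
move=> Tf Tf' H.
have U := exec_unmark (updE T' f (ctr 0)); rewrite upd_upd (upd_id Tf') in U.
by have := exec_seq (exec_mark Tf) (exec_seq H U); apply: exec_le; lia.
Qed.

End Counters.

Ltac upd_case :=
  rewrite /upd; repeat (case: eqP => [?|?]); subst;
  try solve [ done | lia | congruence | congr ctr; lia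
            | match goal with H : ?T ?j = _ |- _ = ?T ?j => rewrite H; congr ctr; lia end
            | match goal with H : is_true (?x != ?x) |- _ => by rewrite eqxx in H end ].

Ltac upd_eq := apply: functional_extensionality => ?; upd_case.

Lemma exec_to (E : finType) (A : mach (bool + E)) T b T1 T2 t1 t2 :
  exec A T b T1 t1 -> T1 = T2 -> t1 <= t2 -> exec A T b T2 t2.
Proof. by move=> H <- le; apply: exec_le le H. Qed.

(** * Moving, copying and truncating counters *)

Section Moves.
Variable E : finType.
Local Notation X := (bool + E)%type.
Local Notation tapes := (nat -> atape X).
Local Notation ctr := (ctr E).

Definition transfer r d := consume r (step E Right d).

Lemma exec_transfer (T : tapes) r d a b : r != d -> T r = ctr a -> T d = ctr b ->
  exec (transfer r d) T true (upd (upd T r (ctr 0)) d (ctr (a + b))) (a * 7 + 4).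
Proof.
move=> rd Tr Td; have rd' : d != r by rewrite eq_sym.
apply: (exec_consume (t := 1) (I := fun j => upd T d (ctr (j + b)))).
- by rewrite updC // (upd_id Tr) upd_id.
- by rewrite updC.
move=> j lt.
have S := @exec_inc E (upd (upd T d (ctr (j + b))) r (ctr (a - j.+1))) d (j + b).
by apply: (exec_to (S _)) => //; [upd_case | upd_eq].
Qed.

(** A counter is read only by counting it down, so its value is sent to both [d] and [u] and then
    restored from [u]. *)
Definition copy s d u :=
  seqm (consume s (seqm (step E Right d) (step E Right u))) (transfer u s).

Lemma exec_copy (T : tapes) s d u a b : uniq [:: s; d; u] ->
  T s = ctr a -> T d = ctr b -> T u = ctr 0 ->
  exec (copy s d u) T true (upd T d (ctr (a + b))) (a * 16 + 9).
Proof.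
rewrite /= !inE negb_or andbT => /andP[/andP[sd su] du] Ts Td Tu.
have H1 : exec (consume s (seqm (step E Right d) (step E Right u))) T true
    (upd (upd (upd T d (ctr (a + b))) u (ctr a)) s (ctr 0)) (a * (3 + 6) + 4).
  apply: (exec_consume (t := 3) (I := fun j => upd (upd T d (ctr (j + b))) u (ctr j))) => //.
    by upd_eq.
  move=> j lt.
  set T1 := upd (upd _ _ _) s _.
  have S1 := @exec_inc E T1 d (j + b).
  set T2 := upd T1 d _ in S1.
  have S2 := @exec_inc E T2 u j.
  apply: (exec_to (exec_seq (S1 _) (S2 _))) => //; rewrite /T2 /T1; [upd_case..|upd_eq].
set T1 := (X in exec _ _ _ X _) in H1.
have H2 : exec (transfer u s) T1 true (upd (upd T1 u (ctr 0)) s (ctr (a + 0))) (a * 7 + 4).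
  by apply: exec_transfer; rewrite 1?eq_sym // /T1; upd_case.
have := exec_seq H1 H2.
have -> : upd (upd T1 u (ctr 0)) s (ctr (a + 0)) = upd T d (ctr (a + b)).
  by rewrite /T1 addn0; upd_eq.
by apply: exec_le; lia.
Qed.

(** The minimum with the bound: [n] is counted down along with [r] until it is exhausted, and [u]
    records what was taken from [n] in order to restore it. This is what keeps a successor from
    passing the bound. *)
Definition clip n r d u :=
  seqm (consume r (branch (filled E n) (skip X)
         (seqm (step E Left n) (seqm (step E Right d) (step E Right u)))))
       (transfer u n).

Lemma exec_clip (T : tapes) n r d u a N : uniq [:: n; r; d; u] ->
  T n = ctr N -> T r = ctr a -> T d = ctr 0 -> T u = ctr 0 ->
  exec (clip n r d u) T true (upd (upd T r (ctr 0)) d (ctr (minn N a)))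
    (a * 13 + N * 7 + 9).
Proof.
rewrite /= !inE !negb_or andbT => /and3P[/and3P[nr nd nu] /andP[rd ru] du] Tn Tr Td Tu.
pose I j := upd (upd (upd T n (ctr (N - j))) d (ctr (minn N j))) u (ctr (minn N j)).
have H1 : exec (consume r (branch (filled E n) (skip X)
         (seqm (step E Left n) (seqm (step E Right d) (step E Right u))))) T true
    (upd (I a) r (ctr 0)) (a * (7 + 6) + 4).
  apply: (exec_consume (t := 7) (I := I)) => //.
    by rewrite /I minn0 subn0; upd_eq.
  move=> j lt; set r0 := ctr (a - j.+1).
  have Z := @exec_filled E (upd (I j) r r0) n (N - j).
  have {}Z : exec (filled E n) (upd (I j) r r0) (N - j == 0) (upd (I j) r r0) 1.
    by apply: Z; rewrite /I; upd_case.
  case: (leqP N j) => Nj.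
    have -> : I j.+1 = I j by rewrite /I; upd_eq.
    have eN : N - j == 0 by lia.
    rewrite eN in Z.
    by apply: exec_le (exec_branch Z (exec_skip (upd (I j) r r0) 0)).
  have eN : (N - j == 0) = false by lia.
  rewrite eN in Z.
  have S1 := @exec_dec E (upd (I j) r r0) n (N - j.+1).
  set T1 := upd (upd (I j) r r0) n (ctr (N - j.+1)) in S1.
  have S2 := @exec_inc E T1 d j.
  set T2 := upd T1 d (ctr j.+1) in S2.
  have S3 := @exec_inc E T2 u j.
  set T3 := upd T2 u (ctr j.+1) in S3.
  have -> : upd (I j.+1) r r0 = T3.
    have e : minn N j.+1 = j.+1 by lia.
    by rewrite /T3 /T2 /T1 /I e; upd_eq.
  apply: exec_le (exec_branch Z (exec_seq (S1 _) (exec_seq (S2 _) (S3 _)))) => //;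
    by rewrite /T2 /T1 /I; upd_case.
set T1 := (X in exec _ _ _ X _) in H1.
have H2 : exec (transfer u n) T1 true
    (upd (upd T1 u (ctr 0)) n (ctr (minn N a + (N - a)))) (minn N a * 7 + 4).
  by apply: exec_transfer; rewrite 1?eq_sym // /T1 /I; upd_case.
have := exec_seq H1 H2.
have -> : upd (upd T1 u (ctr 0)) n (ctr (minn N a + (N - a))) =
   upd (upd T r (ctr 0)) d (ctr (minn N a)).
  by rewrite /T1 /I; upd_eq.
by apply: exec_le; lia.
Qed.

End Moves.

(** * Saturating recursion *)

Definition scons (T : Type) (x : T) (v : nat -> T) (k : nat) : T :=
  if k is k'.+1 then v k' else x.

Notation "x .: v" := (scons x v) (at level 60, right associativity).

(* Primitive recursion on naturals, saturating at a bound [N], with read access to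
   some bit strings; variables are de Bruijn indices.  Since every value stays
   below [N], evaluation with unary counters takes time polynomial in [N]. *)
Inductive expr :=
  | Var of nat
  | Zero
  | Top
  | Succ of expr
  | Bit of nat & expr
  | If of expr & expr & expr
  | Rec of expr & expr & expr
  | Let of expr & expr
  | Ren of (nat -> nat) & expr.

(** The value 0 stands for a position past the end, so the end of a string is noticed by reading. *)
Definition bitv (w : bits) (i : nat) : nat :=
  if i < size w then (nth false w i).+1 else 0.

Fixpoint eval (N : nat) (xs : seq bits) (e : expr) (v : nat -> nat) : nat :=
  match e with
  | Var k => v k
  | Zero => 0
  | Top => N
  | Succ e => minn N (eval N xs e v).+1
  | Bit k e => bitv (nth [::] xs k) (eval N xs e v)
  | If e a b => if eval N xs e v is 0 then eval N xs b v else eval N xs a v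
  | Rec n z s => iteri (eval N xs n v) (fun i acc => eval N xs s (i .: acc .: v)) (eval N xs z v)
  | Let a b => eval N xs b (eval N xs a v .: v)
  | Ren r e => eval N xs e (fun k => v (r k))
  end.

Lemma bitv_le w i : bitv w i <= 2.
Proof. by rewrite /bitv; case: ifP => // _; case: nth. Qed.

(** [Bit] yields up to 2, whence [1 < N]. In a loop the index stays below the number of rounds and
    the accumulator is bounded by induction along the rounds. *)
Lemma eval_le N xs e v : 1 < N -> (forall k, v k <= N) -> eval N xs e v <= N.
Proof.
move=> N2; elim: e v => //=.
- by move=> e _ v _; rewrite geq_minl.
- by move=> k e _ v _; apply: leq_trans (bitv_le _ _) _.
- by move=> e _ a IHa b IHb v Hv; case: (eval _ _ e _) => [|_]; [apply: IHb | apply: IHa].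
- move=> n IHn z IHz s IHs v Hv.
  have: eval N xs n v <= N by apply: IHn.
  elim: (eval N xs n v) => [|m IHm] lt /=; first exact: IHz.
  by apply: IHs => -[|[|k]] //=; [apply: ltnW | apply: IHm; apply: ltnW].
- by move=> a IHa b IHb v Hv; apply: IHb => -[|k] //=; apply: IHa.
- by move=> r e IH v Hv; apply: IH.
Qed.

(** Depends on the bound and the expression only: every loop is charged [N] rounds, so nesting
    merely raises the degree of a polynomial in [N]. *)
Fixpoint eval_time (N : nat) (e : expr) : nat :=
  match e with
  | Var k => 16 * N + 13
  | Zero => 0
  | Top => 16 * N + 13
  | Succ e => eval_time N e + 20 * N + 40
  | Bit k e => eval_time N e + 18 * N + 40
  | If e a b => eval_time N e + eval_time N a + eval_time N b + 6 * N + 20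
  | Rec n z s => eval_time N n + eval_time N z + N * (eval_time N s + 13 * N + 20)
                 + 13 * N + 50
  | Let a b => eval_time N a + eval_time N b + 6 * N + 20
  | Ren r e => eval_time N e
  end.

(** * Compiling recursion to counter machines *)

Section Compile.
Variables (E : finType) (K nreg : nat) (N : nat) (xs : seq bits).
Hypotheses (Knreg : K <= nreg) (szxs : size xs = K) (N2 : 1 < N).
Local Notation X := (bool + E)%type.
Local Notation tapes := (nat -> atape X).
Local Notation ctr := (ctr E).
Local Notation blank := (blank E).

Definition read k d : mach X :=
  branch (filled E k)
    (branch (act k (fun s : option X => (if s is Some (inl true) then true else false, (s, Stay))))
       (seqm (step E Right d) (step E Right d)) (step E Right d))
    (skip X).

(* [dst] receives the value, registers from [f] on are free. *)
Fixpoint compile (e : expr) (env : nat -> nat) (dst f : nat) : mach X :=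
  match e with
  | Var k => local f (copy E (env k) dst f)
  | Zero => skip X
  | Top => local f (copy E nreg dst f)
  | Succ e => local f (local f.+1
      (seqm (compile e env f f.+2) (seqm (step E Right f) (clip E nreg f dst f.+1))))
  | Bit k e => if k < K then local f (local f.+1
      (seqm (compile e env f f.+2)
      (seqm (consume f (seqm (step E Right f.+1) (step E Right k)))
      (seqm (read k dst) (consume f.+1 (step E Left k))))))
      else skip X
  | If e a b => local f (seqm (compile e env f f.+1)
      (branch (filled E f) (compile b env dst f.+1) (seqm (drain E f) (compile a env dst f.+1))))
  | Rec n z s => local f (local f.+1 (local f.+2 (local f.+3
      (seqm (compile n env f f.+4) (seqm (compile z env f.+1 f.+4)
      (seqm (consume f
        (seqm (compile s (f.+2 .: f.+1 .: env) f.+3 f.+4)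
        (seqm (drain E f.+1) (seqm (transfer E f.+3 f.+1) (step E Right f.+2)))))
      (seqm (drain E f.+2) (transfer E f.+1 dst))))))))
  | Let a b => local f (seqm (compile a env f f.+1)
      (seqm (compile b (f .: env) dst f.+1) (drain E f)))
  | Ren r e => compile e (fun k => env (r k)) dst f
  end.

(** The layout of the tapes: inputs below [K], the constant [N] on [nreg], variables above it, blank
    tapes from [f] on. Nothing is required between [K] and [nreg], so outputs can be written there.
    Input heads rest on cell 0, which makes reading repeatable. *)
Record ok (f : nat) (T : tapes) (env v : nat -> nat) : Prop := Ok {
  ok_in : forall k, k < K -> T k = atape_of E (nth [::] xs k);
  ok_N : T nreg = ctr N;
  ok_base : nreg < f;
  ok_env : forall k, nreg < env k < f;
  ok_val : forall k, T (env k) = ctr (v k);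
  ok_le : forall k, v k <= N;
  ok_free : forall r, f <= r -> T r = blank
}.

Lemma ok_upd f f' T env v r a : ok f T env v -> f <= f' -> nreg < r < f' ->
  (forall k, env k != r) -> ok f' (upd T r a) env v.
Proof.
case=> Hi HN Hb He Hv Hl Hf le /andP[lo hi] ne; split=> //.
- by move=> k lt; rewrite upd_ne ?Hi //; lia.
- by rewrite upd_ne //; lia.
- lia.
- by move=> k; have := He k; lia.
- by move=> k; rewrite upd_ne.
- by move=> q le'; rewrite upd_ne ?Hf //; lia.
Qed.

Lemma ok_new f f' T env v r a : ok f T env v -> f <= r < f' -> ok f' (upd T r a) env v.
Proof.
move=> H lt; apply: (ok_upd a H); first lia.
  by have := ok_base H; lia.
by move=> k; have := ok_env H k; lia.
Qed.

Lemma ok_cons f T env v r a : ok f T env v -> nreg < r < f -> T r = ctr a ->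
  a <= N -> ok f T (r .: env) (a .: v).
Proof. by case=> Hi HN Hb He Hv Hl Hf lt Tr le; split=> // -[|k] /=. Qed.

Lemma ok_ren f T env v r : ok f T env v -> ok f T (fun k => env (r k)) (fun k => v (r k)).
Proof. by case=> Hi HN Hb He Hv Hl Hf; split. Qed.

Lemma exec_read (T : tapes) k d v w : k != d -> T k = (@bitcells E w, Posz v) ->
  T d = ctr 0 -> exec (read k d) T true (upd T d (ctr (bitv w v))) 7.
Proof.
move=> kd Tk Td.
have S0 := @exec_act X k (fun s => (isSome s, (s, Stay))) T.
have S1 := @exec_act X k (fun s : option X =>
   (if s is Some (inl true) then true else false, (s, Stay))) T.
rewrite /= aact_stay upd_id // in S0; rewrite /= aact_stay upd_id // in S1.
have sc : ascan (T k) = nth None [seq Some (inl b) | b <- w] v by rewrite Tk.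
case: (ltnP v (size w)) => lt; last first.
  rewrite sc nth_default ?size_map // in S0.
  apply: (exec_to (exec_branch S0 (exec_skip T 0))) => //.
  by rewrite /bitv ltnNge lt /= upd_id.
rewrite sc (nth_map false) // in S0; rewrite sc (nth_map false) // in S1.
have I1 := exec_inc Td.
rewrite /bitv lt; case: (nth false w v) S1 => S1.
  apply: (exec_to (exec_branch S0 (exec_branch S1 (exec_seq I1 (exec_inc (updE T d _)))))) => //.
  by rewrite upd_upd.
exact: (exec_to (exec_branch S0 (exec_branch S1 I1))).
Qed.

(** The only change left on the tapes is the value of [dst]: heads return and auxiliary registers
    become blank again. This exactness is what allows compiled pieces to be chained. No variable
    lives in [dst], so variables stay readable while [dst] is being filled. *)
Lemma compile_ok e env v f dst T : ok f T env v -> nreg < dst < f ->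
  (forall k, env k != dst) -> T dst = ctr 0 ->
  exec (compile e env dst f) T true (upd T dst (ctr (eval N xs e v))) (eval_time N e).
Proof.
elim: e env v f dst T => [k|||e IHe|k e IHe|e IHe a IHa b IHb|n IHn z IHz s IHs|a IHa b IHb|r e IHe]
  env v f dst T H /andP[lo hi] ne T0 /=.
- have Hf := ok_free H; have He := ok_env H k; have Hb := ok_base H.
  have [lef nek] : env k != f /\ env k != dst by split; [lia | apply: ne].
  apply: (@exec_le _ _ _ _ _ (v k * 16 + 9 + 4)); first by have := ok_le H k; lia.
  apply: exec_local; [exact: Hf | by rewrite upd_ne ?Hf //; lia |].
  apply: (exec_to (@exec_copy E _ (env k) dst f (v k) 0 _ _ _ _)) => //.
  + by rewrite /= !inE negb_or nek lef andbT; lia.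
  + by rewrite upd_ne // (ok_val H).
  + by rewrite upd_ne //; lia.
  + by rewrite updE.
  + by rewrite addn0 updC //; lia.
- by rewrite upd_id //; apply: exec_skip.
- have Hf := ok_free H; have Hb := ok_base H.
  apply: (@exec_le _ _ _ _ _ (N * 16 + 9 + 4)); first lia.
  apply: exec_local; [exact: Hf | by rewrite upd_ne ?Hf //; lia |].
  apply: (exec_to (@exec_copy E _ nreg dst f N 0 _ _ _ _)) => //.
  + by rewrite /= !inE; lia.
  + by rewrite upd_ne ?(ok_N H) //; lia.
  + by rewrite upd_ne //; lia.
  + by rewrite updE.
  + by rewrite addn0 updC //; lia.
- have Hf := ok_free H; have Hb := ok_base H.
  set T1 := upd T f (ctr 0); set T2 := upd T1 f.+1 (ctr 0).
  have H2 : ok f.+2 T2 env v.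
    by apply: (@ok_new f.+1); [apply: ok_new H _; lia | lia].
  have C := IHe env v f.+2 f T2 H2.
  set r := eval N xs e v in C *.
  have le : r <= N by apply: eval_le => //; apply: ok_le H.
  have {}C : exec (compile e env f f.+2) T2 true (upd T2 f (ctr r)) (eval_time N e).
    apply: C; first lia.
      by move=> k; have := ok_env H k; lia.
    by rewrite /T2 /T1 upd_ne ?updE //; lia.
  have S := exec_inc (updE T2 f (ctr r)).
  rewrite upd_upd in S.
  have Cl : exec (clip E nreg f dst f.+1) (upd T2 f (ctr r.+1)) true
     (upd (upd (upd T2 f (ctr r.+1)) f (ctr 0)) dst (ctr (minn N r.+1)))
     (r.+1 * 13 + N * 7 + 9).
    apply: exec_clip.
    + by rewrite /= !inE; lia.
    + by rewrite /T2 /T1 !upd_ne ?(ok_N H) //; lia.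
    + by rewrite updE.
    + by rewrite /T2 /T1 !upd_ne //; lia.
    + by rewrite /T2 upd_ne ?updE //; lia.
  apply: (@exec_le _ _ _ _ _ (((eval_time N e + (1 + (r.+1 * 13 + N * 7 + 9)).+1).+1 + 4) + 4)); first lia.
  apply: exec_local; [exact: Hf | by rewrite upd_ne ?Hf //; lia |].
  apply: exec_local; [by rewrite upd_ne ?Hf //; lia | by rewrite !upd_ne ?Hf //; lia |].
  apply: (exec_to (exec_seq C (exec_seq S Cl))) => //.
  by rewrite /T2 /T1; upd_eq.
- case: ifP => kK; last first.
    rewrite nth_default ?szxs; last by lia.
    by rewrite /bitv /= upd_id //; apply: exec_skip.
  have Hf := ok_free H; have Hb := ok_base H.
  set T1 := upd T f (ctr 0); set T2 := upd T1 f.+1 (ctr 0).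
  have H2 : ok f.+2 T2 env v.
    by apply: (@ok_new f.+1); [apply: ok_new H _; lia | lia].
  have C := IHe env v f.+2 f T2 H2.
  set r := eval N xs e v in C *.
  have le : r <= N by apply: eval_le => //; apply: ok_le H.
  have {}C : exec (compile e env f f.+2) T2 true (upd T2 f (ctr r)) (eval_time N e).
    apply: C; first lia.
      by move=> q; have := ok_env H q; lia.
    by rewrite /T2 /T1 upd_ne ?updE //; lia.
  have Tk := ok_in H kK; set w := nth [::] xs k in Tk *.
  (* Counting [f] down moves the head of tape [k] to the requested cell and builds up the same
     distance in [f.+1] for the way back. *)
  pose I j := upd (upd T2 f.+1 (ctr j)) k (@bitcells E w, Posz j).
  have C1 : exec (consume f (seqm (step E Right f.+1) (step E Right k)))
      (upd T2 f (ctr r)) true (upd (I r) f (ctr 0)) (r * (3 + 6) + 4).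
    apply: (@exec_consume _ _ _ _ _ I) => //.
      by rewrite /I /T2 /T1; upd_eq.
    move=> j lt.
    have S1 := @exec_inc E (upd (I j) f (ctr (r - j.+1))) f.+1 j.
    set T3 := upd (upd (I j) f _) f.+1 _ in S1.
    have S2 := @exec_step E T3 Right k.
    apply: (exec_to (exec_seq (S1 _) S2)) => //.
      by rewrite /I; upd_case.
    have -> : T3 k = (@bitcells E w, Posz j) by rewrite /T3 /I; upd_case.
    by rewrite /T3 /I /= -PoszD addn1; upd_eq.
  set T3 := upd (I r) f (ctr 0) in C1.
  have R := @exec_read T3 k dst r w.
  have {}R : exec (read k dst) T3 true (upd T3 dst (ctr (bitv w r))) 7.
    by apply: R; rewrite ?/T3 /I /T2 /T1; try upd_case; lia.
  pose J j := upd (upd T1 dst (ctr (bitv w r))) k (@bitcells E w, Posz (r - j)).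
  have C2 : exec (consume f.+1 (step E Left k)) (upd T3 dst (ctr (bitv w r))) true
     (upd (J r) f.+1 (ctr 0)) (r * (1 + 6) + 4).
    apply: (@exec_consume _ _ _ _ _ J) => //.
      by rewrite /J /T3 /I /T2 /T1 subn0; upd_eq.
    move=> j lt.
    have S2 := @exec_step E (upd (J j) f.+1 (ctr (r - j.+1))) Left k.
    apply: (exec_to S2) => //.
    have -> : upd (J j) f.+1 (ctr (r - j.+1)) k = (@bitcells E w, Posz (r - j)).
      by rewrite /J; upd_case.
    have -> /= : (Posz (r - j) + shift Left)%R = Posz (r - j.+1) by rewrite /=; lia.
    by rewrite /J; upd_eq.
  apply: (@exec_le _ _ _ _ _ ((eval_time N e + (r * (3 + 6) + 4 + (7 + (r * (1 + 6) + 4)).+1).+1).+1 + 4 + 4)); first lia.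
  apply: exec_local; [exact: Hf | by rewrite upd_ne ?Hf //; lia |].
  apply: exec_local; [by rewrite upd_ne ?Hf //; lia | by rewrite !upd_ne ?Hf //; lia |].
  apply: (exec_to (exec_seq C (exec_seq C1 (exec_seq R C2)))) => //.
  (* The head has returned to cell 0, so tape [k] is the original input tape again. *)
  rewrite /J subnn /T1; apply: functional_extensionality => q.
  rewrite /upd; case: (q =P k) => [->|//]; last by do !case: eqP => //; lia.
  by rewrite !ifN ?Tk //; lia.
- have Hf := ok_free H; have Hb := ok_base H.
  set T1 := upd T f (ctr 0).
  have H1 : ok f.+1 T1 env v by apply: ok_new H _; lia.
  set r := eval N xs e v.
  have le : r <= N by apply: eval_le => //; apply: ok_le H.
  have C : exec (compile e env f f.+1) T1 true (upd T1 f (ctr r)) (eval_time N e).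
    apply: IHe => //; first lia.
      by move=> k; have := ok_env H k; lia.
    by rewrite /T1 updE.
  have Z := exec_filled (updE T1 f (ctr r)).
  have D := exec_drain (updE T1 f (ctr r)).
  rewrite upd_upd [upd T1 f (ctr 0)]upd_id ?/T1 ?updE // -/T1 in D.
  have A c : (forall env v f dst T, ok f T env v ->
      nreg < dst < f -> (forall k : nat, env k != dst) -> T dst = ctr 0 ->
      exec (compile c env dst f) T true (upd T dst (ctr (eval N xs c v))) (eval_time N c)) ->
      exec (compile c env dst f.+1) T1 true (upd T1 dst (ctr (eval N xs c v))) (eval_time N c).
    apply => //; first lia.
    by rewrite /T1 upd_ne //; lia.
  apply: (@exec_le _ _ _ _ _ ((eval_time N e + (1 + (r * 6 + 4 + eval_time N a + eval_time N b).+1).+1).+1 + 4)); first lia.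
  apply: exec_local; [exact: Hf | by rewrite upd_ne ?Hf //; lia |].
  case er: r Z D C => [|r'] Z D C.
    have e0 : upd T1 f (ctr 0) = T1 by rewrite upd_id // /T1 updE.
    have {}A : exec (if 0 == 0 then compile b env dst f.+1 else (seqm (drain E f) (compile a env dst f.+1)))
      (upd T1 f (ctr 0)) true (upd T1 dst (ctr (eval N xs b v))) (eval_time N b).
      by rewrite e0; apply: A.
    apply: (exec_to (exec_seq C (exec_branch Z A))); last lia.
    by rewrite updC //; lia.
  have {}A : exec (if r'.+1 == 0 then compile b env dst f.+1 else (seqm (drain E f) (compile a env dst f.+1)))
      (upd T1 f (ctr r'.+1)) true (upd T1 dst (ctr (eval N xs a v))) (r'.+1 * 6 + 4 + eval_time N a).+1.
    by apply: exec_seq D _; apply: A.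
  apply: (exec_to (exec_seq C (exec_branch Z A))); last lia.
  by rewrite updC //; lia.
- have Hf := ok_free H; have Hb := ok_base H.
  set S0 := upd (upd (upd (upd T f (ctr 0)) f.+1 (ctr 0)) f.+2 (ctr 0)) f.+3 (ctr 0).
  (* Between rounds: [a] rounds remain, [b] is the accumulator, [c] the index; [f.+3] is zero and
     receives the next accumulator, as the old one is still being read. *)
  pose St a b c := upd (upd (upd (upd T f (ctr a)) f.+1 (ctr b)) f.+2 (ctr c)) f.+3 (ctr 0).
  have HS a b c : ok f.+4 (St a b c) env v.
    apply: (@ok_new f.+3); last lia.
    apply: (@ok_new f.+2); last lia.
    apply: (@ok_new f.+1); last lia.
    by apply: (ok_new _ H); lia.
  set m := eval N xs n v; set acc := iteri _ _ _.
  have lem : m <= N by apply: eval_le => //; apply: ok_le H.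
  pose ac j := iteri j (fun i acc => eval N xs s (i .: acc .: v)) (eval N xs z v).
  have leac j : j <= m -> ac j <= N.
    elim: j => [|j IH] lt /=; first by apply: eval_le => //; apply: ok_le H.
    apply: eval_le => // -[|[|k]] /=; [lia | apply: IH; lia | exact: ok_le H _].
  have Cn : exec (compile n env f f.+4) (St 0 0 0) true (St m 0 0) (eval_time N n).
    apply: (exec_to (IHn env v f.+4 f _ (HS 0 0 0) _ _ _)) => //; first lia.
    - by move=> k; have := ok_env H k; lia.
    - by rewrite /St; upd_case.
    - by rewrite /St; upd_eq.
  have Cz : exec (compile z env f.+1 f.+4) (St m 0 0) true (St m (ac 0) 0) (eval_time N z).
    apply: (exec_to (IHz env v f.+4 f.+1 _ (HS m 0 0) _ _ _)) => //; first lia.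
    - by move=> k; have := ok_env H k; lia.
    - by rewrite /St; upd_case.
    - by rewrite /St; upd_eq.
  have Cs : exec (consume f
        (seqm (compile s (f.+2 .: f.+1 .: env) f.+3 f.+4)
        (seqm (drain E f.+1) (seqm (transfer E f.+3 f.+1) (step E Right f.+2)))))
       (St m (ac 0) 0) true (St 0 (ac m) m) (m * (eval_time N s + 13 * N + 12 + 6) + 4).
    apply: (@exec_consume _ _ _ _ _ (fun j => St 0 (ac j) j)).
    - by rewrite /St; upd_eq.
    - by rewrite /St; upd_eq.
    move=> j lt; set c := m - j.+1.
    have -> : upd (St 0 (ac j) j) f (ctr c) = St c (ac j) j by rewrite /St; upd_eq.
    have -> : upd (St 0 (ac j.+1) j.+1) f (ctr c) = St c (ac j.+1) j.+1 by rewrite /St; upd_eq.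
    have H1 : ok f.+4 (St c (ac j) j) (f.+2 .: f.+1 .: env) (j .: ac j .: v).
      apply: ok_cons; [|lia|by rewrite /St; upd_case|lia].
      apply: ok_cons; [exact: HS | lia | by rewrite /St; upd_case | apply: leac; lia].
    have C1 := IHs _ _ f.+4 f.+3 _ H1.
    rewrite -[eval N xs s _]/(ac j.+1) in C1.
    set T1 := upd _ _ _ in C1.
    have C2 := @exec_drain E T1 f.+1 (ac j).
    set T2 := upd _ _ _ in C2.
    have C3 := @exec_transfer E T2 f.+3 f.+1 (ac j.+1) 0.
    set T3 := upd _ _ _ in C3.
    have C4 := @exec_inc E T3 f.+2 j.
    apply: (exec_to (exec_seq (C1 _ _ _) (exec_seq (C2 _) (exec_seq (C3 _ _ _) (C4 _))))).
    - lia.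
    - by case=> [|[|k]] /=; [lia|lia|have := ok_env H k; lia].
    - by rewrite /St; upd_case.
    - by rewrite /T1 /St; upd_case.
    - lia.
    - by rewrite /T2 /T1 /St; upd_case.
    - by rewrite /T2 /T1 /St; upd_case.
    - by rewrite /T3 /T2 /T1 /St; upd_case.
    - by rewrite /T3 /T2 /T1 /St; upd_eq.
    have := leac _ (ltnW lt); have := leac _ lt; lia.
  have C5 := @exec_drain E (St 0 (ac m) m) f.+2 m.
  set T1 := upd _ _ _ in C5.
  have C6 := @exec_transfer E T1 f.+1 dst (ac m) 0.
  apply: (@exec_le _ _ _ _ _ ((eval_time N n + (eval_time N z + (m * (eval_time N s + 13 * N + 12 + 6) + 4 + (m * 6 + 4 + (ac m * 7 + 4)).+1).+1).+1).+1 + 4 + 4 + 4 + 4)).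
    have := leac _ (leqnn m).
    have : m * (eval_time N s + 13 * N + 18) <= N * (eval_time N s + 13 * N + 20).
      by apply: leq_mul => //; lia.
    lia.
  apply: exec_local; [exact: Hf | by rewrite upd_ne ?Hf //; lia |].
  apply: exec_local; [by rewrite upd_ne ?Hf //; lia | by rewrite !upd_ne ?Hf //; lia |].
  apply: exec_local; [by rewrite !upd_ne ?Hf //; lia | by rewrite !upd_ne ?Hf //; lia |].
  apply: exec_local; [by rewrite !upd_ne ?Hf //; lia | by rewrite !upd_ne ?Hf //; lia |].
  apply: (exec_to (exec_seq Cn (exec_seq Cz (exec_seq Cs (exec_seq (C5 _) (C6 _ _ _)))))) => //.
  - by rewrite /St; upd_case.
  - lia.
  - by rewrite /T1 /St; upd_case.
  - by rewrite /T1 /St; upd_case.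
  by rewrite /T1 /St addn0 -/m -/(ac m) /acc -/(ac m); upd_eq.
- have Hf := ok_free H; have Hb := ok_base H.
  set T1 := upd T f (ctr 0).
  have H1 : ok f.+1 T1 env v by apply: ok_new H _; lia.
  set r := eval N xs a v.
  have le : r <= N by apply: eval_le => //; apply: ok_le H.
  have C : exec (compile a env f f.+1) T1 true (upd T1 f (ctr r)) (eval_time N a).
    apply: IHa => //; first lia.
      by move=> k; have := ok_env H k; lia.
    by rewrite /T1 updE.
  rewrite {2}/T1 upd_upd in C.
  set T2 := upd T f (ctr r) in C.
  have H2 : ok f.+1 T2 (f .: env) (r .: v).
    apply: ok_cons => //; [apply: ok_new H _ | | by rewrite /T2 updE]; lia.
  have C2 : exec (compile b (f .: env) dst f.+1) T2 true
      (upd T2 dst (ctr (eval N xs b (r .: v)))) (eval_time N b).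
    apply: IHb => //; first lia.
      by case=> [|k] /=; [lia | apply: ne].
    by rewrite /T2 upd_ne //; lia.
  have D := @exec_drain E (upd T2 dst (ctr (eval N xs b (r .: v)))) f r.
  apply: (@exec_le _ _ _ _ _ ((eval_time N a + (eval_time N b + (r * 6 + 4)).+1).+1 + 4)); first lia.
  apply: exec_local; [exact: Hf | by rewrite upd_ne ?Hf //; lia |].
  apply: (exec_to (exec_seq C (exec_seq C2 (D _)))) => //.
    by rewrite /T2; upd_case.
  by rewrite /T2; upd_eq.
- by apply: IHe => //; [exact: (ok_ren r H) | lia].
Qed.

End Compile.

(** * Producing strings *)

(** Numbers below the bound cannot represent whole strings, so strings are not values but are
    written bit by bit on a tape. *)
Inductive oprog :=
  | Emit of expr
  | Cat of oprog & oprog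
  | For of expr & oprog.

(** Inverse to the convention of [bitv]; in particular, copying from beyond the end of a string
    emits nothing. *)
Definition sym_bits (n : nat) : bits :=
  match n with 0 => [::] | 1 => [:: false] | _ => [:: true] end.

Fixpoint outp (N : nat) (xs : seq bits) (o : oprog) (v : nat -> nat) : bits :=
  match o with
  | Emit e => sym_bits (eval N xs e v)
  | Cat a b => outp N xs a v ++ outp N xs b v
  | For n a => flatten [seq outp N xs a (i .: v) | i <- iota 0 (eval N xs n v)]
  end.

Fixpoint outp_time (N : nat) (o : oprog) : nat :=
  match o with
  | Emit e => eval_time N e + 6 * N + 30
  | Cat a b => outp_time N a + outp_time N b + 1
  | For n a => eval_time N n + N * (outp_time N a + 20) + 6 * N + 30
  end.

(** The time bound also bounds the length of the output, which governs the cost of rewinding and the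
    running time of the machine that receives the output as input. *)
Lemma size_outp N xs o v : 1 < N -> (forall k, v k <= N) ->
  size (outp N xs o v) <= outp_time N o.
Proof.
move=> N2; elim: o v => [e|a IHa b IHb|n a IHa] v Hv /=.
- by case: (eval _ _ _ _) => [|[|k]] /=; lia.
- by rewrite size_cat; have := IHa v Hv; have := IHb v Hv; lia.
have le : eval N xs n v <= N by apply: eval_le.
rewrite size_flatten /shape -map_comp sumnE big_map.
have H : \sum_(i <- iota 0 (eval N xs n v)) size (outp N xs a (i .: v)) <=
   \sum_(i <- iota 0 (eval N xs n v)) outp_time N a.
  rewrite !big_seq; apply: leq_sum => i; rewrite mem_iota => lt.
  by apply: IHa => -[|k] //=; lia.
apply: leq_trans H _.
rewrite big_const_seq count_predT size_iota iter_addn_0 mulnC.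
have : eval N xs n v * outp_time N a <= N * (outp_time N a + 20) by apply: leq_mul; lia.
lia.
Qed.

Section CompileOutput.
Variables (E : finType) (K nreg : nat) (N : nat) (xs : seq bits).
Hypotheses (Knreg : K <= nreg) (szxs : size xs = K) (N2 : 1 < N).
Local Notation X := (bool + E)%type.
Local Notation tapes := (nat -> atape X).
Local Notation ctr := (ctr E).
Local Notation blank := (blank E).
Local Notation ok := (@ok E K nreg N xs).
Local Notation compile := (@compile E K nreg).

Definition otape (w : bits) : atape X := (@bitcells E w, Posz (size w)).

Lemma otape0 : blank = otape [::].
Proof. by congr pair; apply: functional_extensionality => -[[|i]|i]. Qed.

Lemma atape0 : atape_of E [::] = blank.
Proof. by congr pair; apply: functional_extensionality => -[[|i]|i]. Qed.

Definition emit b t := act t (fun _ : option X => (true, (Some (inl b), Right))).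

Lemma exec_emit (T : tapes) b t w : T t = otape w ->
  exec (emit b t) T true (upd T t (otape (rcons w b))) 1.
Proof.
move=> Tt; have := @exec_act X t (fun=> (true, (Some (inl b), Right))) T; rewrite Tt /=.
congr (exec _ _ _ (upd _ _ _) _); rewrite /aact /otape /=; congr pair; last first.
  by rewrite size_rcons -PoszD addn1.
apply: functional_extensionality => -[i|i] //=.
rewrite map_rcons nth_rcons size_map eqz_nat.
by case: ltngtP => // lt; rewrite nth_default // size_map ltnW.
Qed.

Fixpoint ocompile (o : oprog) (env : nat -> nat) (t f : nat) : mach X :=
  match o with
  | Emit e => local f (seqm (compile e env f f.+1)
      (branch (filled E f) (skip X)
        (seqm (step E Left f)
          (branch (filled E f) (emit false t) (seqm (emit true t) (drain E f))))))
  | Cat a b => seqm (ocompile a env t f) (ocompile b env t f)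
  | For n a => local f (local f.+1 (seqm (compile n env f f.+2)
      (seqm (consume f (seqm (ocompile a (f.+1 .: env) t f.+2) (step E Right f.+1)))
         (drain E f.+1))))
  end.

Lemma ok_out f T env v t a : ok f T env v -> K <= t < nreg -> ok f (upd T t a) env v.
Proof.
case=> Hi HN Hb He Hv Hl Hf lt; split=> //.
- by move=> k lt'; rewrite upd_ne ?Hi //; lia.
- by rewrite upd_ne //; lia.
- by move=> k; rewrite upd_ne //; have := He k; lia.
- by move=> q le'; rewrite upd_ne ?Hf //; lia.
Qed.

Lemma ocompile_ok o env v f t w T : ok f T env v -> K <= t < nreg -> T t = otape w ->
  exec (ocompile o env t f) T true (upd T t (otape (w ++ outp N xs o v))) (outp_time N o).
Proof.
elim: o env v f t w T => [e|a IHa b IHb|n a IHa] env v f t w T H lt Tt /=.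
- have Hf := ok_free H; have Hb := ok_base H.
  set T1 := upd T f (ctr 0).
  have H1 : ok f.+1 T1 env v by apply: (ok_new Knreg szxs N2 _ H); lia.
  set r := eval N xs e v.
  have le : r <= N by apply: eval_le => //; apply: ok_le H.
  have C : exec (compile e env f f.+1) T1 true (upd T1 f (ctr r)) (eval_time N e).
    apply: compile_ok => //; first by lia.
      by move=> k; have := ok_env H k; lia.
    by rewrite /T1 updE.
  rewrite {2}/T1 upd_upd in C; set T2 := upd T f (ctr r) in C.
  have Z : exec (filled E f) T2 (r == 0) T2 1 by apply: exec_filled; rewrite /T2 updE.
  have tf : t != f by lia.
  have B : exec (branch (filled E f) (skip X)
        (seqm (step E Left f)
          (branch (filled E f) (emit false t) (seqm (emit true t) (drain E f)))))
      T2 true (upd T1 t (otape (w ++ sym_bits r))) (1 + (1 + (1 + (1 + (r * 6 + 4)).+1).+1).+1).+1.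
    case er: r @T2 C Z => [|r'] T2 C Z.
      apply: (exec_to (exec_branch Z (exec_skip _ 0))) => //.
      by rewrite cats0 -Tt /T2 /T1; upd_eq.
    have D : exec (step E Left f) T2 true (upd T f (ctr r')) 1.
      apply: (exec_to (exec_dec (v := r') _)) => //; first by rewrite /T2 updE.
      by rewrite /T2 upd_upd.
    have Z2 : exec (filled E f) (upd T f (ctr r')) (r' == 0) (upd T f (ctr r')) 1.
      by apply: exec_filled; rewrite updE.
    have Tt' : upd T f (ctr r') t = otape w by rewrite upd_ne.
    clear C; clearbody T2; case: r' er Z D Z2 Tt' => [|r''] er Z D Z2 Tt'.
      apply: (exec_to (exec_branch Z (exec_seq D (exec_branch Z2 (exec_emit false Tt'))))) => //.
      by rewrite cats1.
    have S1 := exec_emit true Tt'; set T3 := upd _ t _ in S1.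
    have S2 := @exec_drain E T3 f r''.+1.
    apply: (exec_to (exec_branch Z (exec_seq D (exec_branch Z2 (exec_seq S1 (S2 _)))))).
    - by rewrite /T3; upd_case.
    - by rewrite /T3 /T1 /= cats1; upd_eq.
    by lia.
  apply: (@exec_le _ _ _ _ _ ((eval_time N e + (1 + (1 + (1 + (1 + (r * 6 + 4)).+1).+1).+1).+1).+1 + 4)); first lia.
  apply: exec_local; [exact: Hf | by rewrite upd_ne ?Hf //; lia |].
  by apply: (exec_to (exec_seq C B)) => //; rewrite /T1 updC //; lia.
- have C1 := IHa env v f t w T H lt Tt.
  have C2 := IHb env v f t (w ++ outp N xs a v) _ (ok_out _ H lt) lt (updE _ _ _).
  apply: (exec_to (exec_seq C1 C2)); last lia.
  by rewrite upd_upd catA.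
- have Hf := ok_free H; have Hb := ok_base H.
  pose St a b := upd (upd T f (ctr a)) f.+1 (ctr b).
  have HS a' b : ok f.+2 (St a' b) env v.
    by apply: (@ok_new E _ _ _ _ Knreg szxs N2 f.+1); [apply: (ok_new Knreg szxs N2 _ H) |]; lia.
  set m := eval N xs n v.
  have lem : m <= N by apply: eval_le => //; apply: ok_le H.
  have Cn : exec (compile n env f f.+2) (St 0 0) true (St m 0) (eval_time N n).
    apply: (exec_to (compile_ok Knreg szxs N2 n (HS 0 0) _ _ _)) => //; first lia.
    - by move=> k; have := ok_env H k; lia.
    - by rewrite /St; upd_case.
    - by rewrite /St -/m; upd_eq.
  pose ac j := w ++ flatten [seq outp N xs a (i .: v) | i <- iota 0 j].
  have Cs : exec (consume f (seqm (ocompile a (f.+1 .: env) t f.+2) (step E Right f.+1)))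
      (St m 0) true (upd (St 0 m) t (otape (ac m))) (m * (outp_time N a + 2 + 6) + 4).
    apply: (@exec_consume _ _ _ _ _ (fun j => upd (St 0 j) t (otape (ac j)))).
    - by rewrite /St /ac cats0 -Tt; upd_eq.
    - by rewrite /St; upd_eq.
    move=> j ltj; set c := m - j.+1.
    have -> : upd (upd (St 0 j) t (otape (ac j))) f (ctr c) = upd (St c j) t (otape (ac j)).
      by rewrite /St; upd_eq.
    have -> : upd (upd (St 0 j.+1) t (otape (ac j.+1))) f (ctr c) = upd (St c j.+1) t (otape (ac j.+1)).
      by rewrite /St; upd_eq.
    have H1 : ok f.+2 (upd (St c j) t (otape (ac j))) (f.+1 .: env) (j .: v).
      apply: ok_cons; [by apply: ok_out | lia | by rewrite /St; upd_case | lia].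
    have C1 := IHa _ _ _ _ _ _ H1 lt (updE _ _ _).
    rewrite upd_upd in C1; set T1 := upd _ _ (otape (_ ++ outp _ _ _ _)) in C1.
    have C2 := @exec_inc E T1 f.+1 j.
    apply: (exec_to (exec_seq C1 (C2 _))).
    - by rewrite /T1 /St; upd_case.
    - have -> : ac j.+1 = ac j ++ outp N xs a (j .: v).
        by rewrite /ac -[j.+1]addn1 iotaD map_cat flatten_cat /= cats0 catA.
      by rewrite /T1 /St; upd_eq.
    lia.
  have D := @exec_drain E (upd (St 0 m) t (otape (ac m))) f.+1 m.
  apply: (@exec_le _ _ _ _ _ ((eval_time N n + (m * (outp_time N a + 2 + 6) + 4 + (m * 6 + 4)).+1).+1 + 4 + 4)).
    have : m * (outp_time N a + 2 + 6) <= N * (outp_time N a + 20) by apply: leq_mul; lia.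
    lia.
  apply: exec_local; [exact: Hf | by rewrite upd_ne ?Hf //; lia |].
  apply: exec_local; [by rewrite upd_ne ?Hf //; lia | by rewrite !upd_ne ?Hf //; lia |].
  apply: (exec_to (exec_seq Cn (exec_seq Cs (D _)))) => //.
    by rewrite /St; upd_case.
  by rewrite /St -/m -/(ac m); upd_eq.
Qed.
End CompileOutput.

Ltac upd_skip := repeat (rewrite upd_ne; [| lia]).

(** * Checking, then preparing the inputs of the verifier *)

Section Driver.
Variables (E : finType) (K : nat).
Local Notation X := (bool + E)%type.
Local Notation tapes := (nat -> atape X).
Local Notation ctr := (ctr E).
Local Notation blank := (blank E).

Lemma exec_loop (A : mach X) (I : nat -> tapes) v t :
  (forall j, j < v -> exec A (I j) true (I j.+1) t) ->
  exec A (I v) false (I v) t ->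
  exec (loop A) (I 0) true (I v) (v.+1 * t.+1).
Proof.
elim: v I => [|v IH] I H H0.
  by apply: exec_le (exec_loop_end H0); lia.
have {}IH := IH (fun j => I j.+1) (fun j lt => H j.+1 lt) H0.
by apply: exec_le (exec_loop_next (H 0 isT) IH); lia.
Qed.

Definition incs c r := iter c (seqm (step E Right r)) (skip X).

Lemma exec_incs c r v (T : tapes) : T r = ctr v ->
  exec (incs c r) T true (upd T r (ctr (v + c))) (2 * c).
Proof.
elim: c v T => [|c IH] v T Tr /=; first by rewrite addn0 upd_id //; apply: exec_skip.
apply: (exec_to (exec_seq (exec_inc Tr) (IH v.+1 _ (updE _ _ _)))); last lia.
by rewrite upd_upd addSnnS.
Qed.

(** Eight units per cell produce the factor of the bound. The register [f] records how far the head
    of tape [k] has moved, so that it can return. *)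
Definition count_length n f k :=
  local f (seqm
    (loop (branch (filled E k) (seqm (step E Right k) (seqm (step E Right f) (incs 8 n)))
                  (stop X)))
    (consume f (step E Left k))).

Lemma exec_count_length (T : tapes) (n f k : nat) w a : uniq [:: n; f; k] ->
  T k = atape_of E w -> T f = blank -> T n = ctr a ->
  exec (count_length n f k) T true (upd T n (ctr (a + 8 * size w))) (size w * 40 + 40).
Proof.
rewrite /= !inE negb_or andbT => /andP[/andP[nf nk] fk] Tk Tf Tn.
pose I j := upd (upd (upd T k (@bitcells E w, Posz j)) f (ctr j)) n (ctr (a + 8 * j)).
have Z j : exec (filled E k) (I j) (j < size w) (I j) 1.
  have := @exec_act X k (fun s => (isSome s, (s, Stay))) (I j).
  rewrite /= aact_stay upd_id // (_ : isSome _ = (j < size w)) //.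
  have -> : I j k = (@bitcells E w, Posz j) by rewrite /I; upd_case.
  rewrite /ascan /=; case: ltnP => lt; last by rewrite nth_default // size_map.
  by rewrite (nth_map false).
have L : exec (loop (branch (filled E k) (seqm (step E Right k) (seqm (step E Right f) (incs 8 n)))
                  (stop X))) (I 0) true (I (size w)) ((size w).+1 * 22.+1).
  apply: exec_loop => [j lt|]; last first.
    have := Z (size w); rewrite ltnn => {}Z.
    by apply: exec_le (exec_branch Z (exec_stop _ 0)).
  have Zj := Z j; rewrite lt in Zj.
  have S1 := @exec_step E (I j) Right k; set T1 := upd _ k _ in S1.
  have S2 := @exec_inc E T1 f j; set T2 := upd _ f _ in S2.
  have S3 := @exec_incs 8 n (a + 8 * j) T2.
  have kn : k != n by rewrite eq_sym.
  have kf : k != f by rewrite eq_sym.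
  have fn : f != n by rewrite eq_sym.
  have e : I j k = (@bitcells E w, Posz j).
    by rewrite /I (upd_ne _ _ kn) (upd_ne _ _ kf) updE.
  apply: (exec_to (exec_branch Zj (exec_seq S1 (exec_seq (S2 _) (S3 _))))).
  - by rewrite /T1 /I (upd_ne _ _ fk) (upd_ne _ _ fn) updE.
  - by rewrite /T2 /T1 /I (upd_ne _ _ nf) (upd_ne _ _ nk) updE.
  - have e8 : a + 8 * j + 8 = a + 8 * j.+1 by lia.
    by rewrite /T2 /T1 e /= -PoszD addn1 e8 /I; clear -nf nk fk; upd_eq.
  by [].
pose J j := upd (upd T n (ctr (a + 8 * size w))) k (@bitcells E w, Posz (size w - j)).
have C : exec (consume f (step E Left k)) (I (size w)) true
     (upd (J (size w)) f (ctr 0)) (size w * (1 + 6) + 4).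
  apply: (@exec_consume _ _ _ _ _ J) => //.
    by rewrite /I /J subn0; upd_eq.
  move=> j lt.
  have S2 := @exec_step E (upd (J j) f (ctr (size w - j.+1))) Left k.
  apply: (exec_to S2) => //.
  have -> : upd (J j) f (ctr (size w - j.+1)) k = (@bitcells E w, Posz (size w - j)).
    by rewrite /J; upd_case.
  have -> /= : (Posz (size w - j) + shift Left)%R = Posz (size w - j.+1) by rewrite /=; lia.
  by rewrite /J; upd_eq.
apply: (@exec_le _ _ _ _ _ (((size w).+1 * 22.+1 + (size w * (1 + 6) + 4)).+1 + 4)); first lia.
apply: exec_local; [exact: Tf | by rewrite upd_ne 1?eq_sym |].
have -> : upd T f (ctr 0) = I 0.
  by rewrite /I muln0 addn0 -[(_, _)]/(atape_of E w) -Tk -Tn; upd_eq.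
apply: (exec_to (exec_seq L C)) => //.
by rewrite /J subnn -[(_, _)]/(atape_of E w) -Tk; upd_eq.
Qed.

(** After writing, the head stands behind the last symbol. It walks left over the string until the
    blank cell before it, then one step right, to where an input tape has its head. *)
Definition rewind t := seqm (step E Left t)
  (seqm (loop (branch (filled E t) (step E Left t) (stop X))) (step E Right t)).

Lemma exec_rewind (T : tapes) t w : T t = otape E w ->
  exec (rewind t) T true (upd T t (atape_of E w)) (size w * 4 + 12).
Proof.
move=> Tt.
pose I j := upd T t (@bitcells E w, (Posz (size w) - 1 - Posz j)%R).
have S1 : exec (step E Left t) T true (I 0) 1.
  by apply: (exec_to (exec_step _ _ _)) => //; rewrite Tt /I /= subr0.
have Z j : exec (filled E t) (I j) (j < size w) (I j) 1.
  have := @exec_act X t (fun s => (isSome s, (s, Stay))) (I j).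
  rewrite /= aact_stay upd_id // (_ : isSome _ = (j < size w)) //.
  rewrite /I updE /ascan /=; case: ltnP => lt.
    have -> : (Posz (size w) - 1 - Posz j = Posz (size w - j.+1))%R by lia.
    by rewrite /= (nth_map false) //; lia.
  (* The cell left of cell 0 has a negative index and is therefore blank, which ends the walk. *)
  have [i ->] : exists i, (Posz (size w) - 1 - Posz j = Negz i)%R.
    by exists (j - size w); lia.
  by [].
have L : exec (loop (branch (filled E t) (step E Left t) (stop X)))
   (I 0) true (I (size w)) ((size w).+1 * 3.+1).
  apply: exec_loop => [j lt|]; last first.
    have := Z (size w); rewrite ltnn => {}Z.
    by apply: exec_le (exec_branch Z (exec_stop _ 0)).
  have Zj := Z j; rewrite lt in Zj.
  apply: (exec_to (exec_branch Zj (@exec_step E (I j) Left t))) => //.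
  rewrite /I updE upd_upd /=; congr (upd _ _ (_, _)); lia.
apply: (exec_to (exec_seq S1 (exec_seq L (exec_step _ _ _)))); last lia.
rewrite /I updE upd_upd /=; congr (upd _ _ (_, _)); lia.
Qed.

Variables (s : nat) (xs : seq bits).
Hypotheses (szxs : size xs = K).
(** Behind the inputs, two blocks of [s] tapes are reserved for the two runs of the verifier.
    Register [nreg] holds the bound, and [nreg.+1] is a zero counter that serves as every free
    variable. *)
Let nreg := K + 2 * s.
Let f0 := nreg.+2.
Let bound := 8 * (\sum_(x <- xs) size x) + 8.

Definition count_all n f ks := foldr (fun k A => seqm (count_length n f k) A) (skip X) ks.

Lemma exec_count_all (T : tapes) (n f a : nat) (ks : seq nat) : n != f ->
  {in ks, forall k, [/\ T k = atape_of E (nth [::] xs k), n != k & f != k]} ->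
  T f = blank -> T n = ctr a ->
  exec (count_all n f ks) T true
    (upd T n (ctr (a + 8 * \sum_(k <- ks) size (nth [::] xs k))))
    (40 * \sum_(k <- ks) size (nth [::] xs k) + 41 * size ks).
Proof.
elim: ks a T => [|k ks IH] a T nf H Tf Tn.
  by rewrite big_nil muln0 addn0 upd_id //; apply: exec_skip.
rewrite big_cons /=.
have [Tk nk fk] := H k (mem_head _ _).
have C1 := @exec_count_length T n f k (nth [::] xs k) a _ Tk Tf Tn.
have C2 := IH (a + 8 * size (nth [::] xs k)) (upd T n (ctr (a + 8 * size (nth [::] xs k)))) nf.
apply: (exec_to (exec_seq (C1 _) (C2 _ _ _))).
- by rewrite /= !inE negb_or nf nk fk.
- move=> k' ik; have [|Tk' nk' fk'] := H k'; first by rewrite inE ik orbT.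
  by rewrite upd_ne // eq_sym.
- by rewrite upd_ne // eq_sym.
- by rewrite updE.
- by rewrite upd_upd mulnDr addnA.
by set S := \sum_(_ <- ks) _; lia.
Qed.

Definition output o t f := seqm (ocompile E K nreg o (fun=> nreg.+1) t f) (rewind t).

(** The result of the check is kept in [f0], where zero means rejection. The outputs go to the first
    two tapes of each block. *)
Definition driver (chk : expr) (o1 o2 o3 o4 : oprog) : mach X :=
  seqm (mark E nreg) (seqm (mark E nreg.+1)
  (seqm (count_all nreg f0 (iota 0 K)) (seqm (incs 8 nreg)
  (seqm (mark E f0) (seqm (compile E K nreg chk (fun=> nreg.+1) f0 f0.+1)
  (branch (filled E f0) (stop X)
    (seqm (output o1 K f0.+1) (seqm (output o2 K.+1 f0.+1)
    (seqm (output o3 (K + s) f0.+1) (output o4 (K + s).+1 f0.+1)))))))))).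

Definition driver_time n chk o1 o2 o3 o4 :=
  eval_time (8 * n + 8) chk + 5 * (outp_time (8 * n + 8) o1 + outp_time (8 * n + 8) o2
  + outp_time (8 * n + 8) o3 + outp_time (8 * n + 8) o4) + 40 * n + 41 * K + 120.

(** Only the two blocks matter afterwards: their first two tapes carry the outputs with heads at the
    start and the others are blank, as in an initial configuration with two inputs. *)
Lemma exec_driver chk o1 o2 o3 o4 : 1 < s ->
  let v0 := fun=> 0 in
  let w1 := outp bound xs o1 v0 in let w2 := outp bound xs o2 v0 in
  let w3 := outp bound xs o3 v0 in let w4 := outp bound xs o4 v0 in
  exists T', exec (driver chk o1 o2 o3 o4) (fun i => atape_of E (nth [::] xs i))
    (0 < eval bound xs chk v0) T' (driver_time (\sum_(x <- xs) size x) chk o1 o2 o3 o4) /\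
  (0 < eval bound xs chk v0 -> forall i, i < s ->
     T' (K + i) = atape_of E (nth [::] [:: w1; w2] i) /\
     T' (K + s + i) = atape_of E (nth [::] [:: w3; w4] i)).
Proof.
move=> s2 v0 w1 w2 w3 w4.
pose T0 : tapes := fun i => atape_of E (nth [::] xs i); rewrite -/T0.
have T0b i : K <= i -> T0 i = blank.
  by move=> le; rewrite /T0 nth_default ?szxs // atape0.
set tot := \sum_(x <- xs) size x.
have M1 := @exec_mark E T0 nreg (T0b _ (leq_addr _ _)).
set T1 := upd T0 nreg (ctr 0) in M1.
have M2 := @exec_mark E T1 nreg.+1.
set T2 := upd T1 nreg.+1 (ctr 0) in M2.
have sumE : \sum_(k <- iota 0 K) size (nth [::] xs k) = tot.
  by rewrite /tot (big_nth [::]) szxs /index_iota subn0.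
have C1 := @exec_count_all T2 nreg f0 0 (iota 0 K).
rewrite sumE size_iota in C1.
set T3 := upd T2 nreg _ in C1.
have I1 := @exec_incs 8 nreg (8 * tot) T3.
rewrite upd_upd in I1; set T4 := upd T2 nreg _ in I1.
have N2 : 1 < bound by rewrite /bound; lia.
have Knreg : K <= nreg by rewrite /nreg leq_addr.
have H4 : ok K nreg bound xs f0 T4 (fun=> nreg.+1) v0.
  split.
  - by move=> k lt; rewrite /T4 /T2 /T1; upd_skip.
  - by rewrite /T4 updE.
  - by rewrite /f0.
  - by move=> k; rewrite /f0; lia.
  - by move=> k; rewrite /T4 /T2; upd_skip; rewrite updE.
  - by [].
  by rewrite /f0 => r le; rewrite /T4 /T2 /T1; upd_skip; apply: T0b; lia.
have M3 := @exec_mark E T4 f0 (ok_free H4 (leqnn _)).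
set T5 := upd T4 f0 (ctr 0) in M3.
have H5 : ok K nreg bound xs f0.+1 T5 (fun=> nreg.+1) v0.
  by apply: (ok_new Knreg szxs N2 _ H4); lia.
have C2 := @compile_ok E K nreg bound xs Knreg szxs N2 chk _ _ f0.+1 f0 _ H5 _ _ _.
set c := eval _ _ _ _ in C2 *.
set T6 := upd T5 f0 (ctr c) in C2.
have H6 : ok K nreg bound xs f0.+1 T6 (fun=> nreg.+1) v0.
  apply: (@ok_upd E K nreg bound xs Knreg szxs N2 f0.+1 _ _ _ _ _ _ H5); rewrite /f0; lia.
have Z := @exec_filled E T6 f0 c (updE _ _ _).
have O o t T : ok K nreg bound xs f0.+1 T (fun=> nreg.+1) v0 -> K <= t < nreg ->
    T t = blank ->
    exec (output o t f0.+1) T true (upd T t (atape_of E (outp bound xs o v0)))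
         (5 * outp_time bound o + 13) /\
    ok K nreg bound xs f0.+1 (upd T t (atape_of E (outp bound xs o v0))) (fun=> nreg.+1) v0.
  move=> H lt Tt; split; last first.
    by apply: ok_out => //.
  have P1 := @ocompile_ok E K nreg bound xs Knreg szxs N2 o _ _ _ _ [::] _ H lt.
  rewrite Tt otape0 in P1; have {}P1 := P1 erefl.
  have P2 := exec_rewind (updE T t (otape E ([::] ++ outp bound xs o v0))).
  rewrite upd_upd in P2; apply: (exec_to (exec_seq P1 P2)); first by [].
  have := @size_outp bound xs o v0 N2 (fun=> leq0n _).
  by rewrite cat0s; lia.
have [O1 H7] := O o1 K T6 H6 ltac:(rewrite /nreg; lia)
  ltac:(rewrite /T6 /T5 /T4 /T2 /T1 /f0 /nreg; upd_skip; apply: T0b; lia).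
set T7 := upd T6 K _ in O1 H7.
have [O2 H8] := O o2 K.+1 T7 H7 ltac:(rewrite /nreg; lia)
  ltac:(rewrite /T7 /T6 /T5 /T4 /T2 /T1 /f0 /nreg; upd_skip; apply: T0b; lia).
set T8 := upd T7 K.+1 _ in O2 H8.
have [O3 H9] := O o3 (K + s) T8 H8 ltac:(rewrite /nreg; lia)
  ltac:(rewrite /T8 /T7 /T6 /T5 /T4 /T2 /T1 /f0 /nreg; upd_skip; apply: T0b; lia).
set T9 := upd T8 (K + s) _ in O3 H9.
have [O4 _] := O o4 (K + s).+1 T9 H9 ltac:(rewrite /nreg; lia)
  ltac:(rewrite /T9 /T8 /T7 /T6 /T5 /T4 /T2 /T1 /f0 /nreg; upd_skip; apply: T0b; lia).
set T10 := upd T9 (K + s).+1 _ in O4.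
have B : exec (branch (filled E f0) (stop X)
    (seqm (output o1 K f0.+1) (seqm (output o2 K.+1 f0.+1)
    (seqm (output o3 (K + s) f0.+1) (output o4 (K + s).+1 f0.+1))))) T6 (0 < c)
    (if 0 < c then T10 else T6) (60 + 5 * (outp_time bound o1 + outp_time bound o2
     + outp_time bound o3 + outp_time bound o4)).
  case: (c) Z => [|c'] Z.
    by apply: exec_le (exec_branch Z (exec_stop _ 0)); lia.
  apply: exec_le (exec_branch Z (exec_seq O1 (exec_seq O2 (exec_seq O3 O4)))).
  lia.
exists (if 0 < c then T10 else T6); split.
  apply: (exec_to (exec_seq M1 (exec_seq (M2 _) (exec_seq (C1 _ _ _ _)
   (exec_seq (I1 _) (exec_seq M3 (exec_seq (C2 _ _ _) B))))))).
  - by rewrite /T1; upd_skip; apply: T0b; lia.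
  - by rewrite /f0; lia.
  - move=> k; rewrite mem_iota => lt; split; rewrite /f0 /T2 /T1; try lia.
    by upd_skip.
  - by rewrite /T2 /T1 /f0; upd_skip; apply: T0b; lia.
  - by rewrite /T2 /T1; upd_skip; rewrite updE.
  - by rewrite /T3 updE.
  - by rewrite /f0; lia.
  - by move=> k; rewrite /f0; lia.
  - by rewrite /T5 updE.
  - by [].
  by rewrite /driver_time -/tot -/bound; lia.
move=> -> i lt.
have Tb j : K <= j < nreg -> T6 j = blank.
  by move=> ltj; rewrite /T6 /T5 /T4 /T2 /T1 /f0; upd_skip; apply: T0b; lia.
split.
  rewrite /T10 upd_ne; last lia.
  rewrite /T9 upd_ne; last lia.
  case: i lt => [|[|i]] lt /=.
  - by rewrite addn0 /T8; upd_skip; rewrite /T7 updE.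
  - by rewrite addn1 /T8 updE.
  by rewrite nth_nil atape0 /T8 /T7; upd_skip; apply: Tb; rewrite /nreg; lia.
case: i lt => [|[|i]] lt /=.
- by rewrite addn0 /T10; upd_skip; rewrite /T9 updE.
- by rewrite addn1 /T10 updE.
by rewrite nth_nil atape0 /T10 /T9 /T8 /T7; upd_skip; apply: Tb; rewrite /nreg; lia.
Qed.

End Driver.

(** * Polynomial time *)

Definition polybound (f : nat -> nat) : Prop :=
  exists q : {poly nat}, forall n, f n <= q.[n]%R.

Lemma polybound_const c : polybound (fun=> c).
Proof. by exists (c%:P)%R => n; rewrite hornerC. Qed.

Lemma polybound_id : polybound id.
Proof. by exists ('X)%R => n; rewrite hornerX. Qed.

Lemma polybound_add f g :
  polybound f -> polybound g -> polybound (fun n => f n + g n).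
Proof.
by move=> [p Hp] [q Hq]; exists (p + q)%R => n; rewrite hornerD; apply: leq_add.
Qed.

Lemma polybound_mul f g :
  polybound f -> polybound g -> polybound (fun n => f n * g n).
Proof.
by move=> [p Hp] [q Hq]; exists (p * q)%R => n; rewrite hornerM; apply: leq_mul.
Qed.

Lemma polybound_le f g : (forall n, f n <= g n) -> polybound g -> polybound f.
Proof. by move=> H [q Hq]; exists q => n; apply: leq_trans (H n) (Hq n). Qed.

(** Coefficients are naturals, so there are no negative terms. Monotonicity is what makes time
    bounds composable. *)
Lemma horner_mono (q : {poly nat}) m n : m <= n -> (q.[m] <= q.[n])%N%R.
Proof.
move=> le; elim/poly_ind: q => [|q c IH]; first by rewrite !horner0.
by rewrite !hornerMXaddC leq_add // leq_mul.
Qed.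

Lemma polybound_comp f g :
  polybound f -> polybound g -> polybound (fun n => f (g n)).
Proof.
move=> [p Hp] [q Hq]; exists (p \Po q)%R => n; rewrite horner_comp.
exact: leq_trans (Hp _) (horner_mono p (Hq n)).
Qed.

Ltac polybound := repeat (apply: polybound_add || apply: polybound_mul
  || apply: polybound_const || apply: polybound_id || assumption).

Lemma polybound_eval_time e : polybound (fun n => eval_time n e).
Proof.
elim: e => /= [k|||e ?|k e ?|e ? a ? b ?|n ? z ? s ?|a ? b ?|r e ?] //;
by polybound.
Qed.

Lemma polybound_outp_time o : polybound (fun n => outp_time n o).
Proof.
elim: o => /= [e|a ? b ?|e a ?]; try have ? := polybound_eval_time e;
by polybound.
Qed.

(** * One machine simulating two runs of another *)

Section TwoRuns.
Variables (M : tm) (A : mach (bool + tm_extra M)) (d1 d2 : nat).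
Local Notation S := (option (bool + tm_extra M)).
Local Notation m := (tm_tapes M).
Hypothesis d12 : d1 + m <= d2.

Definition lookup (T : Type) (x0 : T) n (f : 'I_n -> T) (k : nat) : T :=
  if insub k is Some i then f i else x0.

Lemma lookupE (T : Type) (x0 : T) n (f : 'I_n -> T) (i : 'I_n) : lookup x0 f i = f i.
Proof. by rewrite /lookup valK. Qed.

(** A halted machine is made to step in place, rewriting what it scans, so that the two copies can
    advance together although one may halt earlier. *)
Definition mstep (q : tm_state M) (rd : 'I_m -> S) : tm_state M * ('I_m -> S * move) :=
  if tm_verdict q is Some _ then (q, fun i => (rd i, Stay))
  else let r := tm_trans q [ffun i => rd i] in (r.1, fun i => r.2 i).

Lemma astepE (c : aconfig M) : let r := mstep c.1 (fun i => ascan (c.2 i)) in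
  astep c = (r.1, fun i => aact (c.2 i) (r.2 i).1 (r.2 i).2).
Proof.
case: c => q a; rewrite /astep /mstep /=; case: (tm_verdict q) => [_|//] /=.
by congr pair; apply: functional_extensionality => i; rewrite aact_stay.
Qed.

(** [A] has finitely many states, each accessing one tape, so only finitely many of the tapes
    indexed by naturals are ever touched. *)
Definition ntapes := maxn (d2 + m) (\max_(q : st A) sel q).+1.

Lemma sel_lt (q : st A) : sel q < ntapes.
Proof. by rewrite leq_max ltnS (leq_bigmax q) orbT. Qed.

Definition tr_state := (st A + (tm_state M * tm_state M))%type.

Definition tr_verdict (q : tr_state) : option bool :=
  match q with
  | inl q => if out q is Some false then Some false else None
  | inr (q1, q2) => match tm_verdict q1, tm_verdict q2 with
                    | Some b1, Some b2 => Some (b1 && b2) | _, _ => None end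
  end.

Definition tr_trans (q : tr_state) (rd : {ffun 'I_ntapes -> S}) :
    tr_state * {ffun 'I_ntapes -> S * move} :=
  match q with
  | inl q =>
      if out q is Some _ then (inr (tm_start M, tm_start M), [ffun i => (rd i, Stay)])
      else let r := tr q (lookup None rd (sel q)) in
           (inl r.1, [ffun i : 'I_ntapes => if i == sel q :> nat then r.2 else (rd i, Stay)])
  | inr (q1, q2) =>
      let r1 := mstep q1 (fun i => lookup None rd (d1 + i)) in
      let r2 := mstep q2 (fun i => lookup None rd (d2 + i)) in
      (inr (r1.1, r2.1),
       [ffun i : 'I_ntapes =>
          if d2 <= i then lookup (rd i, Stay) r2.2 (i - d2)
          else if d1 <= i then lookup (rd i, Stay) r1.2 (i - d1) else (rd i, Stay)])
  end.

(* Runs [A]; if it accepts, runs two copies of [M] in parallel, on the tapes from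
   [d1] and from [d2] on, and accepts if both do. *)
Definition two_runs : tm :=
  @TM ntapes (tm_extra M) tr_state (inl (st0 A)) tr_verdict tr_trans.

Local Notation F := two_runs.
Local Notation tapes := (nat -> atape (bool + tm_extra M)).

Definition restr (T : tapes) : 'I_(tm_tapes F) -> atape (bool + tm_extra F) := fun i => T i.

Lemma astep_next (q : st A) (T : tapes) : out q = None ->
  @astep F (inl q, restr T) = (inl (mnext q T).1, restr (mnext q T).2).
Proof.
move=> oq; rewrite /astep /= oq.
have -> : lookup None [ffun i => ascan (restr T i)] (sel q) = ascan (T (sel q)).
  rewrite /lookup; case: insubP => [i _ <-|]; first by rewrite ffunE.
  by rewrite sel_lt.
congr pair; apply: functional_extensionality => i.
rewrite !ffunE /restr /mnext /upd /=; case: eqP => [->|_] //.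
by rewrite aact_stay.
Qed.

Lemma astep_switch (q : st A) b a : out q = Some b -> b ->
  @astep F (inl q, a) = (inr (tm_start M, tm_start M), a).
Proof.
move=> oq bT; rewrite /astep /= oq; case: b bT oq => // _ oq /=.
congr pair; apply: functional_extensionality => i.
by rewrite !ffunE aact_stay.
Qed.

Lemma reach_astep t (q : st A) T b T' : reach t q T b T' ->
  exists2 k, k <= t & exists2 q', out q' = Some b &
    iter k (@astep F) (inl q, restr T) = (inl q', restr T').
Proof.
elim: t q T => [|t IH] q T; case oq: (out q) => [b'|].
- by rewrite (reach_out _ _ _ _ oq) => -[<- <-]; exists 0 => //; exists q.
- by rewrite /= oq.
- by rewrite (reach_out _ _ _ _ oq) => -[<- <-]; exists 0 => //; exists q.
rewrite reach_next // => /IH [k le [q' oq' E]].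
by exists k.+1 => //; exists q' => //; rewrite iterSr astep_next.
Qed.

Definition twin (c : aconfig F) (c1 c2 : aconfig M) : Prop :=
  c.1 = inr (c1.1, c2.1) /\
  exists T : tapes, c.2 = restr T /\
    forall i : 'I_m, T (d1 + i) = c1.2 i /\ T (d2 + i) = c2.2 i.

Lemma twin_step c c1 c2 : twin c c1 c2 -> twin (astep c) (astep c1) (astep c2).
Proof.
case: c => q a [/= -> [T [/= -> H]]].
(* If both copies have a verdict, so does the combined machine, and all three stand still. Otherwise
   [mstep] keeps a copy in place that has halted already. *)
case v: (tr_verdict (inr (c1.1, c2.1))) => [b|].
  move: (v) => /=; case v1: (tm_verdict c1.1) => [b1|//].
  case v2: (tm_verdict c2.1) => [b2|//] _.
  have -> : astep c1 = c1 by rewrite /astep v1.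
  have -> : astep c2 = c2 by rewrite /astep v2.
  have -> : @astep F (inr (c1.1, c2.1), restr T) = (inr (c1.1, c2.1), restr T).
    by rewrite /astep /= v1 v2.
  by split=> //; exists T.
rewrite (astepE c1) (astepE c2).
have -> : @astep F (inr (c1.1, c2.1), restr T) =
    let r := tr_trans (inr (c1.1, c2.1)) [ffun i => ascan (restr T i)] in
    (r.1, fun i => aact (restr T i) (r.2 i).1 (r.2 i).2).
  by rewrite /astep -[tm_verdict _]/(tr_verdict _) v.
rewrite /=.
have rd1 : (fun i : 'I_m => lookup None [ffun i => ascan (restr T i)] (d1 + i)) =
    (fun i => ascan (c1.2 i)).
  apply: functional_extensionality => i; rewrite /lookup insubT ?ffunE => [|lt].
    by rewrite leq_max; apply/orP; left; have := ltn_ord i; lia.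
  by rewrite ffunE /restr /= (H i).1.
have rd2 : (fun i : 'I_m => lookup None [ffun i => ascan (restr T i)] (d2 + i)) =
    (fun i => ascan (c2.2 i)).
  apply: functional_extensionality => i; rewrite /lookup insubT ?ffunE => [|lt].
    by rewrite leq_max; apply/orP; left; have := ltn_ord i; lia.
  by rewrite ffunE /restr /= (H i).2.
rewrite rd1 rd2; set r1 := mstep _ _; set r2 := mstep _ _.
pose ac k := if d2 <= k then lookup (ascan (T k), Stay) r2.2 (k - d2)
  else if d1 <= k then lookup (ascan (T k), Stay) r1.2 (k - d1) else (ascan (T k), Stay).
split=> //=; exists (fun k => aact (T k) (ac k).1 (ac k).2); split.
  by apply: functional_extensionality => i; rewrite /restr !ffunE.
move=> i; have lt := ltn_ord i.
have -> : ac (d2 + i) = r2.2 i by rewrite /ac leq_addr addKn lookupE.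
have -> : ac (d1 + i) = r1.2 i.
  by rewrite /ac ifN ?leq_addr ?addKn ?lookupE // -ltnNge; lia.
by rewrite (H i).1 (H i).2.
Qed.

Lemma twin_iter n c c1 c2 : twin c c1 c2 ->
  twin (iter n (@astep F) c) (iter n (@astep M) c1) (iter n (@astep M) c2).
Proof. by move=> H; elim: n => //= n; apply: twin_step. Qed.

End TwoRuns.

Lemma astep_fixed (M : tm) n n' (c : aconfig M) b :
  tm_verdict (iter n (@astep M) c).1 = Some b -> n <= n' ->
  iter n' (@astep M) c = iter n (@astep M) c.
Proof.
move=> v /subnK <-; elim: (n' - n) => [//|k IH].
by rewrite addSn iterS IH /astep v.
Qed.

Lemma polytime_two_runs (k : nat) (V : seq bits -> Prop) (chk : expr)
    (o1 o2 o3 o4 : oprog) :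
  polytime 2 V ->
  polytime k (fun xs =>
    let N := 8 * (\sum_(x <- xs) size x) + 8 in
    let out o := outp N xs o (fun=> 0) in
    [/\ 0 < eval N xs chk (fun=> 0), V [:: out o1; out o2] & V [:: out o3; out o4]]).
Proof.
case=> M [q HM].
pose s := (tm_tapes M).+2.
pose A := driver (tm_extra M) k s chk o1 o2 o3 o4.
pose F := two_runs A k (k + s).
(* The sum over all four outputs bounds the input length of either run, so that both copies halt
   within the same number [q.[ob n]] of steps. *)
pose ob n := outp_time (8 * n + 8) o1 + outp_time (8 * n + 8) o2 +
             (outp_time (8 * n + 8) o3 + outp_time (8 * n + 8) o4).
(* The single step is the passage from the preparation to the two runs. *)
pose t n := driver_time k n chk o1 o2 o3 o4 + 1 + q.[ob n]%R.
have [p Hp] : polybound t.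
  rewrite /t /ob /driver_time.
  have lin : polybound (fun n => 8 * n + 8).
    by polybound.
  have pe e : polybound (fun n => eval_time (8 * n + 8) e).
    by apply: (polybound_comp (polybound_eval_time e) lin).
  have po o : polybound (fun n => outp_time (8 * n + 8) o).
    by apply: (polybound_comp (polybound_outp_time o) lin).
  have pq : polybound (fun n => q.[n]%R) by exists q.
  apply: polybound_add; last apply: (polybound_comp pq);
  by repeat (apply: polybound_add || apply: polybound_mul || apply: polybound_const
    || apply: polybound_id || apply: pe || apply: po).
exists F, p => xs szxs; set tot := \sum_(x <- xs) size x.
set N := 8 * tot + 8 => /=.
have N2 : 1 < N by rewrite /N; lia.
set w1 := outp N xs o1 _; set w2 := outp N xs o2 _.
set w3 := outp N xs o3 _; set w4 := outp N xs o4 _.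
have szw o : size (outp N xs o (fun=> 0)) <= outp_time N o by apply: size_outp.
have [T' [HA HT]] := @exec_driver (tm_extra M) k s xs szxs chk o1 o2 o3 o4 isT.
have [n1 le1 [q' oq' E]] := reach_astep k (k + s) HA.
have run n : (tm_run F n xs).1 = (iter n (@astep F) (inl (st0 A), restr (fun i => atape_of _ (nth [::] xs i)))).1.
  by case: (crep_run F n xs).
have letp : t tot <= p.[tot]%R by apply: Hp.
case chk0: (0 < eval N xs chk _) oq' HT => oq' HT; last first.
  exists false; split; last by split=> // -[].
  have v : tm_verdict (iter n1 (@astep F) (inl (st0 A), restr (fun i => atape_of _ (nth [::] xs i)))).1
      = Some false by rewrite E -[LHS]/(tr_verdict (inl q')) /tr_verdict oq'.
  rewrite run (astep_fixed v) //; apply: leq_trans le1 _; apply: leq_trans letp.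
  by rewrite /t -addnA leq_addr.
have E1 : iter n1.+1 (@astep F) (inl (st0 A), restr (fun i => atape_of _ (nth [::] xs i))) =
    (inr (tm_start M, tm_start M), restr T').
  by rewrite iterS E (astep_switch _ oq' isT).
have tw : @twin M A k (k + s) (inr (tm_start M, tm_start M), restr T')
   (ainit M [:: w1; w2]) (ainit M [:: w3; w4]).
  split=> //; exists T'; split=> // i.
  by apply: HT => //; rewrite /s; have := ltn_ord i; lia.
have [b1 [v1 HV1]] := HM [:: w1; w2] erefl.
have [b2 [v2 HV2]] := HM [:: w3; w4] erefl.
have runM n ys : (tm_run M n ys).1 = (iter n (@astep M) (ainit M ys)).1 by case: (crep_run M n ys).
rewrite runM in v1; rewrite runM in v2.
have le2 o o' : outp_time N o + outp_time N o' <= ob tot ->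
    leq q.[(\sum_(x <- [:: outp N xs o (fun=> 0); outp N xs o' (fun=> 0)]) size x)%N]%R
     q.[ob tot]%R.
  move=> le; apply: horner_mono; rewrite big_cons big_seq1; apply: leq_trans le.
  by apply: leq_add; apply: szw.
have F1 := astep_fixed v1 (le2 o1 o2 (leq_addr _ _)).
have F2 := astep_fixed v2 (le2 o3 o4 (leq_addl _ _)).
set n2 := q.[ob tot]%R in F1 F2.
have d12 : k + tm_tapes M <= k + s by rewrite /s; lia.
have [tw1 _] := twin_iter d12 n2 tw; rewrite F1 F2 in tw1.
exists (b1 && b2); split; last first.
  split; first by case/andP=> /HV1 ? /HV2 ?.
  by case=> _ /HV1 -> /HV2 ->.
have v : tm_verdict (iter (n2 + n1.+1) (@astep F)
    (inl (st0 A), restr (fun i => atape_of _ (nth [::] xs i)))).1 = Some (b1 && b2).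
  by rewrite iterD E1 tw1 /= v1 v2.
rewrite run (astep_fixed v) //; apply: leq_trans letp.
by rewrite /t addnC -/n2 leq_add2r addn1 ltnS.
Qed.

(** * Definable functions *)

(** The factor 8 leaves room for the states of the automaton that reads terms, which grow by at most
    7 per bit; the summand makes constants up to 8 available even for empty strings. *)
Definition bnd (xs : seq bits) : nat := 8 * (\sum_(x <- xs) size x) + 8.

Lemma bnd_gt1 xs : 1 < bnd xs. Proof. by rewrite /bnd; lia. Qed.

Definition str (xs : seq bits) k : bits := nth [::] xs k.

Lemma size_str xs k : 8 * size (str xs k) + 8 <= bnd xs.
Proof.
rewrite /bnd leq_add2r leq_mul2l /=; rewrite /str.
case: (ltnP k (size xs)) => lt; last by rewrite nth_default.
by rewrite (big_nth [::]) big_mkord (bigD1 (Ordinal lt)) //= leq_addr.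
Qed.

Local Notation valuation := (nat -> nat).

(** Recording only that an expression exists turns definability into a closure property: running
    time never has to be mentioned again. The expression needs to be right only on valuations within
    the bound. *)
Definition definable (f : seq bits -> valuation -> nat) : Prop :=
  exists e, forall xs v, (forall k, v k <= bnd xs) -> eval (bnd xs) xs e v = f xs v.

Lemma definable_ext f g : (forall xs v, (forall k, v k <= bnd xs) -> f xs v = g xs v) ->
  definable f -> definable g.
Proof. by move=> H [e He]; exists e => xs v Hv; rewrite He // H. Qed.

Lemma definable_le f xs v : definable f -> (forall k, v k <= bnd xs) -> f xs v <= bnd xs.
Proof. by case=> e He Hv; rewrite -He //; apply: eval_le => //; apply: bnd_gt1. Qed.

Lemma definable_var k : definable (fun xs v => v k).
Proof. by exists (Var k). Qed.

Lemma definable_bnd : definable (fun xs v => bnd xs).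
Proof. by exists Top. Qed.

Lemma definable_succ f : definable f -> definable (fun xs v => minn (bnd xs) (f xs v).+1).
Proof. by case=> e He; exists (Succ e) => xs v Hv /=; rewrite He. Qed.

Lemma definable_const c : c <= 8 -> definable (fun xs v => c).
Proof.
elim: c => [_|c IH lt]; first by exists Zero.
have := definable_succ (IH (ltnW lt)); apply: definable_ext => xs v _.
by rewrite /bnd; lia.
Qed.

Lemma definable_bit k f : definable f -> definable (fun xs v => bitv (str xs k) (f xs v)).
Proof. by case=> e He; exists (Bit k e) => xs v Hv /=; rewrite He. Qed.

Lemma definable_if (c : seq bits -> valuation -> bool) a b :
  definable (fun xs v => c xs v : nat) -> definable a -> definable b ->
  definable (fun xs v => if c xs v then a xs v else b xs v).
Proof.
move=> [ec Hc] [ea Ha] [eb Hb]; exists (If ec ea eb) => xs v Hv /=.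
by rewrite Hc // Ha // Hb //; case: (c xs v).
Qed.

Lemma definable_let f g : definable f -> definable g ->
  definable (fun xs v => g xs (f xs v .: v)).
Proof.
move=> df [eg Hg]; case: (df) => ef Hf; exists (Let ef eg) => xs v Hv /=.
by rewrite Hf // Hg // => -[|k] //=; apply: definable_le.
Qed.

Lemma definable_ren r f : definable f -> definable (fun xs v => f xs (fun k => v (r k))).
Proof. by move=> [e He]; exists (Ren r e) => xs v Hv /=; rewrite He. Qed.

Lemma definable_shift f : definable f -> definable (fun xs v => f xs (fun k => v k.+1)).
Proof. exact: (definable_ren succn). Qed.

Lemma definable1 (g : seq bits -> nat -> nat) f :
  definable (fun xs v => g xs (v 0)) -> definable f ->
  definable (fun xs v => g xs (f xs v)).
Proof. by move=> dg df; apply: (definable_let df dg). Qed.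

(** Definability shown for variables transfers to arbitrary arguments. The second argument is bound
    first, hence the shift in the first one. *)
Lemma definable2 (g : seq bits -> nat -> nat -> nat) f1 f2 :
  definable (fun xs v => g xs (v 0) (v 1)) -> definable f1 -> definable f2 ->
  definable (fun xs v => g xs (f1 xs v) (f2 xs v)).
Proof.
move=> dg d1 d2.
by apply: (definable_let d2 (definable_let (definable_shift d1) dg)).
Qed.

Lemma definable3 (g : seq bits -> nat -> nat -> nat -> nat) f1 f2 f3 :
  definable (fun xs v => g xs (v 0) (v 1) (v 2)) ->
  definable f1 -> definable f2 -> definable f3 ->
  definable (fun xs v => g xs (f1 xs v) (f2 xs v) (f3 xs v)).
Proof.
move=> dg d1 d2 d3.
exact: (definable_let d3 (definable_let (definable_shift d2)
  (definable_let (definable_shift (definable_shift d1)) dg))).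
Qed.

(** The step is known to be right only for values within the bound, so the accumulators have to be
    bounded along the way; this already follows from the definability of the step. *)
Lemma definable_rec (n z : seq bits -> valuation -> nat) s :
  definable n -> definable z ->
  definable (fun xs v => s xs (v 0) (v 1) (fun k => v k.+2)) ->
  definable (fun xs v => iteri (n xs v) (fun i a => s xs i a v) (z xs v)).
Proof.
move=> dn dz ds; case: (dn) => en Hn; case: (dz) => ez Hz; case: (ds) => es Hs.
exists (Rec en ez es) => xs v Hv /=; rewrite Hn // Hz //.
have lt0 : n xs v <= bnd xs by apply: definable_le.
pose acc m := iteri m (fun i a => s xs i a v) (z xs v).
have Hacc m : m <= n xs v -> acc m <= bnd xs.
  elim: m => [|m IH] lt; first exact: (definable_le dz Hv).
  have Hv' k : (m .: acc m .: v) k <= bnd xs.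
    by case: k => [|[|k]] /=; [lia | apply: IH; lia | apply: Hv].
  exact: (definable_le ds Hv').
rewrite -/(acc (n xs v)); elim: (n xs v) Hacc lt0 => [//|m IH] Hacc lt0.
rewrite iteriS (IH (fun k le => Hacc k (leqW le)) (ltnW lt0)).
have Hv' k : (m .: acc m .: v) k <= bnd xs.
  by case: k => [|[|k]] /=; [lia | apply: Hacc; lia | apply: Hv].
exact: (Hs xs _ Hv').
Qed.

Lemma definable_pred f : definable f -> definable (fun xs v => (f xs v).-1).
Proof.
move=> df; apply: (definable1 (g := fun _ n => n.-1)) df.
(* The predecessor of [n] is the last index of a loop with [n] rounds, and 0 if there is no
   round. *)
have := definable_rec (s := fun _ i _ _ => i) (definable_var 0)
  (@definable_const 0 isT) (definable_var 0).
by apply: definable_ext => xs v _; case: (v 0) => //= n; elim: n.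
Qed.

Lemma definable_sub f g : definable f -> definable g ->
  definable (fun xs v => f xs v - g xs v).
Proof.
apply: definable2 (fun _ n m => n - m) _ _ _.
have := definable_rec (s := fun _ _ a _ => a.-1) (definable_var 1)
  (definable_var 0) (definable_pred (definable_var 1)).
apply: definable_ext => xs v _; elim: (v 1) => [|m IH] /=; first by rewrite subn0.
by rewrite IH subnS.
Qed.

Lemma definable_le_op f g : definable f -> definable g ->
  definable (fun xs v => (f xs v <= g xs v)%N : nat).
Proof.
move=> df dg; have := definable_sub (@definable_const 1 isT) (definable_sub df dg).
by apply: definable_ext => xs v _; rewrite /leq; case: (f xs v - g xs v).
Qed.

Lemma definable_lt_op f g : definable f -> definable g ->
  definable (fun xs v => (f xs v < g xs v)%N : nat).
Proof.
move=> df dg; have := definable_sub (@definable_const 1 isT)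
  (definable_sub (@definable_const 1 isT) (definable_sub dg df)).
by apply: definable_ext => xs v _; rewrite -subn_gt0; case: (g xs v - f xs v) => [|[]].
Qed.

Lemma definable_not (p : seq bits -> valuation -> bool) :
  definable (fun xs v => p xs v : nat) -> definable (fun xs v => ~~ p xs v : nat).
Proof.
move=> dp; have := definable_sub (@definable_const 1 isT) dp.
by apply: definable_ext => xs v _; case: (p xs v).
Qed.

Section Connectives.
Variables p q : seq bits -> valuation -> bool.
Hypothesis dp : definable (fun xs v => p xs v : nat).
Hypothesis dq : definable (fun xs v => q xs v : nat).

Lemma definable_and : definable (fun xs v => p xs v && q xs v : nat).
Proof.
have := definable_if dp dq (@definable_const 0 isT).
by apply: definable_ext => xs v _; case: (p xs v).
Qed.

Lemma definable_or : definable (fun xs v => p xs v || q xs v : nat).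
Proof.
have := definable_if dp (@definable_const 1 isT) dq.
by apply: definable_ext => xs v _; case: (p xs v).
Qed.

Lemma definable_imp : definable (fun xs v => (p xs v ==> q xs v) : nat).
Proof.
have := definable_if dp dq (@definable_const 1 isT).
by apply: definable_ext => xs v _; case: (p xs v).
Qed.

End Connectives.

Lemma definable_eq f g : definable f -> definable g ->
  definable (fun xs v => (f xs v == g xs v) : nat).
Proof.
move=> df dg; have := definable_and (definable_le_op df dg) (definable_le_op dg df).
by apply: definable_ext => xs v _; rewrite eqn_leq.
Qed.

Lemma definable_add f g : definable f -> definable g ->
  definable (fun xs v => minn (bnd xs) (f xs v + g xs v)).
Proof.
move=> df dg; apply: (definable2 (g := fun xs n m => minn (bnd xs) (n + m))) df dg.
have := definable_rec (s := fun xs _ a _ => minn (bnd xs) a.+1) (definable_var 1)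
  (definable_var 0) (definable_succ (definable_var 1)).
apply: definable_ext => xs v Hv; have := Hv 0.
by elim: (v 1) => [|m IH] le /=; [|rewrite IH //]; lia.
Qed.

Lemma definable_mul f g : definable f -> definable g ->
  definable (fun xs v => minn (bnd xs) (f xs v * g xs v)).
Proof.
move=> df dg; apply: (definable2 (g := fun xs n m => minn (bnd xs) (n * m))) df dg.
have := definable_rec (s := fun xs _ a v => minn (bnd xs) (a + v 0)) (definable_var 1)
  (@definable_const 0 isT) (definable_add (definable_var 1) (definable_var 2)).
apply: definable_ext => xs v Hv; elim: (v 1) => [|m IH] /=; first by lia.
by rewrite IH mulnS; lia.
Qed.

Lemma iotaSr m : iota 0 m.+1 = iota 0 m ++ [:: m].
Proof. by rewrite -addn1 iotaD. Qed.

Lemma definable_has (n : seq bits -> valuation -> nat) (p : seq bits -> nat -> valuation -> bool) :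
  definable n -> definable (fun xs v => p xs (v 0) (fun k => v k.+1) : nat) ->
  definable (fun xs v => has (fun i => p xs i v) (iota 0 (n xs v)) : nat).
Proof.
move=> dn dp.
(* In the loop body variable 1 is the accumulator, which [p] does not know; the renaming skips
   it. *)
have dp2 : definable (fun xs v => p xs (v 0) (fun k => v k.+2) : nat).
  exact: (definable_ren (fun k => if k is k'.+1 then k.+1 else 0) dp).
have := definable_rec (s := fun xs i a v => (0 < a) || p xs i v) dn (@definable_const 0 isT)
  (definable_or (definable_lt_op (@definable_const 0 isT) (definable_var 1)) dp2).
apply: definable_ext => xs v _; elim: (n xs v) => [//|m IH].
by rewrite iteriS iotaSr has_cat IH lt0b /= orbF.
Qed.

Lemma definable_all (n : seq bits -> valuation -> nat) (p : seq bits -> nat -> valuation -> bool) :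
  definable n -> definable (fun xs v => p xs (v 0) (fun k => v k.+1) : nat) ->
  definable (fun xs v => all (fun i => p xs i v) (iota 0 (n xs v)) : nat).
Proof.
move=> dn dp; have := definable_not (definable_has (p := fun xs i v => ~~ p xs i v)
  dn (definable_not dp)).
apply: definable_ext => xs v _.
by rewrite -all_predC; congr nat_of_bool; apply: eq_all => i /=; rewrite negbK.
Qed.

Lemma definable_count (n : seq bits -> valuation -> nat) (p : seq bits -> nat -> valuation -> bool) :
  definable n -> definable (fun xs v => p xs (v 0) (fun k => v k.+1) : nat) ->
  definable (fun xs v => count (fun i => p xs i v) (iota 0 (n xs v))).
Proof.
move=> dn dp.
have dp2 : definable (fun xs v => p xs (v 0) (fun k => v k.+2) : nat).
  exact: (definable_ren (fun k => if k is k'.+1 then k.+1 else 0) dp).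
have := definable_rec (s := fun xs i a v => minn (bnd xs) (a + p xs i v)) dn
  (@definable_const 0 isT) (definable_add (definable_var 1) dp2).
apply: definable_ext => xs v Hv; have := definable_le dn Hv.
elim: (n xs v) => [//|m IH] lt.
rewrite iteriS iotaSr (IH (ltnW lt)) count_cat /= addn0.
have := count_size (fun i => p xs i v) (iota 0 m); rewrite size_iota => le.
by apply/minn_idPr; case: (p xs _ v); lia.
Qed.

(** The accumulator follows the loop index until the first hit and then stops, so equality of the
    two says that nothing has been found yet. *)
Lemma definable_find (n : seq bits -> valuation -> nat) (p : seq bits -> nat -> valuation -> bool) :
  definable n -> definable (fun xs v => p xs (v 0) (fun k => v k.+1) : nat) ->
  definable (fun xs v => find (fun i => p xs i v) (iota 0 (n xs v))).
Proof.
move=> dn dp.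
have dp2 : definable (fun xs v => p xs (v 0) (fun k => v k.+2) : nat).
  exact: (definable_ren (fun k => if k is k'.+1 then k.+1 else 0) dp).
have := definable_rec (s := fun xs i a v => if (a == i) && ~~ p xs i v
     then minn (bnd xs) a.+1 else a) dn
  (@definable_const 0 isT) (definable_if (definable_and (definable_eq (definable_var 1) (definable_var 0))
    (definable_not dp2)) (definable_succ (definable_var 1)) (definable_var 1)).
apply: definable_ext => xs v Hv; have := definable_le dn Hv.
elim: (n xs v) => [//|m IH] lt.
rewrite iteriS iotaSr (IH (ltnW lt)) find_cat.
have := has_find (fun i => p xs i v) (iota 0 m); rewrite size_iota => e.
have := find_size (fun i => p xs i v) (iota 0 m); rewrite size_iota => le.
set F := find _ _ in e le *; rewrite e.
case: (ltnP F m) => [ltF|geF]; first by rewrite (ltn_eqF ltF).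
have -> : F = m by lia.
by rewrite eqxx /=; case: (p xs m v) => /=; lia.
Qed.

(** The bound lies beyond the end of every string, so a saturated position reads 0 just as the true
    one does. This permits plain sums as positions. *)
Lemma bitv_sat xs k i : bitv (str xs k) (minn (bnd xs) i) = bitv (str xs k) i.
Proof.
have := size_str xs k; rewrite /bitv => le.
case: (leqP (bnd xs) i) => [lei|]; last by [].
by rewrite !ifN //; lia.
Qed.

Lemma definable_bit_add k f g : definable f -> definable g ->
  definable (fun xs v => bitv (str xs k) (f xs v + g xs v)).
Proof.
move=> df dg; have := definable_bit k (definable_add df dg).
by apply: definable_ext => xs v _; rewrite bitv_sat.
Qed.

Lemma definable_mod4 f : definable f -> definable (fun xs v => f xs v %% 4).
Proof.
move=> df; apply: (definable1 (g := fun _ n => n %% 4)) df.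
have := definable_rec (s := fun xs _ a _ => if a == 3 then 0 else minn (bnd xs) a.+1)
  (definable_var 0) (@definable_const 0 isT)
  (definable_if (definable_eq (definable_var 1) (@definable_const 3 isT))
    (@definable_const 0 isT) (definable_succ (definable_var 1))).
apply: definable_ext => xs v _; elim: (v 0) => [//|n IH]; rewrite iteriS IH.
have : n %% 4 < 4 by rewrite ltn_mod.
by rewrite -[n.+1]addn1 -modnDml /bnd; set s := \sum_(_ <- _) _; case: (n %% 4) => [|[|[|[|]]]] // _; rewrite /= ?modn_small; lia.
Qed.

Definition definable_out (f : seq bits -> valuation -> bits) : Prop :=
  exists o, forall xs v, (forall k, v k <= bnd xs) -> outp (bnd xs) xs o v = f xs v.

Lemma definable_out_ext f g : (forall xs v, f xs v = g xs v) ->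
  definable_out f -> definable_out g.
Proof. by move=> H [o Ho]; exists o => xs v Hv; rewrite Ho // H. Qed.

Lemma definable_emit f : definable f -> definable_out (fun xs v => sym_bits (f xs v)).
Proof. by move=> [e He]; exists (Emit e) => xs v Hv /=; rewrite He. Qed.

Lemma definable_cat f g : definable_out f -> definable_out g ->
  definable_out (fun xs v => f xs v ++ g xs v).
Proof. by move=> [o Ho] [o' Ho']; exists (Cat o o') => xs v Hv /=; rewrite Ho ?Ho'. Qed.

Lemma definable_for n (f : seq bits -> nat -> valuation -> bits) :
  definable n -> definable_out (fun xs v => f xs (v 0) (fun k => v k.+1)) ->
  definable_out (fun xs v => flatten [seq f xs i v | i <- iota 0 (n xs v)]).
Proof.
move=> dn [o Ho]; case: (dn) => e He; exists (For e o) => xs v Hv /=; rewrite He //.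
have := definable_le dn Hv => le.
congr flatten; apply/eq_in_map => i; rewrite mem_iota => lt.
by rewrite Ho // => -[|k] /=; [lia | apply: Hv].
Qed.

Lemma definable_out_const b : definable_out (fun xs v => [:: b]).
Proof.
have := definable_emit (@definable_const b.+1 (ltac:(by case: b))).
by apply: definable_out_ext => xs v; case: b.
Qed.

(** A conditional is a loop with 0 or 1 rounds; the loop variable accounts for the shift. *)
Lemma definable_when (c : seq bits -> valuation -> bool) (f : seq bits -> valuation -> bits) :
  definable (fun xs v => c xs v : nat) ->
  definable_out (fun xs v => f xs (fun k => v k.+1)) ->
  definable_out (fun xs v => if c xs v then f xs v else [::]).
Proof.
move=> dc df; have := definable_for (f := fun xs _ v => f xs v) dc df.
by apply: definable_out_ext => xs v; case: (c xs v); rewrite //= cats0.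
Qed.

Lemma slice_cat (w : bits) a n :
  flatten [seq sym_bits (bitv w (a + i)) | i <- iota 0 n] = take n (drop a w).
Proof.
elim: n => [|n IH]; first by rewrite take0.
rewrite iotaSr map_cat flatten_cat IH /= cats0 /bitv.
case: ltnP => lt; last first.
  by rewrite cats0 !take_oversize // size_drop; lia.
rewrite (take_nth false) ?size_drop; last lia.
by rewrite nth_drop -cats1; case: nth.
Qed.

Lemma definable_slice k a n : definable a -> definable n ->
  definable_out (fun xs v => take (n xs v) (drop (a xs v) (str xs k))).
Proof.
move=> da dn.
have := definable_for (f := fun xs i v => sym_bits (bitv (str xs k) (a xs v + i))) dn
  (definable_emit (definable_bit_add k (definable_shift da) (definable_var 0))).
by apply: definable_out_ext => xs v; rewrite slice_cat.
Qed.

Lemma polytime_definable (n : nat) (V : seq bits -> Prop) chk f1 f2 f3 f4 :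
  polytime 2 V -> definable (fun xs v => nat_of_bool (chk xs v)) ->
  definable_out f1 -> definable_out f2 -> definable_out f3 -> definable_out f4 ->
  let v0 := fun=> 0 in
  polytime n (fun xs => [/\ chk xs v0, V [:: f1 xs v0; f2 xs v0] & V [:: f3 xs v0; f4 xs v0]]).
Proof.
move=> HV [e He] [o1 H1] [o2 H2] [o3 H3] [o4 H4] v0.
have [M [q HM]] := polytime_two_runs n e o1 o2 o3 o4 HV.
exists M, q => xs szxs; have [b [v Hb]] := HM xs szxs; exists b; split=> //.
by move: Hb; rewrite /= -/(bnd xs) He ?H1 ?H2 ?H3 ?H4 // lt0b.
Qed.

Lemma definable_min f : definable f -> definable (fun xs v => minn (bnd xs) (f xs v)).
Proof.
move=> df; have := definable_add df (@definable_const 0 isT).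
by apply: definable_ext => xs v _; rewrite addn0.
Qed.

Lemma definable_ifb (c p q : seq bits -> valuation -> bool) :
  definable (fun xs v => c xs v : nat) -> definable (fun xs v => p xs v : nat) ->
  definable (fun xs v => q xs v : nat) ->
  definable (fun xs v => (if c xs v then p xs v else q xs v) : nat).
Proof.
move=> dc dp dq; have := definable_if dc dp dq.
by apply: definable_ext => xs v _; case: (c xs v).
Qed.

Ltac definable_user := fail.

(* Goals are matched syntactically: unification would unfold the defined functions. *)
Ltac definable_step :=
  cbv beta;
  first
  [ match goal with
    | H : definable ?f |- definable ?g => let f' := eval cbv beta in f in constr_eq f' g; exact H
    end
  | lazymatch goal with
    | |- definable (fun xs v => v ?k) => exact (definable_var k)
    | |- definable (fun xs v => bnd xs) => exact definable_bnd
    | |- definable (fun xs v => bitv (str xs ?k) (@?f xs v + @?g xs v)) =>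
        refine (@definable_bit_add k f g _ _)
    | |- definable (fun xs v => bitv (str xs ?k) (@?f xs v)) => refine (@definable_bit k f _)
    | |- definable (fun xs v => nat_of_bool (@?f xs v < @?g xs v)) =>
        refine (@definable_lt_op f g _ _)
    | |- definable (fun xs v => nat_of_bool (@?f xs v <= @?g xs v)) =>
        refine (@definable_le_op f g _ _)
    | |- definable (fun xs v => nat_of_bool (@?p xs v && @?q xs v)) =>
        refine (@definable_and p q _ _)
    | |- definable (fun xs v => nat_of_bool (@?p xs v || @?q xs v)) =>
        refine (@definable_or p q _ _)
    | |- definable (fun xs v => nat_of_bool (@?p xs v ==> @?q xs v)) =>
        refine (@definable_imp p q _ _)
    | |- definable (fun xs v => nat_of_bool (~~ @?p xs v)) => refine (@definable_not p _)
    | |- definable (fun xs v => nat_of_bool (@?f xs v == @?g xs v)) =>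
        refine (@definable_eq f g _ _)
    | |- definable (fun xs v => nat_of_bool (has (fun i => @?p xs v i) (iota 0 (@?n xs v)))) =>
        refine (@definable_has n (fun xs i v => p xs v i) _ _)
    | |- definable (fun xs v => nat_of_bool (all (fun i => @?p xs v i) (iota 0 (@?n xs v)))) =>
        refine (@definable_all n (fun xs i v => p xs v i) _ _)
    | |- definable (fun xs v => count (fun i => @?p xs v i) (iota 0 (@?n xs v))) =>
        refine (@definable_count n (fun xs i v => p xs v i) _ _)
    | |- definable (fun xs v => find (fun i => @?p xs v i) (iota 0 (@?n xs v))) =>
        refine (@definable_find n (fun xs i v => p xs v i) _ _)
    | |- definable (fun xs v => minn (bnd xs) (@?f xs v).+1) => refine (@definable_succ f _)
    | |- definable (fun xs v => minn (bnd xs) (@?f xs v + @?g xs v)) =>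
        refine (@definable_add f g _ _)
    | |- definable (fun xs v => minn (bnd xs) (@?f xs v * @?g xs v)) =>
        refine (@definable_mul f g _ _)
    | |- definable (fun xs v => minn (bnd xs) (@?f xs v)) => refine (@definable_min f _)
    | |- definable (fun xs v => @?f xs v - @?g xs v) => refine (@definable_sub f g _ _)
    | |- definable (fun xs v => @?f xs v %% 4) => refine (@definable_mod4 f _)
    | |- definable (fun xs v => nat_of_bool (@?p xs v)) =>
        first [definable_user | apply: definable_ifb]
    | |- definable (fun xs v => S ?c) => exact (@definable_const (S c) isT)
    | |- definable (fun xs v => 0) => exact (@definable_const 0 isT)
    | |- _ => first [definable_user | apply: definable_if]
    end
  | assumption ].

Ltac definable := repeat definable_step.

(** * Reading codes *)

Definition prefix_code (T : Type) (f : T -> bits) : Prop :=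
  forall x y z z', f x ++ z = f y ++ z' -> x = y /\ z = z'.

Lemma prefix_code_seq (T : Type) (f : T -> bits) :
  prefix_code f -> prefix_code (enc_seq f).
Proof.
move=> pf; elim=> [|x s IH] [|y s'] z z' //=; first by case.
rewrite -!catA => -[/pf [<- /IH [<- <-]]]; by [].
Qed.

Lemma prefix_code_bits : prefix_code enc_bits.
Proof. by apply: prefix_code_seq => x y z z' /= [-> ->]. Qed.

Lemma prefix_code_term : prefix_code enc_term.
Proof.
(* Terms are nested in lists, so the induction is a guarded fixpoint, called on the members of a
   list inside an induction on that list. *)
rewrite /prefix_code; fix IH 1 => -[w|ts] [w'|ts'] z z' //= [].
  by case/prefix_code_bits=> -> ->.
suff H : forall us, enc_seq enc_term ts ++ z = enc_seq enc_term us ++ z' ->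
    ts = us /\ z = z' by move=> /H [-> ->].
elim: ts {ts'} => [|t ts IHts] [|u us] //=; first by case.
by rewrite -!catA => -[/IH [<- /IHts [<- <-]]].
Qed.

Lemma enc_term_neq0 t : enc_term t <> [::].
Proof. by case: t. Qed.

Lemma prefix_code_celem : prefix_code enc_celem.
Proof.
move=> [j t] [j' t'] z z'; rewrite /enc_celem /= -!catA.
elim: j j' => [|j IH] [|j'] //=; first by case=> /prefix_code_term [-> ->].
by case=> /IH [[-> ->] ->].
Qed.

Lemma enc_seqE (T : Type) (f : T -> bits) s :
  enc_seq f s = flatten [seq true :: f x | x <- s] ++ [:: false].
Proof. by elim: s => //= x s ->; rewrite catA. Qed.

(* The automaton reading a term: in state [4 * d + m] there are [d] unfinished
   tuples, and what comes next is a term ([m = 0]), the presence flag of a bit of a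
   name ([m = 1]), that bit ([m = 2]), or the presence flag of a component
   ([m = 3]). State [3] is reached when the term is complete. *)
Definition pstep (s b : nat) : nat :=
  if b == 0 then s else
  if s %% 4 == 0 then (if b == 1 then s + 1 else s + 7) else
  if s %% 4 == 1 then (if b == 1 then s + 2 else s + 1) else
  if s %% 4 == 2 then s - 1 else (if b == 1 then s - 4 else s - 3).

Arguments pstep : simpl never.

Definition lrun (s : nat) (w : bits) : nat := foldl (fun s (b : bool) => pstep s b.+1) s w.

Lemma lrun_cat s w w' : lrun s (w ++ w') = lrun (lrun s w) w'.
Proof. exact: foldl_cat. Qed.

Lemma lrun_le s w : lrun s w <= s + 7 * size w.
Proof.
elim: w s => [|b w IH] s /=; first lia.
apply: leq_trans (IH _) _; suff : pstep s b.+1 <= s + 7 by lia.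
by rewrite /pstep; case: ifP => // _; do !case: ifP => _; lia.
Qed.

Lemma pstepT d (b : bool) : pstep (4 * d) b.+1 = if b then 4 * d.+1 + 3 else 4 * d + 1.
Proof. by rewrite /pstep mulnC modnMl; case: b => /=; lia. Qed.

Lemma pstepB d (b : bool) : pstep (4 * d + 1) b.+1 = if b then 4 * d + 2 else 4 * d + 3.
Proof. by rewrite /pstep mulnC modnMDl; case: b => /=; lia. Qed.

Lemma pstepb d (b : bool) : pstep (4 * d + 2) b.+1 = 4 * d + 1.
Proof. by rewrite /pstep mulnC modnMDl; case: b => /=; lia. Qed.

Lemma pstepS d (b : bool) : pstep (4 * d.+1 + 3) b.+1 = if b then 4 * d.+1 else 4 * d + 3.
Proof. by rewrite /pstep mulnC modnMDl; case: b => /=; lia. Qed.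

Fixpoint states (s : nat) (w : bits) : seq nat :=
  if w is b :: w' then s :: states (pstep s b.+1) w' else [::].

Lemma size_states s w : size (states s w) = size w.
Proof. by elim: w s => //= b w IH s; rewrite IH. Qed.

Lemma states_cat s w w' : states s (w ++ w') = states s w ++ states (lrun s w) w'.
Proof. by elim: w s => //= b w IH s; rewrite IH. Qed.

Lemma nth_states s w i : i < size w -> nth 0 (states s w) i = lrun s (take i w).
Proof. by elim: w s i => //= b w IH s [|i] //= lt; rewrite IH. Qed.

(** A state divisible by four announces a term, so [Q] is tried on exactly those of the first [n]
    suffixes at which a term begins. *)
Fixpoint scan (Q : bits -> bool) (s : nat) (w : bits) (n : nat) : bool :=
  if n is n'.+1 then
    if w is b :: w' then ((s %% 4 == 0) && Q w) || scan Q (pstep s b.+1) w' n' else false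
  else false.

Lemma scan_has Q s w n : n <= size w ->
  scan Q s w n = has (fun i => (lrun s (take i w) %% 4 == 0) && Q (drop i w)) (iota 0 n).
Proof.
elim: n s w => [|n IH] s w; first by case: w.
case: w => [//|b w] le /=.
rewrite IH // -[1]addn0 iotaDl has_map; congr (_ || _).
Qed.

(** Stated for every depth [d], as the induction on terms requires. The second clause says that the
    final state is not met too early; in the third, reading starts after the first bit, since a term
    is not among its constituents. *)
Definition term_spec (t : term) : Prop := forall d,
  [/\ lrun (4 * d) (enc_term t) = 4 * d + 3,
      all (fun s => (4 * d <= s) && (s != 4 * d + 3)) (states (4 * d) (enc_term t)) &
      forall u (Q : bits -> bool) (P : pred term),
        (forall pre r z, u = pre ++ enc_term r ++ z -> Q (enc_term r ++ z) = P r) ->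
        forall pre z n, u = pre ++ enc_term t ++ z ->
        scan Q (lrun (4 * d) (take 1 (enc_term t))) (behead (enc_term t) ++ z)
          ((size (enc_term t)).-1 + n) =
        has P (constituents t) || scan Q (4 * d + 3) z n].

Lemma bits_spec d w :
  [/\ lrun (4 * d + 1) (enc_bits w) = 4 * d + 3,
      all (fun s => (4 * d <= s) && (s != 4 * d + 3)) (states (4 * d + 1) (enc_bits w)) &
      forall Q z n, scan Q (4 * d + 1) (enc_bits w ++ z) (size (enc_bits w) + n) =
        scan Q (4 * d + 3) z n].
Proof.
have e1 : ((4 * d + 1) %% 4 == 0) = false by rewrite mulnC modnMDl.
have e2 : ((4 * d + 2) %% 4 == 0) = false by rewrite mulnC modnMDl.
elim: w => [|b w [IH1 IH2 IH3]].
  by rewrite /= (pstepB d false) /= e1; split=> //; lia.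
rewrite /= (pstepB d true) /= pstepb IH1 IH2; split=> //; first lia.
by move=> Q z n /=; rewrite e1 e2 /= IH3.
Qed.

Lemma term_specP t : term_spec t.
Proof.
move: t; fix IH 1 => -[w|ts] d.
  have [H1 H2 H3] := bits_spec d w.
  rewrite [enc_term _]/= /= (pstepT d false) H1 H2; split=> //; first lia.
  by move=> u Q P HQ pre z n eu; rewrite take0 /= H3.
(* For the components of an opened tuple the states stay at or above [4 * d.+1], so [4 * d + 3] is
   not met before the tuple closes. *)
have [H1 H2 H3] : [/\ lrun (4 * d.+1 + 3) (enc_seq enc_term ts) = 4 * d + 3,
      all (fun s => 4 * d.+1 <= s) (states (4 * d.+1 + 3) (enc_seq enc_term ts)) &
      forall u (Q : bits -> bool) (P : pred term),
        (forall pre r z, u = pre ++ enc_term r ++ z -> Q (enc_term r ++ z) = P r) ->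
        forall pre z n, u = pre ++ enc_seq enc_term ts ++ z ->
        scan Q (4 * d.+1 + 3) (enc_seq enc_term ts ++ z) (size (enc_seq enc_term ts) + n) =
        has P (flatten (map subterms ts)) || scan Q (4 * d + 3) z n].
  have e3 : ((4 * d.+1 + 3) %% 4 == 0) = false by rewrite mulnC modnMDl.
  elim: ts => [|t ts [IH1 IH2 IH3]].
    by rewrite /= (pstepS d false); split=> // [|u Q P _ pre z n _]; rewrite /= ?e3; [lia|].
  have [T1 T2 T3] := IH t d.+1.
  rewrite /= (pstepS d true) lrun_cat T1 IH1 states_cat all_cat T1 IH2; split=> //.
    rewrite andbT; apply/andP; split; first lia.
    by apply: sub_all T2 => s /andP[].
  move=> u Q P HQ pre z n eu /=; rewrite e3 /= -catA size_cat -addnA.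
  have eu1 : u = rcons pre true ++ enc_term t ++ (enc_seq enc_term ts ++ z).
    by rewrite eu cat_rcons -!catA.
  have eu2 : u = (rcons pre true ++ enc_term t) ++ enc_seq enc_term ts ++ z.
    by rewrite eu1 -!catA.
  have e0 : (4 * d.+1) %% 4 = 0 by rewrite mulnC modnMl.
  have Qt := HQ _ _ _ eu1.
  have := T3 u Q P HQ _ _ (size (enc_seq enc_term ts) + n) eu1.
  rewrite has_cat (IH3 u Q P HQ _ _ _ eu2).
  (* The component itself is tested at its first bit; its constituents are left to the recursive
     call. *)
  have -> : has P (subterms t) = P t || has P (constituents t) by case: (t).
  rewrite -orbA -orbA => <-; rewrite -Qt.
  by case: (enc_term t) (@enc_term_neq0 t) => //= b w _; rewrite e0 take0.
rewrite [enc_term _]/= /= (pstepT d true) H1; split=> //.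
  apply/andP; split; first lia.
  by apply: sub_all H2 => s le; apply/andP; split; lia.
move=> u Q P HQ pre z n eu; rewrite take0 /=; apply: (H3 u Q P HQ (rcons pre true)).
by rewrite eu cat_rcons.
Qed.

(** The state determines what is still to come: the item that the residue announces, then for each
    unfinished tuple the list of its remaining components. Prepending one bit at a time shows that a
    string on which state 3 first appears at the end is a code. *)
Lemma states_inv w s : lrun s w = 3 -> all (fun s => s != 3) (states s w) ->
  exists2 tss : seq (seq term), size tss = s %/ 4 &
  let z := flatten (map (enc_seq enc_term) tss) in
  match s %% 4 with
  | 0 => exists t, w = enc_term t ++ z
  | 1 => exists b, w = enc_bits b ++ z
  | 2 => exists c b, w = c :: enc_bits b ++ z
  | _ => w = z
  end.
Proof.
have dv k r : r < 4 -> (4 * k + r) %/ 4 = k by lia.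
have md k r : r < 4 -> (4 * k + r) %% 4 = r by lia.
have dv0 k : (4 * k) %/ 4 = k by lia.
have md0 k : (4 * k) %% 4 = 0 by lia.
elim: w s => [|b w IH] s /=; first by move=> -> _; exists [::].
move=> H /andP[s3 Hall]; have {H Hall} := IH _ H Hall.
have [d [m [lt es]]] : exists d m, m < 4 /\ s = 4 * d + m.
  by exists (s %/ 4), (s %% 4); lia.
subst s; rewrite dv // md //.
case: m lt s3 => [|[|[|[|//]]]] _ s3.
- rewrite addn0 pstepT; case: b => -[tss]; rewrite dv // md // => sz ew.
    case: tss sz ew => [|ts tss] //= [sz] ->.
    by exists tss => //; exists (Tuple ts).
  by case: ew => b ->; exists tss => //; exists (Atom b).
- rewrite pstepB; case: b => -[tss]; rewrite dv // md // => sz.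
    by move=> [c [b ->]]; exists tss => //; exists (c :: b).
  by move=> ->; exists tss => //; exists [::].
- by rewrite pstepb => -[tss]; rewrite dv // md // => sz [b' ->]; exists tss => //; exists b, b'.
case: d s3 => [//|d] _; rewrite pstepS; case: b => -[tss].
  rewrite dv0 md0 => sz [t ->].
  case: tss sz => [//|ts tss] /= sz; exists ((t :: ts) :: tss) => //=.
  by rewrite -!catA.
by rewrite dv // md // => sz ->; exists ([::] :: tss) => //=; rewrite sz.
Qed.

Definition coded_at (T : Type) (f : T -> bits) (u : bits) (a : nat) (y : T) : Prop :=
  exists z, drop a u = f y ++ z.

Lemma coded_at_uniq (T : Type) (f : T -> bits) u a y y' :
  prefix_code f -> coded_at f u a y -> coded_at f u a y' -> y = y'.
Proof. by move=> pf [z e] [z']; rewrite e => /pf[]. Qed.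

(** An empty code would be present at every position beyond the end, hence the positivity. *)
Lemma coded_at_size (T : Type) (f : T -> bits) u a y : 0 < size (f y) ->
  coded_at f u a y -> a + size (f y) <= size u.
Proof.
move=> pos [z] /(congr1 size); rewrite size_drop size_cat; lia.
Qed.

Lemma bitv_drop u a b w : drop a u = b :: w -> bitv u a = b.+1 /\ drop a.+1 u = w.
Proof.
move=> e; have lt : a < size u by have := congr1 size e; rewrite size_drop /=; lia.
split; last by rewrite -add1n -drop_drop e /= drop0.
by rewrite /bitv lt; have := nth_drop a false u 0; rewrite e addn0 /= => <-.
Qed.

Lemma bitv_gt0 u a b : bitv u a = b.+1 -> exists2 c : bool, b = c & exists w, drop a u = c :: w.
Proof.
rewrite /bitv; case: ltnP => // lt [<-]; exists (nth false u a) => //.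
by exists (drop a.+1 u); rewrite -drop_nth.
Qed.

Lemma find_iota (P : pred nat) n i :
  i < n -> P i -> (forall j, j < i -> ~~ P j) -> find P (iota 0 n) = i.
Proof.
move=> lt Pi H; have h : has P (iota 0 n) by apply/hasP; exists i; rewrite ?mem_iota.
have ltf : find P (iota 0 n) < n by rewrite -[X in _ < X](size_iota 0) -has_find.
have Pf := nth_find 0 h; rewrite nth_iota // add0n in Pf.
apply/eqP; rewrite eqn_leq; apply/andP; split; rewrite leqNgt; apply/negP => lt'.
  by have := before_find 0 lt'; rewrite nth_iota // Pi.
by have := H _ lt'; rewrite Pf.
Qed.

Lemma find_iotaP (P : pred nat) n : find P (iota 0 n) < n ->
  P (find P (iota 0 n)) /\ forall j, j < find P (iota 0 n) -> ~~ P j.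
Proof.
move=> lt; have h : has P (iota 0 n) by rewrite has_find size_iota.
split; first by have := nth_find 0 h; rewrite nth_iota.
move=> j ltj; have := before_find 0 ltj; rewrite nth_iota ?add0n ?(ltn_trans ltj) //.
by move->.
Qed.

Lemma iotaSl m : iota 0 m.+1 = 0 :: [seq i.+1 | i <- iota 0 m].
Proof. by rewrite /= (iotaDl 1 0). Qed.

Definition pst (N : nat) (u : bits) (a i : nat) : nat :=
  iteri i (fun j s => minn N (pstep s (bitv u (a + j)))) 0.

(** A search without success returns [N], which then serves as the sign of failure. *)
Definition tlen N u a : nat := find (fun i => pst N u a i == 3) (iota 0 N).
Definition tend N u a : nat := minn N (a + tlen N u a).

Lemma definable_pstep f g : definable f -> definable g ->
  definable (fun xs v => minn (bnd xs) (pstep (f xs v) (g xs v))).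
Proof.
move=> df dg.
apply: (definable2 (g := fun xs s b => minn (bnd xs) (pstep s b))) df dg.
have : definable (fun xs v => if v 1 == 0 then minn (bnd xs) (v 0) else
  if v 0 %% 4 == 0 then (if v 1 == 1 then minn (bnd xs) (v 0 + 1) else minn (bnd xs) (v 0 + 7)) else
  if v 0 %% 4 == 1 then (if v 1 == 1 then minn (bnd xs) (v 0 + 2) else minn (bnd xs) (v 0 + 1)) else
  if v 0 %% 4 == 2 then minn (bnd xs) ((v 0 - 1) + 0)
  else (if v 1 == 1 then minn (bnd xs) ((v 0 - 4) + 0) else minn (bnd xs) ((v 0 - 3) + 0))).
  by definable.
by apply: definable_ext => xs v _; rewrite /pstep !addn0; do !case: ifP.
Qed.

Section Positions.
Variables (N : nat) (u : bits).
Hypothesis Nu : 8 * size u + 8 <= N.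

(** Saturation never takes effect, as a state is at most seven times the number of bits read; beyond
    the end of the string [pstep] receives 0 and idles. *)
Lemma pst_lrun a i : pst N u a i = lrun 0 (take i (drop a u)).
Proof.
elim: i => [|i IH]; first by rewrite take0.
rewrite /pst iteriS -/(pst N u a i) IH.
have le : lrun 0 (take i.+1 (drop a u)) <= N.
  apply: leq_trans (lrun_le _ _) _.
  have : size (take i.+1 (drop a u)) <= size u by rewrite size_take size_drop; case: ifP; lia.
  lia.
case: (ltnP (a + i) (size u)) => lt.
  have e : take i.+1 (drop a u) = take i (drop a u) ++ [:: nth false u (a + i)].
    by rewrite cats1 (take_nth false) ?nth_drop // size_drop; lia.
  rewrite e lrun_cat in le *; rewrite /bitv lt.
  by apply/minn_idPr.
have -> : bitv u (a + i) = 0 by rewrite /bitv ifN // -leqNgt.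
rewrite take_oversize ?size_drop in le; last lia.
by rewrite !take_oversize ?size_drop; [apply/minn_idPr|lia|lia].
Qed.

Lemma term_unfinished t i : i < size (enc_term t) -> lrun 0 (take i (enc_term t)) != 3.
Proof.
move=> lt; have [_ /allP H _] := term_specP t 0.
have lt' : i < size (states (4 * 0) (enc_term t)) by rewrite size_states.
by have /andP[_] := H _ (mem_nth 0 lt'); rewrite nth_states.
Qed.

Lemma tlenP a t : coded_at enc_term u a t -> tlen N u a = size (enc_term t).
Proof.
have pos : 0 < size (enc_term t) by case: (enc_term t) (@enc_term_neq0 t).
move=> c; have le := coded_at_size pos c; case: c => z e.
apply: find_iota; first lia.
  by rewrite pst_lrun e take_size_cat //; have [-> _ _] := term_specP t 0.
move=> j lt; rewrite pst_lrun e takel_cat; last exact: ltnW.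
exact: term_unfinished.
Qed.

Lemma tendP a t : coded_at enc_term u a t -> tend N u a = a + size (enc_term t).
Proof.
have pos : 0 < size (enc_term t) by case: (enc_term t) (@enc_term_neq0 t).
by move=> c; have le := coded_at_size pos c; rewrite /tend (tlenP c); lia.
Qed.

Lemma tend_conv a : tend N u a < N -> exists t, coded_at enc_term u a t.
Proof.
rewrite /tend => lt.
have [] := @find_iotaP (fun i => pst N u a i == 3) N; first by rewrite -/(tlen N u a); lia.
rewrite -/(tlen N u a); set n := tlen N u a; rewrite !pst_lrun => /eqP Hn Hlt.
(* The automaton idles past the end, so a first arrival in state 3 lies within the string. *)
have len : n <= size (drop a u).
  rewrite leqNgt; apply/negP => lt'; have := Hlt _ lt'.
  by rewrite pst_lrun take_size -(take_oversize (ltnW lt')) Hn.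
have sz : size (take n (drop a u)) = n by rewrite size_takel.
have [] := states_inv Hn.
  apply/(all_nthP 0) => j; rewrite size_states => ltj.
  rewrite nth_states // take_takel; last by rewrite -sz ltnW.
  by have := Hlt j; rewrite pst_lrun -sz; apply.
by case=> // _ [t]; rewrite cats0 => et; exists t, (drop n (drop a u)); rewrite -et cat_take_drop.
Qed.

(** Offset 0 is left out because there the term itself begins. *)
Definition has_inside a (Q : nat -> bool) : bool :=
  has (fun i => [&& 0 < i, pst N u a i %% 4 == 0 & Q (minn N (a + i))]) (iota 0 (tlen N u a)).

Lemma has_insideP a t (Q : nat -> bool) (P : pred term) :
  coded_at enc_term u a t ->
  (forall b r, coded_at enc_term u b r -> Q b = P r) ->
  has_inside a Q = has P (constituents t).
Proof.
move=> c H; have tl := tlenP c; rewrite /has_inside tl.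
have pos : 0 < size (enc_term t) by case: (enc_term t) (@enc_term_neq0 t).
have le := coded_at_size pos c; case: (c) => z e.
have eu : u = take a u ++ enc_term t ++ z by rewrite -e cat_take_drop.
(* [scan] sees suffixes only; their lengths turn a test of positions into a test of suffixes. *)
have [_ _ /(_ u (fun w => Q (size u - size w)) P) T] := term_specP t 0.
have {}T := T _ (take a u) z 0 eu.
have s0 Q' s w : scan Q' s w 0 = false by case: w.
rewrite addn0 s0 orbF in T; rewrite -T; last first.
  move=> pre r z' eu'; apply: H; exists z'.
  rewrite (_ : _ - _ = size pre); last by rewrite {1}eu' !size_cat; lia.
  by rewrite {1}eu' drop_size_cat.
rewrite scan_has; last by rewrite size_cat size_behead; lia.
rewrite -{1}(prednK pos) iotaSl [has _ (_ :: _)]/= has_map.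
apply: eq_in_has => i; rewrite mem_iota add0n => lt.
rewrite -[LHS]/((pst N u a i.+1 %% 4 == 0) && Q (minn N (a + i.+1))).
rewrite pst_lrun e; congr (_ && Q _).
  suff -> : take i.+1 (enc_term t ++ z) =
      take 1 (enc_term t) ++ take i (behead (enc_term t) ++ z) by rewrite lrun_cat.
  by case: (enc_term t) pos => //= b w _; rewrite take0.
rewrite size_drop size_cat size_behead.
have := congr1 size e; rewrite size_drop size_cat; lia.
Qed.

End Positions.

Lemma definable_pst k f g : definable f -> definable g ->
  definable (fun xs v => pst (bnd xs) (str xs k) (f xs v) (g xs v)).
Proof.
move=> df dg.
apply: (definable2 (g := fun xs a i => pst (bnd xs) (str xs k) a i)) df dg.
apply: (definable_rec (s := fun xs j s v =>
  minn (bnd xs) (pstep s (bitv (str xs k) (v 0 + j)))) (definable_var 1) (@definable_const 0 isT)).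
apply: definable_pstep; definable.
Qed.

Lemma definable_tlen k f : definable f ->
  definable (fun xs v => tlen (bnd xs) (str xs k) (f xs v)).
Proof.
move=> df; apply: (definable1 (g := fun xs a => tlen (bnd xs) (str xs k) a)) df.
apply: (definable_find (p := fun xs i v => pst (bnd xs) (str xs k) (v 0) i == 3) definable_bnd).
by apply: definable_eq (@definable_const 3 isT); apply: definable_pst; definable.
Qed.

Lemma definable_tend k f : definable f ->
  definable (fun xs v => tend (bnd xs) (str xs k) (f xs v)).
Proof. by move=> df; apply: definable_add => //; apply: definable_tlen. Qed.

Lemma definable_has_inside k a (Q : seq bits -> nat -> (nat -> nat) -> bool) :
  definable a -> definable (fun xs v => Q xs (v 0) (fun k => v k.+1) : nat) ->
  definable (fun xs v => has_inside (bnd xs) (str xs k) (a xs v) (fun b => Q xs b v) : nat).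
Proof.
move=> da dQ.
apply: (definable_has (p := fun xs i v => [&& 0 < i, pst (bnd xs) (str xs k) (a xs v) i %% 4 == 0
   & Q xs (minn (bnd xs) (a xs v + i)) v])); first exact: definable_tlen.
have da' := definable_shift da.
have dp := definable_pst k da' (definable_var 0).
have dQ' : definable (fun xs v => Q xs (minn (bnd xs) (a xs (fun k => v k.+1) + v 0)) (fun k => v k.+1) : nat).
  have := definable_let (definable_add da' (definable_var 0))
    (definable_ren (fun k => if k is k'.+1 then k.+1 else 0) dQ).
  by [].
by definable.
Qed.

(* [e N u a] is the end of the code of type [f] that starts at position [a] of [u]; it
   is at least [N] if there is no such code. *)
Definition codec (T : Type) (f : T -> bits) (e : nat -> bits -> nat -> nat) : Prop :=
  [/\ prefix_code f, forall y, 0 < size (f y),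
      forall N u a y, 8 * size u + 8 <= N -> coded_at f u a y -> e N u a = a + size (f y),
      forall N u a, 8 * size u + 8 <= N -> e N u a < N -> exists y, coded_at f u a y &
      forall k g, definable g -> definable (fun xs v => e (bnd xs) (str xs k) (g xs v))].

Lemma codec_term : codec enc_term tend.
Proof.
split; first exact: prefix_code_term.
- by move=> t; case: (enc_term t) (@enc_term_neq0 t).
- by move=> N u a y Nu; apply: tendP.
- by move=> N u a Nu; apply: tend_conv.
by move=> k g; apply: definable_tend.
Qed.

Definition bit_end (N : nat) (u : bits) (a : nat) : nat :=
  if bitv u a == 0 then N else minn N a.+1.

Lemma codec_bit : codec (fun b => [:: b]) bit_end.
Proof.
split=> //.
- by move=> x y z z' /= [-> ->].
- move=> N u a y Nu c; have le := coded_at_size (f := fun b => [:: b]) (y := y) isT c; rewrite /= in le.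
  by case: c => z /bitv_drop [e _]; rewrite /bit_end e /=; lia.
- move=> N u a Nu; rewrite /bit_end; case e: (bitv u a) => [|b] /=; first by rewrite ltnn.
  by have [c _ [w ew]] := bitv_gt0 e; exists c, w.
by move=> k g dg; rewrite /bit_end; definable.
Qed.

(** * Codes of lists *)

Section Sequences.
Variables (T : Type) (f : T -> bits) (e : nat -> bits -> nat -> nat).
Hypothesis fe : codec f e.

(* Position of the flag announcing the [j]-th element of the list coded at [p]. *)
Definition spos N u p j : nat := iteri j (fun _ q => e N u (minn N q.+1)) p.
(** The search stops at the first flag other than [true], be it the terminator, of value 1, or the
    value 0 read after a failed element; [send] tells these apart. *)
Definition slen N u p : nat := find (fun j => bitv u (spos N u p j) != 2) (iota 0 N).
Definition elt N u p j : nat := minn N (spos N u p j).+1.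
Definition send N u p : nat :=
  if bitv u (spos N u p (slen N u p)) == 1 then minn N (spos N u p (slen N u p)).+1 else N.

Lemma definable_spos k p j : definable p -> definable j ->
  definable (fun xs v => spos (bnd xs) (str xs k) (p xs v) (j xs v)).
Proof.
move=> dp dj; case: fe => _ _ _ _ de.
apply: (definable2 (g := fun xs p j => spos (bnd xs) (str xs k) p j)) dp dj.
apply: (definable_rec (s := fun xs _ q _ => e (bnd xs) (str xs k) (minn (bnd xs) q.+1))
  (definable_var 1) (definable_var 0)).
by apply: de; definable.
Qed.

Lemma definable_slen k p : definable p ->
  definable (fun xs v => slen (bnd xs) (str xs k) (p xs v)).
Proof.
move=> dp; apply: (definable1 (g := fun xs p => slen (bnd xs) (str xs k) p)) dp.
apply: (definable_find (p := fun xs j v => bitv (str xs k) (spos (bnd xs) (str xs k) (v 0) j) != 2)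
  definable_bnd).
have := definable_spos k (definable_var 1) (definable_var 0) => d.
by definable.
Qed.

Lemma definable_elt k p j : definable p -> definable j ->
  definable (fun xs v => elt (bnd xs) (str xs k) (p xs v) (j xs v)).
Proof. by move=> dp dj; apply: definable_succ; apply: definable_spos. Qed.

Lemma definable_send k p : definable p ->
  definable (fun xs v => send (bnd xs) (str xs k) (p xs v)).
Proof.
move=> dp; rewrite /send; have d := definable_spos k dp (definable_slen k dp).
by definable.
Qed.

Lemma size_enc_seq s : size s < size (enc_seq f s).
Proof. by elim: s => //= x s IH; rewrite size_cat; lia. Qed.

Section Spec.
Variables (N : nat) (u : bits) (p : nat).
Hypothesis Nu : 8 * size u + 8 <= N.

Lemma coded_at_cons q x s : coded_at (enc_seq f) u q (x :: s) ->
  [/\ bitv u q = 2, q < size u, coded_at f u q.+1 x &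
      coded_at (enc_seq f) u (q.+1 + size (f x)) s].
Proof.
case=> z /= eq; have [e1 e2] := bitv_drop eq; split=> //.
- by have := congr1 size eq; rewrite size_drop /=; lia.
- by exists (enc_seq f s ++ z); rewrite e2 catA.
by exists z; rewrite addnC -drop_drop e2 -catA drop_size_cat.
Qed.

Lemma coded_at_nil q : coded_at (enc_seq f) u q [::] -> bitv u q = 1 /\ q < size u.
Proof.
case=> z /= eq; have [e1 _] := bitv_drop eq; split=> //.
by have := congr1 size eq; rewrite size_drop /=; lia.
Qed.

Variable s : seq T.
Hypothesis Hs : coded_at (enc_seq f) u p s.

Lemma sposP j : j <= size s -> coded_at (enc_seq f) u (spos N u p j) (drop j s) /\
  spos N u p j + size (enc_seq f (drop j s)) = p + size (enc_seq f s).
Proof.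
case: fe => _ _ He _ _.
elim: j => [|j IH] lt; first by rewrite drop0.
have x0 : T by case: (s) lt.
have [c sz] := IH (ltnW lt); rewrite (drop_nth x0) // in c sz.
have [_ ltu cx cs] := coded_at_cons c.
have e1 : minn N (spos N u p j).+1 = (spos N u p j).+1 by lia.
rewrite /spos iteriS -/(spos N u p j) e1 (He _ _ _ _ Nu cx); split=> //.
by rewrite -sz /= size_cat; lia.
Qed.

Lemma slenP : slen N u p = size s.
Proof.
have le : size s < N.
  have := coded_at_size (leq_ltn_trans (leq0n _) (size_enc_seq s)) Hs.
  have := size_enc_seq s; lia.
apply: find_iota => // [|j lt].
  by have [] := sposP (leqnn _); rewrite drop_size => /coded_at_nil[-> _].
have x0 : T by case: (s) lt.
by have [c _] := sposP (ltnW lt); move: c; rewrite (drop_nth x0) // => /coded_at_cons[-> _ _ _].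
Qed.

Lemma eltP x0 j : j < size s -> coded_at f u (elt N u p j) (nth x0 s j).
Proof.
move=> lt; have [] := sposP (ltnW lt); rewrite (drop_nth x0) // => c _.
have [_ ltu cx _] := coded_at_cons c.
by rewrite /elt (_ : minn _ _ = (spos N u p j).+1) //; lia.
Qed.

Lemma sendP : send N u p = p + size (enc_seq f s).
Proof.
have [] := sposP (leqnn _); rewrite drop_size /send slenP => /coded_at_nil[-> lt] /= <-.
by rewrite addn1; lia.
Qed.

End Spec.

(** The list is assembled from its end: the terminator gives the empty list, and each preceding flag
    is followed by an element, because the position behind that element lies within the string. *)
Lemma send_conv N u p : 8 * size u + 8 <= N -> send N u p < N ->
  exists s, coded_at (enc_seq f) u p s.
Proof.
move=> Nu; rewrite /send; case: eqP => [e1 _|]; last by rewrite ltnn.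
case: fe => _ _ He Hc _.
have Hj j : j < slen N u p -> bitv u (spos N u p j) == 2.
  move=> lt; have := before_find 0 lt; rewrite nth_iota ?add0n => [/negbFE //|].
  by apply: leq_trans lt _; have := find_size (fun j => bitv u (spos N u p j) != 2) (iota 0 N); rewrite size_iota.
suff H i : i <= slen N u p -> exists s, coded_at (enc_seq f) u (spos N u p (slen N u p - i)) s.
  by have := H _ (leqnn _); rewrite subnn.
elim: i => [_|i IH lt].
  have [c ec [w ew]] := bitv_gt0 e1; exists [::], w; rewrite subn0 ew.
  by case: c ec {ew}.
have [s cs] := IH (ltnW lt).
have /eqP b2 := Hj (slen N u p - i.+1) ltac:(lia).
have [c ec [w ew]] := bitv_gt0 b2.
have ltq : spos N u p (slen N u p - i.+1) < size u.
  by have := congr1 size ew; rewrite size_drop /=; lia.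
set q := spos N u p (slen N u p - i.+1) in b2 ew ltq *.
have eq : spos N u p (slen N u p - i) = e N u q.+1.
  rewrite (_ : slen N u p - i = (slen N u p - i.+1).+1); last lia.
  by rewrite /spos iteriS -/(spos N u p _) -/q; congr e; lia.
have lt2 : e N u q.+1 < N.
  have lt0 : 0 < size (enc_seq f s) by apply: leq_ltn_trans _ (size_enc_seq s).
  by have := coded_at_size lt0 cs; rewrite eq; lia.
have [y cy] := Hc _ _ _ Nu lt2.
rewrite eq (He _ _ _ _ Nu cy) in cs.
exists (y :: s); case: cs => z ez; exists z.
have [_ dq] := bitv_drop ew; case: c ec ew => // _ ew.
case: cy => z' ez'; rewrite ew -dq ez' /=.
by move: ez; rewrite addnC -drop_drop ez' drop_size_cat // => ->; rewrite catA.
Qed.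

Lemma codec_seq : codec (enc_seq f) send.
Proof.
case: (fe) => pf _ _ _ _; split; first exact: prefix_code_seq.
- by move=> s; apply: leq_ltn_trans _ (size_enc_seq s).
- by move=> N u a s Nu; apply: sendP.
- by move=> N u a; apply: send_conv.
exact: definable_send.
Qed.

End Sequences.

Section SeqQuantifiers.
Variables (T : Type) (f : T -> bits) (e : nat -> bits -> nat -> nat).
Hypothesis fe : codec f e.

Definition has_seq N u p (Q : nat -> bool) : bool :=
  has (fun j => Q (elt e N u p j)) (iota 0 (slen e N u p)).

Definition all_seq N u p (Q : nat -> bool) : bool :=
  all (fun j => Q (elt e N u p j)) (iota 0 (slen e N u p)).

Lemma has_seqP N u p s (Q : nat -> bool) (P : pred T) : 8 * size u + 8 <= N ->
  coded_at (enc_seq f) u p s -> (forall q y, coded_at f u q y -> Q q = P y) ->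
  has_seq N u p Q = has P s.
Proof.
move=> Nu c H; rewrite /has_seq (slenP fe Nu c).
case: s c => [//|x0 s] c; rewrite -[in RHS](mkseq_nth x0 (x0 :: s)) has_map.
apply: eq_in_has => j; rewrite mem_iota => lt; apply: H.
exact: (eltP fe Nu c).
Qed.

Lemma all_seqP N u p s (Q : nat -> bool) (P : pred T) : 8 * size u + 8 <= N ->
  coded_at (enc_seq f) u p s -> (forall q y, coded_at f u q y -> Q q = P y) ->
  all_seq N u p Q = all P s.
Proof.
move=> Nu c H; apply: negb_inj; rewrite -!has_predC.
apply: (@has_seqP N u p s (predC Q) (predC P) Nu c) => q y cy /=.
by rewrite (H q y cy).
Qed.

Lemma definable_has_seq k p (Q : seq bits -> nat -> (nat -> nat) -> bool) :
  definable p -> definable (fun xs v => Q xs (v 0) (fun k => v k.+1) : nat) ->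
  definable (fun xs v => has_seq (bnd xs) (str xs k) (p xs v) (fun q => Q xs q v) : nat).
Proof.
move=> dp dQ.
apply: (definable_has (p := fun xs j v => Q xs (elt e (bnd xs) (str xs k) (p xs v) j) v)).
  exact: (definable_slen fe k dp).
exact: (definable_let (definable_elt fe k (definable_shift dp) (definable_var 0))
  (definable_ren (fun k => if k is k'.+1 then k.+1 else 0) dQ)).
Qed.

Lemma definable_all_seq k p (Q : seq bits -> nat -> (nat -> nat) -> bool) :
  definable p -> definable (fun xs v => Q xs (v 0) (fun k => v k.+1) : nat) ->
  definable (fun xs v => all_seq (bnd xs) (str xs k) (p xs v) (fun q => Q xs q v) : nat).
Proof.
move=> dp dQ.
have := definable_not (definable_has_seq (Q := fun xs q v => ~~ Q xs q v) k dp (definable_not dQ)).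
apply: definable_ext => xs v _; congr nat_of_bool.
by rewrite /has_seq -all_predC; apply: eq_all => i /=; rewrite negbK.
Qed.

End SeqQuantifiers.

Definition cidx N u a : nat := find (fun i => bitv u (a + i) != 2) (iota 0 N).
Definition cterm N u a : nat := minn N (minn N (a + cidx N u a)).+1.
Definition cend N u a : nat :=
  if bitv u (a + cidx N u a) == 1 then tend N u (cterm N u a) else N.

Lemma definable_cidx k f : definable f ->
  definable (fun xs v => cidx (bnd xs) (str xs k) (f xs v)).
Proof.
move=> df; apply: (definable1 (g := fun xs a => cidx (bnd xs) (str xs k) a)) df.
apply: (definable_find (p := fun xs i v => bitv (str xs k) (v 0 + i) != 2) definable_bnd).
by definable.
Qed.

Lemma definable_cterm k f : definable f ->
  definable (fun xs v => cterm (bnd xs) (str xs k) (f xs v)).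
Proof. by move=> df; rewrite /cterm; have d := definable_cidx k df; definable. Qed.

Lemma bitv_add u a i : bitv u (a + i) = bitv (drop a u) i.
Proof. by rewrite /bitv size_drop nth_drop; congr (if _ then _ else _); lia. Qed.

Lemma drop_ones u a j : (forall i, i < j -> bitv u (a + i) = 2) ->
  drop a u = nseq j true ++ drop (a + j) u.
Proof.
elim: j => [|j IH] H; first by rewrite addn0.
rewrite {1}IH => [|i lt]; last by apply: H; lia.
have [c ec [w ew]] := bitv_gt0 (H j (ltnSn j)); case: c ec ew => // _ ew.
have [_ e2] := bitv_drop ew.
by rewrite ew addnS e2 -[j.+1]addn1 nseqD -catA.
Qed.

Section Celem.
Variables (N : nat) (u : bits) (a : nat).
Hypothesis Nu : 8 * size u + 8 <= N.

Lemma celemP c : coded_at enc_celem u a c ->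
  [/\ cidx N u a = c.1, bitv u (a + c.1) = 1 & coded_at enc_term u (cterm N u a) c.2].
Proof.
case: c => j t [z e]; rewrite /enc_celem /= -catA in e *.
have szle : j.+1 <= size u.
  by have := congr1 size e; rewrite size_drop size_cat size_nseq /=; lia.
have ei : cidx N u a = j.
  apply: find_iota; first lia.
    by rewrite bitv_add e /bitv size_cat size_nseq nth_cat size_nseq ltnn subnn /=; case: ifP => //; lia.
  move=> i lt; rewrite bitv_add e /bitv size_cat size_nseq nth_cat size_nseq lt nth_nseq lt.
  by case: ifP => //; lia.
have ej : bitv u (a + j) = 1.
  by rewrite bitv_add e /bitv size_cat size_nseq nth_cat size_nseq ltnn subnn /=; case: ifP => //; lia.
have lta : a + j < size u by move: ej; rewrite /bitv; case: ltnP.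
split=> //; exists z; rewrite /cterm ei.
rewrite (_ : minn N _ = j.+1 + a); last lia.
rewrite -drop_drop e drop_cat size_nseq ifN; last by rewrite -leqNgt.
by rewrite subSnn /= drop0.
Qed.

Lemma cendP c : coded_at enc_celem u a c -> cend N u a = a + size (enc_celem c).
Proof.
move=> c0; have [ei ej ct] := celemP c0.
rewrite /cend ei ej /= (tendP Nu ct) /cterm ei /enc_celem size_cat size_nseq /=.
have lta : a + c.1 < size u by move: ej; rewrite /bitv; case: ltnP.
lia.
Qed.

Lemma cend_conv : cend N u a < N -> exists c, coded_at enc_celem u a c.
Proof.
rewrite /cend; case: eqP => [e1|_]; last by rewrite ltnn.
case/(tend_conv Nu) => t [z e]; exists (cidx N u a, t), z.
have lta : a + cidx N u a < size u by move: e1; rewrite /bitv; case: ltnP.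
rewrite (@drop_ones u a (cidx N u a)); last first.
  move=> i lt; have := before_find 0 lt; rewrite nth_iota; last first.
    apply: leq_trans lt _; have := find_size (fun i => bitv u (a + i) != 2) (iota 0 N).
    by rewrite size_iota.
  by move/negbFE/eqP.
rewrite /enc_celem /= -catA; congr (_ ++ _).
have [c ec [w ew]] := bitv_gt0 e1; case: c ec ew => // _ ew.
have [_ e2] := bitv_drop ew; rewrite ew; congr (_ :: _).
rewrite -e2 -[RHS]/(enc_term t ++ z) -e /cterm; congr drop; lia.
Qed.

End Celem.

Lemma definable_cend k f : definable f ->
  definable (fun xs v => cend (bnd xs) (str xs k) (f xs v)).
Proof.
move=> df; rewrite /cend; have d := definable_cidx k df.
have d' := definable_tend k (definable_cterm k df).
by definable.
Qed.

Lemma codec_celem : codec enc_celem cend.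
Proof.
split; first exact: prefix_code_celem.
- by move=> c; rewrite /enc_celem size_cat /=; lia.
- by move=> N u a c Nu; apply: cendP.
- by move=> N u a Nu; apply: cend_conv.
exact: definable_cend.
Qed.

Definition teq N u a u' b : bool :=
  all (fun i => bitv u (a + i) == bitv u' (b + i)) (iota 0 (tlen N u a)).

(** Comparing along the first code is enough: agreement means that the first term is also coded at
    the second position, and decoding is unique. *)
Lemma teqP N u a u' b t t' : 8 * size u + 8 <= N ->
  coded_at enc_term u a t -> coded_at enc_term u' b t' -> teq N u a u' b = (t == t').
Proof.
move=> Nu c c'; rewrite /teq (tlenP Nu c); apply/idP/eqP => [/allP H|et].
  apply: (coded_at_uniq prefix_code_term _ c').
  case: c => z e; exists (drop (size (enc_term t)) (drop b u')).
  rewrite -[LHS](cat_take_drop (size (enc_term t))); congr (_ ++ _).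
  have H' i : i < size (enc_term t) ->
      i < size (drop b u') /\ nth false (enc_term t) i = nth false (drop b u') i.
    move=> lt; have := H i; rewrite mem_iota add0n lt => /(_ isT) /eqP.
    rewrite !bitv_add e /bitv size_cat nth_cat lt ifT; last lia.
    by case: ltnP => // _ []; case: nth; case: nth.
  have le : size (enc_term t) <= size (drop b u').
    case es : (size (enc_term t)) => [//|n].
    by have [] := H' n; rewrite ?es.
  apply: (@eq_from_nth _ false); rewrite size_takel // => i lt.
  by rewrite nth_take // -(H' i lt).2.
subst t'; case: c => z e; case: c' => z' e'.
apply/allP => i; rewrite mem_iota add0n /= => lt.
by rewrite !bitv_add e e' /bitv !size_cat !nth_cat lt !ifT; lia.
Qed.

Lemma definable_teq k f k' g : definable f -> definable g ->
  definable (fun xs v => teq (bnd xs) (str xs k) (f xs v) (str xs k') (g xs v) : nat).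
Proof.
move=> df dg.
apply: (definable2 (g := fun xs a b => teq (bnd xs) (str xs k) a (str xs k') b : nat)) df dg.
apply: (definable_all (p := fun xs i v => bitv (str xs k) (v 0 + i) == bitv (str xs k') (v 1 + i))
  (definable_tlen k (definable_var 0))).
by definable.
Qed.

Definition tmem N u a u' p : bool := has_seq tend N u' p (fun b => teq N u a u' b).

Lemma tmemP N u a u' p t s : 8 * size u + 8 <= N -> 8 * size u' + 8 <= N ->
  coded_at enc_term u a t -> coded_at (enc_seq enc_term) u' p s ->
  tmem N u a u' p = (t \in s).
Proof.
move=> Nu Nu' c cs; rewrite -has_pred1.
apply: (has_seqP codec_term Nu' cs) => q y cy; rewrite (teqP Nu c cy) /=.
exact: eq_sym.
Qed.

Lemma definable_tmem k f k' g : definable f -> definable g ->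
  definable (fun xs v => tmem (bnd xs) (str xs k) (f xs v) (str xs k') (g xs v) : nat).
Proof.
move=> df dg.
apply: (definable2 (g := fun xs a p => tmem (bnd xs) (str xs k) a (str xs k') p : nat)) df dg.
apply: (definable_has_seq (Q := fun xs b v => teq (bnd xs) (str xs k) (v 0) (str xs k') b)
  codec_term k' (definable_var 1)).
by apply: definable_teq; definable.
Qed.

Definition cmem N u j a u' p : bool :=
  has_seq cend N u' p (fun q => (cidx N u' q == j) && teq N u a u' (cterm N u' q)).

Lemma cmemP N u j a u' p t s : 8 * size u + 8 <= N -> 8 * size u' + 8 <= N ->
  coded_at enc_term u a t -> coded_at enc_celems u' p s ->
  cmem N u j a u' p = ((j, t) \in s).
Proof.
move=> Nu Nu' c cs; rewrite -has_pred1.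
apply: (has_seqP codec_celem Nu' cs) => q [i r] cy.
have [-> _ cr] := celemP Nu' cy; rewrite (teqP Nu c cr) /= xpair_eqE.
by rewrite (eq_sym t).
Qed.

Lemma definable_cmem k j f k' g : definable j -> definable f -> definable g ->
  definable (fun xs v => cmem (bnd xs) (str xs k) (j xs v) (f xs v) (str xs k') (g xs v) : nat).
Proof.
move=> dj df dg.
apply: (definable3 (g := fun xs j a p => cmem (bnd xs) (str xs k) j a (str xs k') p : nat)) dj df dg.
apply: (definable_has_seq (Q := fun xs q v => (cidx (bnd xs) (str xs k') q == v 0) &&
    teq (bnd xs) (str xs k) (v 1) (str xs k') (cterm (bnd xs) (str xs k') q))
  codec_celem k' (definable_var 2)).
apply: definable_and; last by apply: definable_teq; [definable | apply: definable_cterm; definable].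
by apply: definable_eq; [apply: definable_cidx|]; definable.
Qed.

Lemma coded_at_drop (T : Type) (f : T -> bits) u a y :
  coded_at f u a y -> drop a u = f y ++ drop (a + size (f y)) u.
Proof. by case=> z e; rewrite addnC -drop_drop e drop_size_cat. Qed.

Lemma size_strE xs k : find (fun i => bitv (str xs k) i == 0) (iota 0 (bnd xs)) = size (str xs k).
Proof.
have le := size_str xs k.
apply: find_iota; [lia | by rewrite /bitv ltnn |].
by move=> j lt; rewrite /bitv lt.
Qed.

Lemma definable_size_str k : definable (fun xs v => size (str xs k)).
Proof.
have := definable_find (p := fun xs i v => bitv (str xs k) i == 0) definable_bnd
  (definable_eq (definable_bit k (definable_var 0)) (@definable_const 0 isT)).
by apply: definable_ext => xs v _; rewrite size_strE.
Qed.

Lemma codec_terms : codec (enc_seq enc_term) (send tend).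
Proof. exact: codec_seq codec_term. Qed.

Lemma codec_relations : codec enc_relations (send (send tend)).
Proof. exact: codec_seq codec_terms. Qed.

Lemma codec_celems : codec enc_celems (send cend).
Proof. exact: codec_seq codec_celem. Qed.

Lemma codec_celem_lists : codec (enc_seq enc_celems) (send (send cend)).
Proof. exact: codec_seq codec_celems. Qed.

Lemma codec_bits : codec enc_bits (send bit_end).
Proof. exact: codec_seq codec_bit. Qed.

Lemma mem_rel_at Rl t j : (t \in rel_at (relations_of Rl) j) = (t \in nth [::] Rl j).
Proof.
rewrite /rel_at /relations_of; case: (ltnP j (size Rl)) => lt.
  by rewrite (nth_map [::]) // in_fset.
by rewrite !nth_default ?size_map.
Qed.

(** * Checking the input *)

Section Parse.
Variables (N : nat) (x : bits).

Definition pos1 := send (send tend) N x 0.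
Definition pos2 := send cend N x pos1.
Definition pos3 := send cend N x pos2.
Definition pos4 := send (send cend) N x pos3.
Definition pos5 := send bit_end N x pos4.
Definition pos6 := minn N pos5.+1.
Definition pos7 := send bit_end N x pos6.

(** Testing the last position covers every stage, since after a failed decoding no later code can be
    found. The second condition makes sure that the sign is present. *)
Definition well_formed : bool := (pos7 == size x) && (bitv x pos5 != 0).

Hypothesis Nx : 8 * size x + 8 <= N.

Record parsed Rl l0 l' ls g (sgn : bool) k : Prop := Parsed {
  at_relations : coded_at enc_relations x 0 Rl;
  at_base : coded_at enc_celems x pos1 l0;
  at_common : coded_at enc_celems x pos2 l';
  at_sets : coded_at (enc_seq enc_celems) x pos3 ls;
  at_gamma : coded_at enc_bits x pos4 g;
  at_sign : bitv x pos5 = sgn.+1;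
  at_kappa : coded_at enc_bits x pos6 k
}.

Definition enc_input Rl l0 l' ls g (sgn : bool) k : bits :=
  enc_relations Rl ++ enc_celems l0 ++ enc_celems l' ++ enc_seq enc_celems ls ++
  enc_bits g ++ sgn :: enc_bits k.

Lemma next_code (T : Type) (f : T -> bits) e p y w : codec f e ->
  drop p x = f y ++ w -> coded_at f x p y /\ drop (e N x p) x = w.
Proof.
case=> _ _ He _ _ ed; have c : coded_at f x p y by exists w.
by rewrite (He _ _ _ _ Nx c); split=> //; rewrite addnC -drop_drop ed drop_size_cat.
Qed.

Lemma prev_code (T : Type) (f : T -> bits) e p : codec f e -> e N x p < N ->
  exists y, [/\ coded_at f x p y, p < size x & drop p x = f y ++ drop (e N x p) x].
Proof.
case=> _ pos He Hc _ lt; have [y c] := Hc _ _ _ Nx lt; exists y; split=> //.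
  by have := coded_at_size (pos y) c; have := pos y; lia.
by rewrite (coded_at_drop c) (He _ _ _ _ Nx c).
Qed.

Lemma parsed_enc Rl l0 l' ls g sgn k : x = enc_input Rl l0 l' ls g sgn k ->
  parsed Rl l0 l' ls g sgn k /\ well_formed.
Proof.
rewrite -{1}[x]drop0 => e0.
have [c0 e1] := next_code codec_relations e0.
have [c1 e2] := next_code codec_celems e1.
have [c2 e3] := next_code codec_celems e2.
have [c3 e4] := next_code codec_celem_lists e3.
have [c4 e5] := next_code codec_bits e4.
have [b5 e6] := bitv_drop e5.
have lt5 : pos5 < size x by move: b5; rewrite /bitv; case: ltnP.
have e6' : pos6 = pos5.+1 by rewrite /pos6; lia.
have {}e6 : drop pos6 x = enc_bits k ++ [::] by rewrite cats0 e6'.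
have [c6 e7] := next_code codec_bits e6.
split; first by split.
have [_ _ He _ _] := codec_bits.
have pos : 0 < size (enc_bits k) by apply: leq_ltn_trans _ (size_enc_seq _ _).
rewrite /well_formed b5 andbT eqn_leq; apply/andP; split; last first.
  by have := congr1 size e7; rewrite size_drop /= -/pos7; lia.
by rewrite /pos7 (He _ _ _ _ Nx c6) (coded_at_size pos c6).
Qed.

Lemma well_formed_enc : well_formed ->
  exists Rl l0 l' ls g sgn k, x = enc_input Rl l0 l' ls g sgn k.
Proof.
case/andP=> /eqP e7 b5.
(* From the end backwards: a code found at a position puts this position inside [x], so the
   preceding decoding was successful. *)
have [k [_ lt6 d6]] := prev_code codec_bits (ltac:(lia) : pos7 < N).
have lt5 : pos5 < N by rewrite /pos6 in lt6; lia.
have [g [_ lt4 d4]] := prev_code codec_bits lt5.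
have [ls [_ lt3 d3]] := prev_code codec_celem_lists (ltac:(lia) : pos4 < N).
have [l' [_ lt2 d2]] := prev_code codec_celems (ltac:(lia) : pos3 < N).
have [l0 [_ lt1 d1]] := prev_code codec_celems (ltac:(lia) : pos2 < N).
have [Rl [_ _ d0]] := prev_code codec_relations (ltac:(lia) : pos1 < N).
case eb : (bitv x pos5) b5 => [//|b] _.
have [sgn _ [w ew]] := bitv_gt0 eb; have [_ e5] := bitv_drop ew.
exists Rl, l0, l', ls, g, sgn, k.
rewrite -[x]drop0 d0 d1 d2 d3 d4 -/pos5 ew -e5.
have e6 : pos6 = pos5.+1.
  have : pos5 < size x by move: eb; rewrite /bitv; case: ltnP.
  by rewrite /pos6; lia.
rewrite -e6 d6 -/pos7 e7 drop_size cats0 /enc_input.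
by [].
Qed.

Definition nrel : nat := slen (send tend) N x 0.
Definition rel (j : nat) : nat := elt (send tend) N x 0 j.
(** Beyond the last relation [rel j] is not the position of a list, whereas [rel_at] is empty there;
    hence the guard. *)
Definition inrel (j b : nat) : bool := (j < nrel) && tmem N x b x (rel j).

Definition instance_check : bool :=
  (0 < nrel) && all (fun j => all_seq tend N x (rel j) (fun q =>
    if j == 0 then bitv x q == 1 else
    (bitv x q != 1) && ~~ has_inside N x q (fun b => (bitv x b == 1) && ~~ inrel 0 b)))
  (iota 0 nrel).

Definition elements_check (p : nat) : bool :=
  all_seq cend N x p (fun q => inrel (cidx N x q) (cterm N x q)).

Definition disjoint_check (p p' : nat) : bool :=
  all_seq cend N x p (fun q => ~~ cmem N x (cidx N x q) (cterm N x q) x p').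

Definition gamma_check : bool :=
  [&& elements_check pos2,
      all_seq (send cend) N x pos3 elements_check,
      all_seq (send cend) N x pos3 (disjoint_check pos2) &
      all (fun i => all (fun j => (i < j) ==>
          disjoint_check (elt (send cend) N x pos3 i) (elt (send cend) N x pos3 j))
        (iota 0 (slen (send cend) N x pos3))) (iota 0 (slen (send cend) N x pos3))].

(* [A j b] says whether the element with index [j] and the term at [b] is active. *)
Definition keep (A : nat -> nat -> bool) (j q : nat) : bool :=
  A j q && ~~ has_inside N x q (fun b => ~~ all (fun i => inrel i b ==> A i b) (iota 0 nrel)).

(** The kept terms are copied verbatim from the input, in its order and with its repetitions. Any
    listing of the scenario would do, and this one needs no sorting. *)
Definition filtered_code (A : nat -> nat -> bool) : bits :=
  flatten [seq [:: true] ++ (flatten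
     [seq (if keep A j (elt tend N x (rel j) m)
           then [:: true] ++ take (tlen N x (elt tend N x (rel j) m)) (drop (elt tend N x (rel j) m) x)
           else [::]) | m <- iota 0 (slen tend N x (rel j))] ++ [:: false])
    | j <- iota 0 nrel] ++ [:: false].

Section Spec.
Variables (Rl : seq (seq term)) (l0 l' : seq celem) (ls : seq (seq celem)) (g : bits)
  (sgn : bool) (k : bits).
Hypothesis px : parsed Rl l0 l' ls g sgn k.
Local Notation R := (relations_of Rl).

Lemma nrelP : nrel = size Rl.
Proof. exact: (slenP codec_terms Nx (at_relations px)). Qed.

Lemma relP j : j < size Rl -> coded_at (enc_seq enc_term) x (rel j) (nth [::] Rl j).
Proof. exact: (eltP codec_terms Nx (at_relations px)). Qed.

Lemma inrelP j b t : coded_at enc_term x b t -> inrel j b = (t \in nth [::] Rl j).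
Proof.
move=> c; rewrite /inrel nrelP; case: ltnP => lt; last by rewrite nth_default.
exact: tmemP (relP lt).
Qed.

Lemma atomP q t : coded_at enc_term x q t -> (bitv x q == 1) = is_atom t.
Proof. by case: t => [w|ts] [z] /= /bitv_drop[-> _]. Qed.

Lemma elements_checkP p l : coded_at enc_celems x p l ->
  elements_check p = all (fun c => c.2 \in nth [::] Rl c.1) l.
Proof.
move=> c; apply: (all_seqP codec_celem Nx c) => q [j t] cq.
by have [-> _ ct] := celemP Nx cq; rewrite (inrelP _ ct).
Qed.

Lemma elements_checkE p l : coded_at enc_celems x p l ->
  reflect {subset set_of l <= celems R} (elements_check p).
Proof.
move=> c; rewrite (elements_checkP c); apply: (iffP allP) => H e.
  by rewrite in_fset => /H; rewrite inE mem_rel_at.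
by move=> el; have := H e; rewrite in_fset el inE mem_rel_at; apply.
Qed.

Lemma disjoint_checkE p p' l1 l2 : coded_at enc_celems x p l1 -> coded_at enc_celems x p' l2 ->
  disjoint_check p p' = [disjoint set_of l1 & set_of l2]%fset.
Proof.
move=> c1 c2.
have -> : disjoint_check p p' = all (fun c => c \notin l2) l1.
  apply: (all_seqP codec_celem Nx c1) => q [j t] cq.
  by have [-> _ ct] := celemP Nx cq; rewrite (cmemP _ Nx Nx ct c2).
apply/allP/fdisjointP => H e; have := H e; rewrite !in_fset //.
Qed.

Lemma instance_checkE : reflect (is_instance R) instance_check.
Proof.
have -> : instance_check = (0 < size Rl) && all (fun j => all (fun t =>
    if j == 0 then is_atom t else ~~ is_atom t &&
      ~~ has (fun u => is_atom u && (u \notin nth [::] Rl 0)) (constituents t))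
    (nth [::] Rl j)) (iota 0 (size Rl)).
  rewrite /instance_check nrelP; congr (_ && _); apply: eq_in_all => j.
  rewrite mem_iota add0n /= => lt; apply: (all_seqP codec_term Nx (relP lt)) => q t c.
  rewrite (atomP c); case: ifP => // _; congr (_ && ~~ _).
  by apply: (has_insideP Nx c) => b r cr; rewrite (atomP cr) (inrelP _ cr).
apply: (iffP andP) => [[s0 /allP H]|[s0 H]]; split; rewrite ?size_map // in s0 *.
  move=> j t; rewrite mem_rel_at => tj.
  have lt : j < size Rl by rewrite ltnNge; apply/negP => le; rewrite nth_default in tj.
  have := H j; rewrite mem_iota lt => /(_ isT) /allP /(_ _ tj).
  case: ifP => // _ /andP[-> /hasPn Hc]; split=> // u uc ua.
  by have := Hc _ uc; rewrite ua negbK /universe mem_rel_at.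
apply/allP => j; rewrite mem_iota => lt; apply/allP => t tj.
have := H j t; rewrite mem_rel_at => /(_ tj); case: ifP => // _ [-> Hc] /=.
apply/hasPn => u uc; apply/negP => /andP[ua /negP]; apply.
by have := Hc _ uc ua; rewrite /universe mem_rel_at.
Qed.

Lemma gamma_checkE : reflect
  (gamma_encoding_ok R (set_of l') (map (@set_of celem) ls)) gamma_check.
Proof.
have e1 : all_seq (send cend) N x pos3 elements_check =
    all (fun l => all (fun c => c.2 \in nth [::] Rl c.1) l) ls.
  by apply: (all_seqP codec_celems Nx (at_sets px)) => q y; apply: elements_checkP.
have e2 : all_seq (send cend) N x pos3 (disjoint_check pos2) =
    all (fun A => [disjoint set_of l' & A]%fset) (map (@set_of celem) ls).
  rewrite all_map; apply: (all_seqP codec_celems Nx (at_sets px)) => q y c.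
  exact: disjoint_checkE (at_common px) c.
have e3 : all (fun i => all (fun j => (i < j) ==>
          disjoint_check (elt (send cend) N x pos3 i) (elt (send cend) N x pos3 j))
        (iota 0 (slen (send cend) N x pos3))) (iota 0 (slen (send cend) N x pos3)) =
    pairwise (fun A B : {fset celem} => [disjoint A & B]%fset) (map (@set_of celem) ls).
  rewrite (slenP codec_celems Nx (at_sets px)).
  apply/allP/(pairwiseP fset0) => [H i j | H i].
    rewrite !inE size_map => lti ltj ij; rewrite !(nth_map [::]) //.
    have := H i; rewrite mem_iota add0n lti => /(_ isT) /allP /(_ j).
    rewrite mem_iota add0n ltj ij => /(_ isT) /=.
    by rewrite (disjoint_checkE (eltP codec_celems Nx (at_sets px) [::] lti)
       (eltP codec_celems Nx (at_sets px) [::] ltj)).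
  rewrite mem_iota add0n /= => lti; apply/allP => j; rewrite mem_iota add0n /= => ltj.
  apply/implyP => ij; have := H i j; rewrite !inE size_map => /(_ lti ltj ij).
  rewrite !(nth_map [::]) //.
  by rewrite (disjoint_checkE (eltP codec_celems Nx (at_sets px) [::] lti)
       (eltP codec_celems Nx (at_sets px) [::] ltj)).
rewrite /gamma_check e1 e2 e3 /gamma_encoding_ok /=.
apply: (iffP and4P) => [[/(elements_checkE (at_common px)) H1 /allP H2 H3 H4]|[H1 /andP[H3 H4]]].
  split; last by rewrite H3 H4.
  move=> A; rewrite inE => /predU1P[-> //|/mapP[l ll ->]] c.
  by rewrite in_fset inE mem_rel_at => cl; have /allP := H2 _ ll; apply.
split=> //; first by apply/(elements_checkE (at_common px)); apply: H1; rewrite inE eqxx.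
apply/allP => l ll; apply/allP => c cl.
have := H1 (set_of l); rewrite inE (map_f _ ll) orbT => /(_ isT c).
by rewrite in_fset inE mem_rel_at; apply.
Qed.

Variables (A : nat -> nat -> bool) (act : {fset celem}).
Hypothesis HA : forall j b t, coded_at enc_term x b t -> A j b = ((j, t) \in act).

Definition kept (j : nat) (t : term) : bool :=
  ((j, t) \in act) && all (fun u => all (fun i => (u \in nth [::] Rl i) ==> ((i, u) \in act))
    (iota 0 (size Rl))) (constituents t).

Lemma keepP j q t : coded_at enc_term x q t -> keep A j q = kept j t.
Proof.
move=> c; rewrite /keep /kept (HA _ c); congr (_ && _); rewrite -[RHS]negbK -has_predC.
congr (~~ _); apply: (has_insideP Nx c) => b r cr /=; congr (~~ _).
by rewrite nrelP; apply: eq_all => i; rewrite (inrelP _ cr) (HA _ cr).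
Qed.

Definition filtered : seq (seq term) :=
  mkseq (fun j => filter (kept j) (nth [::] Rl j)) (size Rl).

Lemma flatten_filter (T : Type) (P : pred T) (h : T -> bits) s :
  flatten [seq if P y then h y else [::] | y <- s] = flatten [seq h y | y <- s & P y].
Proof. by elim: s => //= y s ->; case: (P y). Qed.

Lemma filtered_codeE : filtered_code A = enc_relations filtered.
Proof.
rewrite /filtered_code /enc_relations [RHS]enc_seqE /filtered /mkseq -map_comp nrelP.
congr (flatten _ ++ _); apply/eq_in_map => j; rewrite mem_iota add0n /= => lt.
have cj := relP lt; rewrite enc_seqE -flatten_filter (slenP codec_term Nx cj).
congr (_ :: (flatten _ ++ _)).
set s := nth [::] Rl j in cj *.
rewrite -[in RHS](mkseq_nth (Atom [::]) s) -map_comp; apply/eq_in_map => m.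
rewrite mem_iota add0n /= => ltm; have cm := eltP codec_term Nx cj (Atom [::]) ltm.
rewrite (keepP _ cm) (tlenP Nx cm) (coded_at_drop cm) take_size_cat //.
Qed.

(** Whether an element is kept depends on the relations as sets, not on their listings, so filtering
    a listing lists the scenario. *)
Lemma relations_of_filtered : relations_of filtered = scenario R act.
Proof.
apply: (@eq_from_nth _ fset0) => [|j]; rewrite size_map ?size_mkseq ?size_map // => lt.
rewrite -/(rel_at (relations_of filtered) j) nth_mkseq ?size_map //.
apply/fsetP => t; rewrite mem_rel_at /filtered nth_mkseq // mem_filter.
rewrite !inE mem_rel_at andbC /kept; congr (_ && (_ && _)).
by apply: eq_all => u /=; apply: eq_all => i /=; rewrite mem_rel_at.
Qed.

End Spec.
End Parse.

Lemma definable_end (T : Type) (f : T -> bits) e k p : codec f e -> definable p ->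
  definable (fun xs v => e (bnd xs) (str xs k) (p xs v)).
Proof. by case=> _ _ _ _ d; apply: d. Qed.

Ltac codec_of e :=
  lazymatch e with
  | tend => constr:(codec_term)
  | send tend => constr:(codec_terms)
  | cend => constr:(codec_celem)
  | send cend => constr:(codec_celems)
  | bit_end => constr:(codec_bit)
  end.

Ltac definable_user ::=
  lazymatch goal with
  | |- definable (fun xs v => cidx (bnd xs) (str xs ?k) (@?a xs v)) =>
      refine (@definable_cidx k a _)
  | |- definable (fun xs v => cterm (bnd xs) (str xs ?k) (@?a xs v)) =>
      refine (@definable_cterm k a _)
  | |- definable (fun xs v => tlen (bnd xs) (str xs ?k) (@?a xs v)) =>
      refine (@definable_tlen k a _)
  | |- definable (fun xs v => size (str xs ?k)) => exact (definable_size_str k)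
  | |- definable (fun xs v => elt ?e (bnd xs) (str xs ?k) (@?p xs v) (@?j xs v)) =>
      let c := codec_of e in refine (@definable_elt _ _ _ c k p j _ _)
  | |- definable (fun xs v => slen ?e (bnd xs) (str xs ?k) (@?p xs v)) =>
      let c := codec_of e in refine (@definable_slen _ _ _ c k p _)
  | |- definable (fun xs v => nat_of_bool (teq (bnd xs) (str xs ?k) (@?a xs v) (str xs ?k') (@?b xs v))) =>
      refine (@definable_teq k a k' b _ _)
  | |- definable (fun xs v => nat_of_bool (tmem (bnd xs) (str xs ?k) (@?a xs v) (str xs ?k') (@?b xs v))) =>
      refine (@definable_tmem k a k' b _ _)
  | |- definable (fun xs v => nat_of_bool (cmem (bnd xs) (str xs ?k) (@?j xs v) (@?a xs v) (str xs ?k') (@?b xs v))) =>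
      refine (@definable_cmem k j a k' b _ _ _)
  | |- definable (fun xs v => nat_of_bool (all_seq ?e (bnd xs) (str xs ?k) (@?p xs v) (fun q => @?Q xs v q))) =>
      let c := codec_of e in
      refine (@definable_all_seq _ _ _ c k p (fun xs q v => Q xs v q) _ _)
  | |- definable (fun xs v => nat_of_bool (has_inside (bnd xs) (str xs ?k) (@?a xs v) (fun b => @?Q xs v b))) =>
      refine (@definable_has_inside k a (fun xs b v => Q xs v b) _ _)
  end.

(** * Definability of the checks and of the scenario codes *)

Section Checks.
Local Notation N xs := (bnd xs).
Local Notation x xs := (str xs 0).

Lemma definable_pos1 : definable (fun xs v => pos1 (N xs) (x xs)).
Proof. exact: (definable_end 0 codec_relations (@definable_const 0 isT)). Qed.

Lemma definable_pos2 : definable (fun xs v => pos2 (N xs) (x xs)).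
Proof. exact: (definable_end 0 codec_celems definable_pos1). Qed.

Lemma definable_pos3 : definable (fun xs v => pos3 (N xs) (x xs)).
Proof. exact: (definable_end 0 codec_celems definable_pos2). Qed.

Lemma definable_pos4 : definable (fun xs v => pos4 (N xs) (x xs)).
Proof. exact: (definable_end 0 codec_celem_lists definable_pos3). Qed.

Lemma definable_pos5 : definable (fun xs v => pos5 (N xs) (x xs)).
Proof. exact: (definable_end 0 codec_bits definable_pos4). Qed.

Lemma definable_pos6 : definable (fun xs v => pos6 (N xs) (x xs)).
Proof. exact: (definable_succ definable_pos5). Qed.

Lemma definable_pos7 : definable (fun xs v => pos7 (N xs) (x xs)).
Proof. exact: (definable_end 0 codec_bits definable_pos6). Qed.

Lemma definable_well_formed : definable (fun xs v => well_formed (N xs) (x xs) : nat).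
Proof.
have d5 := definable_pos5; have d7 := definable_pos7.
by rewrite /well_formed; definable.
Qed.

Lemma definable_nrel : definable (fun xs v => nrel (N xs) (x xs)).
Proof. exact: (definable_slen codec_terms 0 (@definable_const 0 isT)). Qed.

Lemma definable_rel j : definable j -> definable (fun xs v => rel (N xs) (x xs) (j xs v)).
Proof. exact: (definable_elt codec_terms 0 (@definable_const 0 isT)). Qed.

Lemma definable_inrel j b : definable j -> definable b ->
  definable (fun xs v => inrel (N xs) (x xs) (j xs v) (b xs v) : nat).
Proof.
move=> dj db; have dn := definable_nrel; have dr := definable_rel dj.
by rewrite /inrel; definable.
Qed.

Lemma definable_instance_check : definable (fun xs v => instance_check (N xs) (x xs) : nat).
Proof.
have dn := definable_nrel; rewrite /instance_check.
apply: definable_and; first by definable.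
apply: definable_all => //.
apply: (definable_all_seq codec_term); first by apply: definable_rel; definable.
have di := definable_inrel (@definable_const 0 isT) (definable_var 0).
by definable.
Qed.

Lemma definable_elements_check p : definable p ->
  definable (fun xs v => elements_check (N xs) (x xs) (p xs v) : nat).
Proof.
move=> dp; rewrite /elements_check; apply: (definable_all_seq codec_celem) => //.
by apply: definable_inrel; definable.
Qed.

Lemma definable_disjoint_check p q : definable p -> definable q ->
  definable (fun xs v => disjoint_check (N xs) (x xs) (p xs v) (q xs v) : nat).
Proof.
apply: (definable2 (g := fun xs p q => disjoint_check (N xs) (x xs) p q : nat)).
by rewrite /disjoint_check; definable.
Qed.

Lemma definable_gamma_check : definable (fun xs v => gamma_check (N xs) (x xs) : nat).
Proof.
have d2 := definable_pos2; have d3 := definable_pos3.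
have de := definable_elements_check (definable_var 0).
have dd := definable_disjoint_check d2 (definable_var 0).
have dl := definable_slen codec_celems 0 d3.
rewrite /gamma_check; apply: definable_and; first exact: definable_elements_check.
apply: definable_and; first by apply: (definable_all_seq codec_celems).
apply: definable_and; first by apply: (definable_all_seq codec_celems).
apply: definable_all => //; apply: definable_all => //.
apply: definable_imp; first by definable.
by apply: definable_disjoint_check; definable.
Qed.

Section Filter.
Variable A : seq bits -> nat -> nat -> bool.
Hypothesis dA : definable (fun xs v => A xs (v 0) (v 1) : nat).

Lemma definable_keep j q : definable j -> definable q ->
  definable (fun xs v => keep (N xs) (x xs) (A xs) (j xs v) (q xs v) : nat).
Proof.
apply: (definable2 (g := fun xs j q => keep (N xs) (x xs) (A xs) j q : nat)).
rewrite /keep; apply: definable_and => //; apply: definable_not.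
apply: definable_has_inside; first by definable.
apply: definable_not; apply: definable_all; first exact: definable_nrel.
have di := definable_inrel (definable_var 0) (definable_var 1).
by apply: definable_imp.
Qed.

Lemma definable_filtered_code :
  definable_out (fun xs v => filtered_code (N xs) (x xs) (A xs)).
Proof.
rewrite /filtered_code; apply: definable_cat; last exact: definable_out_const.
apply: definable_for; first exact: definable_nrel.
apply: definable_cat; first exact: definable_out_const.
apply: definable_cat; last exact: definable_out_const.
have dr := definable_rel (definable_var 0); have dr1 := definable_rel (definable_var 1).
apply: definable_for; first by definable.
have de := definable_elt codec_term 0 dr1 (definable_var 0).
apply: definable_when; first exact: (definable_keep (definable_var 1) de).
apply: definable_cat; first exact: definable_out_const.
have dr2 := definable_rel (definable_var 2).
have de2 := definable_elt codec_term 0 dr2 (definable_var 1).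
by apply: definable_slice => //; apply: definable_tlen.
Qed.

End Filter.
End Checks.

(** * Numerals and distances *)

(** Horner's scheme from the most significant digit, which comes last, with saturation in each
    round; the exact value may be exponential in the length. *)
Definition numeral (N : nat) (u : bits) (p : nat) : nat :=
  iteri (slen bit_end N u p) (fun i a => minn N
    (minn N (a + a) + (bitv u (elt bit_end N u p (slen bit_end N u p - i.+1)) == 2))) 0.

Lemma definable_numeral k p : definable p ->
  definable (fun xs v => numeral (bnd xs) (str xs k) (p xs v)).
Proof.
apply: (definable1 (g := fun xs p => numeral (bnd xs) (str xs k) p)).
apply: (definable_rec (s := fun xs i a v => minn (bnd xs) (minn (bnd xs) (a + a) +
  (bitv (str xs k) (elt bit_end (bnd xs) (str xs k) (v 0)
    (slen bit_end (bnd xs) (str xs k) (v 0) - i.+1)) == 2)))); try by definable.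
have d : definable (fun xs v =>
    slen bit_end (bnd xs) (str xs k) (v 2) - minn (bnd xs) (v 0).+1) by definable.
have := definable_elt codec_bit k (definable_var 2) d => de.
have : definable (fun xs v => minn (bnd xs) (minn (bnd xs) (v 1 + v 1) +
  (bitv (str xs k) (elt bit_end (bnd xs) (str xs k) (v 2)
    (slen bit_end (bnd xs) (str xs k) (v 2) - minn (bnd xs) (v 0).+1)) == 2))) by definable.
apply: definable_ext => xs v Hv.
(* Since the length is within the bound, saturating the subtrahend leaves the truncated difference
   unchanged. *)
have le : slen bit_end (bnd xs) (str xs k) (v 2) <= bnd xs.
  exact: (definable_le (definable_slen codec_bit k (definable_var 2)) Hv).
suff -> : slen bit_end (bnd xs) (str xs k) (v 2) - minn (bnd xs) (v 0).+1 =
  slen bit_end (bnd xs) (str xs k) (v 2) - (v 0).+1 by [].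
by lia.
Qed.

Lemma bit_at (u : bits) q b : coded_at (fun b => [:: b]) u q b -> (bitv u q == 2) = b.
Proof. by case=> z /bitv_drop[-> _]; case: b. Qed.

Lemma numeralP N u p w : 8 * size u + 8 <= N -> coded_at enc_bits u p w ->
  numeral N u p = minn N (nat_of_numeral w).
Proof.
move=> Nu c; rewrite /numeral (slenP codec_bit Nu c).
suff H n : n <= size w -> iteri n (fun i a => minn N (minn N (a + a) +
    (bitv u (elt bit_end N u p (size w - i.+1)) == 2))) 0 =
    minn N (nat_of_numeral (drop (size w - n) w)).
  by rewrite H // subnn drop0.
elim: n => [_|n IH lt]; first by rewrite subn0 drop_size minn0.
rewrite iteriS (IH (ltnW lt)).
have lt' : size w - n.+1 < size w by lia.
rewrite (bit_at (eltP codec_bit Nu c false lt')) (drop_nth false lt') /=.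
rewrite (_ : (size w - n.+1).+1 = size w - n); last lia.
by rewrite -/(nat_of_numeral _) -addnn; case: nth; lia.
Qed.

Section Hamming.

Lemma in_universe_part e (s : {fset celem}) : (e \in universe_part s) = (e \in s) && (e.1 == 0).
Proof. by rewrite /universe_part !inE. Qed.

(* Repeated elements are counted at their last occurrence. *)
Definition hcount N u p u' p' : nat :=
  count (fun i =>
    let q := elt cend N u p i in
    [&& cidx N u q == 0, ~~ cmem N u 0 (cterm N u q) u' p' &
     ~~ has (fun j => (i < j) && ((cidx N u (elt cend N u p j) == 0) &&
          teq N u (cterm N u q) u (cterm N u (elt cend N u p j))))
        (iota 0 (slen cend N u p))])
  (iota 0 (slen cend N u p)).

Lemma definable_hcount k p k' p' : definable p -> definable p' ->
  definable (fun xs v => hcount (bnd xs) (str xs k) (p xs v) (str xs k') (p' xs v)).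
Proof.
apply: (definable2 (g := fun xs p p' => hcount (bnd xs) (str xs k) p (str xs k') p')).
by rewrite /hcount /=; definable.
Qed.

(** [undup] discards an entry that occurs again later, so it is the last occurrences that are
    counted. *)
Lemma size_undup_filter (T : eqType) (P : pred T) (x0 : T) s :
  size (undup (filter P s)) =
  count (fun i => P (nth x0 s i) && (nth x0 s i \notin drop i.+1 s)) (iota 0 (size s)).
Proof.
elim: s => [//|y s IH]; rewrite [size (_ :: _)]/= iotaSl [count _ (_ :: _)]/= count_map.
have -> : count (preim succn (fun i => P (nth x0 (y :: s) i) &&
     (nth x0 (y :: s) i \notin drop i.+1 (y :: s)))) (iota 0 (size s)) =
     size (undup (filter P s)) by rewrite IH.
rewrite drop0 /=; case Py: (P y) => //=; rewrite mem_filter Py /=.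
by case: (y \in s).
Qed.

Lemma hcountP N u p l u' p' l' : 8 * size u + 8 <= N -> 8 * size u' + 8 <= N ->
  coded_at enc_celems u p l -> coded_at enc_celems u' p' l' ->
  hcount N u p u' p' = #|` universe_part (set_of l) `\` universe_part (set_of l')|%fset.
Proof.
move=> Nu Nu' c c'; rewrite /hcount (slenP codec_celem Nu c).
pose P (e : celem) := (e.1 == 0) && (e \notin l').
have -> : #|` universe_part (set_of l) `\` universe_part (set_of l')|%fset =
    size (undup (filter P l)).
  have -> : (universe_part (set_of l) `\` universe_part (set_of l'))%fset =
      set_of (filter P l).
    apply/fsetP => e; rewrite in_fsetD !in_universe_part !in_fset mem_filter /P.
    by case: (e.1 == 0); case: (e \in l) => //=; rewrite ?andbF ?andbT.
  by rewrite /set_of card_fseq.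
rewrite (size_undup_filter P (0, Atom [::])); apply: eq_in_count => i.
rewrite mem_iota add0n => /= lt.
have ci := eltP codec_celem Nu c (0, Atom [::]) lt.
have [ei _ ti] := celemP Nu ci; rewrite ei.
case: (nth _ l i) ei ti ci => j t /= ei ti ci; rewrite /P /=.
case: eqP => //= ej; rewrite ej (cmemP _ Nu Nu' ti c'); congr (~~ _ && ~~ _).
(* A later index with index part 0 and an equal term is the same as membership in the rest of the
   list. *)
apply/hasP/idP => [[m]|].
  rewrite mem_iota add0n => /= ltm /and3P[im].
  have [em _ tm] := celemP Nu (eltP codec_celem Nu c (0, Atom [::]) ltm).
  rewrite em (teqP Nu ti tm) => e1 /eqP e2.
  have -> : (0, t) = nth (0, Atom [::]) l m.
    by move: e1 e2; case: nth => ? ? /= /eqP -> ->.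
  have -> : nth (0, Atom [::]) l m = nth (0, Atom [::]) (drop i.+1 l) (m - i.+1).
    by rewrite nth_drop; congr nth; lia.
  by apply: mem_nth; rewrite size_drop ltn_sub2r // (leq_ltn_trans im ltm).
move=> /(nthP (0, Atom [::])) [m]; rewrite size_drop nth_drop => ltm em.
have ltm' : i.+1 + m < size l by rewrite -ltn_subRL.
exists (i.+1 + m); first by rewrite mem_iota.
have [-> _ tm] := celemP Nu (eltP codec_celem Nu c (0, Atom [::]) ltm').
rewrite em in tm *; rewrite (teqP Nu ti tm) /= !eqxx !andbT.
by rewrite addSn ltnS leq_addr.
Qed.

Lemma hammingE (s s' : {fset celem}) : hamming s s' =
  #|` universe_part s `\` universe_part s'|%fset + #|` universe_part s' `\` universe_part s|%fset.
Proof.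
rewrite /hamming /symdiff; move: (universe_part s) (universe_part s') => A B.
rewrite cardfsU (_ : (A `\` B) `&` (B `\` A) = fset0)%fset ?cardfs0 ?subn0 //.
by apply/fsetP => e; rewrite !inE; case: (e \in A); case: (e \in B).
Qed.

End Hamming.

(** An output may be longer than the bound, so its saturated length is computed by recursion on the
    program. It is needed to test the lengths of certificates. *)
Lemma definable_size f : definable_out f ->
  definable (fun xs v => minn (bnd xs) (size (f xs v))).
Proof.
case=> o Ho; suff [e He] : definable (fun xs v => minn (bnd xs) (size (outp (bnd xs) xs o v))).
  by exists e => xs v Hv; rewrite He // Ho.
elim: o {f Ho} => [e|a IHa b IHb|e a IHa].
- have de : definable (fun xs v => eval (bnd xs) xs e v) by exists e.
  have : definable (fun xs v => nat_of_bool (0 < eval (bnd xs) xs e v)) by definable.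
  apply: definable_ext => xs v _ /=; have := bnd_gt1 xs.
  by case: (eval _ _ _ _) => [|[|k]] /=; lia.
- have := definable_add IHa IHb; apply: definable_ext => xs v _ /=.
  by rewrite size_cat; lia.
have de : definable (fun xs v => eval (bnd xs) xs e v) by exists e.
have step : definable (fun xs v => minn (bnd xs) (v 1 +
    minn (bnd xs) (size (outp (bnd xs) xs a (v 0 .: (fun k => v k.+2)))))).
  apply: definable_add (definable_var 1) _.
  have := definable_ren (fun k => if k is k'.+1 then k.+1 else 0) IHa.
  apply: definable_ext => xs v _; congr (minn _ (size (outp _ _ _ _))).
  by apply: functional_extensionality => -[].
have := definable_rec (s := fun xs i acc v => minn (bnd xs) (acc +
   minn (bnd xs) (size (outp (bnd xs) xs a (i .: v))))) de (@definable_const 0 isT) step.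
apply: definable_ext => xs v Hv /=.
elim: (eval _ _ _ _) => [|n IH]; first by rewrite minn0.
rewrite iteriS IH iotaSr map_cat flatten_cat size_cat /= cats0; lia.
Qed.

Lemma definable_horner (p : {poly nat}) f : definable f ->
  definable (fun xs v => minn (bnd xs) p.[f xs v]%R).
Proof.
have dc c : definable (fun xs v => minn (bnd xs) c).
  elim: c => [|c IH]; first exact: definable_min (@definable_const 0 isT).
  by have := definable_succ IH; apply: definable_ext => xs v _; lia.
move=> df; elim/poly_ind: p => [|p c IH].
  by have := dc 0; apply: definable_ext => xs v _; rewrite horner0.
have := definable_add (definable_mul IH df) (dc c).
apply: definable_ext => xs v Hv; rewrite hornerMXaddC.
have le := definable_le df Hv; set m := f xs v in le *; set r := p.[m]%R.
rewrite -[(r * m)%R]/(r * m)%N -[(_ + c)%R]/(r * m + c)%N.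
(* If [r] exceeds the bound, both products do as well, unless [m] is 0 and both vanish. *)
have e : minn (bnd xs) (minn (bnd xs) r * m) = minn (bnd xs) (r * m).
  case: m {r} le @r => [|m] le r; first by rewrite !muln0.
  case: (leqP r (bnd xs)) => // lt.
  by rewrite !mulnS; lia.
by rewrite e; lia.
Qed.

Definition cert N u p : bits :=
  flatten [seq sym_bits (bitv u (elt bit_end N u p i)) | i <- iota 0 (slen bit_end N u p)].

Lemma certP N u p w : 8 * size u + 8 <= N -> coded_at enc_bits u p w -> cert N u p = w.
Proof.
move=> Nu c; rewrite /cert (slenP codec_bit Nu c).
rewrite -[RHS](mkseq_nth false w) /mkseq -[RHS]flatten_seq1 -map_comp.
congr flatten; apply/eq_in_map => i; rewrite mem_iota add0n /= => lt.
have [z /bitv_drop[-> _]] := eltP codec_bit Nu c false lt.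
by case: nth.
Qed.

Lemma definable_cert k p : definable p ->
  definable_out (fun xs v => cert (bnd xs) (str xs k) (p xs v)).
Proof.
move=> dp; have ds := definable_shift dp; rewrite /cert; apply: definable_for; first by definable.
by apply: definable_emit; definable.
Qed.

(** * The verifier *)

(* The verifier reads [x], the code of [s_0], a mask [y_2] selecting the sets of the
   scenario, and [y_3], consisting of two certificates of feasibility and the code of
   the recovery solution. A mask selecting too many sets is read as empty. *)
Section Verifier.
Variable xs : seq bits.
Local Notation N := (bnd xs).
Local Notation x := (str xs 0).
Local Notation y1 := (str xs 1).
Local Notation y2 := (str xs 2).
Local Notation y3 := (str xs 3).

Definition base_active (j b : nat) : bool := cmem N x j b x (pos1 N x).

Definition nsets : nat := slen (send cend) N x (pos3 N x).

Definition selected (i : nat) : bool :=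
  (bitv y2 i == 2) &&
  (count (fun i => bitv y2 i == 2) (iota 0 nsets) <= numeral N x (pos4 N x)).

Definition recovery_active (j b : nat) : bool :=
  cmem N x j b x (pos2 N x) ||
  has (fun i => selected i && cmem N x j b x (elt (send cend) N x (pos3 N x) i)) (iota 0 nsets).

Definition cert2 : nat := send bit_end N y3 0.
Definition solution_pos : nat := send bit_end N y3 cert2.

(** [y1] is appended without being decoded: membership of the result in the solution language forces
    it to be the code of a list. The same holds for the tail of [y3] in [recovery_code]. *)
Definition base_code : bits := filtered_code N x base_active ++ y1.
Definition recovery_code : bits := filtered_code N x recovery_active ++ drop solution_pos y3.

(** With a negative sign the inequality holds only if distance and numeral are both 0. Otherwise a
    saturated threshold is as good as the true one, because the distance does not exceed [N]. *)
Definition distance_check : bool :=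
  let h := minn N (hcount N y1 0 y3 solution_pos + hcount N y3 solution_pos y1 0) in
  let k := numeral N x (pos6 N x) in
  if bitv x (pos5 N x) == 2 then (h == 0) && (k == 0) else h <= k.

Definition static_check : bool :=
  [&& well_formed N x, instance_check N x, elements_check N x (pos1 N x) & gamma_check N x].

(** Membership in NP speaks of certificates up to length [p.[size u]] only, so longer ones must be
    rejected even if the verifier would accept them. *)
Definition short (p : {poly nat}) (u : bits) (q : nat) : bool :=
  slen bit_end N y3 q <= minn N p.[minn N (size u)]%R.

Definition full_check (p : {poly nat}) : bool :=
  [&& static_check, solution_pos < N, short p base_code 0, short p recovery_code cert2 &
      distance_check].

End Verifier.

Section DefinableVerifier.

Lemma definable_base_active : definable (fun xs v => base_active xs (v 0) (v 1) : nat).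
Proof. by have d := definable_pos1; rewrite /base_active; definable. Qed.

Lemma definable_selected i : definable i -> definable (fun xs v => selected xs (i xs v) : nat).
Proof.
move=> di; have d3 := definable_pos3; have d4 := definable_numeral 0 definable_pos4.
by rewrite /selected /nsets; definable.
Qed.

Lemma definable_recovery_active : definable (fun xs v => recovery_active xs (v 0) (v 1) : nat).
Proof.
have d2 := definable_pos2; have d3 := definable_pos3.
have ds := definable_selected (definable_var 0).
by rewrite /recovery_active /nsets; definable.
Qed.

Lemma definable_cert2 : definable (fun xs v => cert2 xs).
Proof. exact: (definable_end 3 codec_bits (@definable_const 0 isT)). Qed.

Lemma definable_solution_pos : definable (fun xs v => solution_pos xs).
Proof. exact: (definable_end 3 codec_bits definable_cert2). Qed.

Lemma definable_suffix k p : definable p ->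
  definable_out (fun xs v => drop (p xs v) (str xs k)).
Proof.
move=> dp; have := definable_slice k dp (definable_size_str k).
by apply: definable_out_ext => xs v; rewrite take_oversize // size_drop leq_subr.
Qed.

Lemma definable_base_code : definable_out (fun xs v => base_code xs).
Proof.
apply: definable_cat; first exact: (definable_filtered_code definable_base_active).
have := definable_suffix 1 (@definable_const 0 isT).
by apply: definable_out_ext => xs v; rewrite drop0.
Qed.

Lemma definable_recovery_code : definable_out (fun xs v => recovery_code xs).
Proof.
apply: definable_cat; first exact: (definable_filtered_code definable_recovery_active).
exact: (definable_suffix 3 definable_solution_pos).
Qed.

Lemma definable_short p u q : definable_out u -> definable q ->
  definable (fun xs v => short xs p (u xs v) (q xs v) : nat).
Proof.
move=> du dq; have d := definable_horner p (definable_size du).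
by rewrite /short; definable.
Qed.

Lemma definable_static_check : definable (fun xs v => static_check xs : nat).
Proof.
have d1 := definable_elements_check definable_pos1.
have d2 := definable_gamma_check; have d3 := definable_instance_check.
have d4 := definable_well_formed.
by rewrite /static_check; definable.
Qed.

Lemma definable_distance_check : definable (fun xs v => distance_check xs : nat).
Proof.
have d0 := @definable_const 0 isT.
have d5 := definable_solution_pos; have d8 := definable_hcount 1 3 d0 d5.
have d9 := definable_hcount 3 1 d5 d0.
have d10 := definable_numeral 0 definable_pos6; have d11 := definable_pos5.
by rewrite /distance_check; definable.
Qed.

Lemma definable_full_check p : definable (fun xs v => full_check xs p : nat).
Proof.
have d1 := definable_static_check; have d2 := definable_solution_pos.
have d3 := definable_short p definable_base_code (@definable_const 0 isT).
have d4 := definable_short p definable_recovery_code definable_cert2.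
have d5 := definable_distance_check.
by rewrite /full_check; definable.
Qed.

End DefinableVerifier.

(** * Masks for index sets and correctness of the checks *)

Definition mask_set (n : nat) (y : bits) (G : nat) : {set 'I_n} :=
  [set i : 'I_n | (bitv y i == 2) && (count (fun i => bitv y i == 2) (iota 0 n) <= G)].

Lemma card_set_ord n (P : pred nat) : #|[set i : 'I_n | P i]| = count P (iota 0 n).
Proof. by rewrite -sum1dep_card -sum1_count -(big_mkord P (fun=> 1)) /index_iota subn0. Qed.

Lemma card_mask_set n y G : #|mask_set n y G| <= G.
Proof.
rewrite /mask_set; case le: (count _ _ <= G); last first.
  by rewrite (_ : [set i : 'I_n | _] = set0) ?cards0 //; apply/setP => i; rewrite !inE andbF.
rewrite (@card_set_ord n (fun i => (bitv y i == 2) && true)).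
by rewrite (eq_count (a2 := fun i => bitv y i == 2)) // => i; rewrite andbT.
Qed.

Definition mask_of n (J : {set 'I_n}) : bits := [seq i \in J | i <- enum 'I_n].

(** Together with [card_mask_set]: masks yield exactly the admissible index sets, so quantifying
    over strings is quantifying over scenarios. *)
Lemma mask_ofK n (J : {set 'I_n}) G : #|J| <= G -> mask_set n (mask_of J) G = J.
Proof.
move=> le; have bm (i : 'I_n) : (bitv (mask_of J) i == 2) = (i \in J).
  rewrite /bitv size_map size_enum_ord ltn_ord (nth_map i) ?size_enum_ord //.
  by rewrite nth_ord_enum; case: (i \in J).
have cnt : count (fun i => bitv (mask_of J) i == 2) (iota 0 n) = #|J|.
  by rewrite -card_set_ord; apply: eq_card => i; rewrite inE bm.
by apply/setP => i; rewrite inE bm cnt le andbT.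
Qed.

Lemma size_mask_of n (J : {set 'I_n}) : size (mask_of J) = n.
Proof. by rewrite size_map size_enum_ord. Qed.

Definition sigma_of (l' : seq celem) (ls : seq (seq celem)) (y : bits) (G : nat) : {fset celem} :=
  let E := map (@set_of celem) ls in
  (set_of l' `|` \bigcup_(i in mask_set (size E) y G) nth fset0 E i)%fset.

Section VerifierSpec.
Variables (x y1 y2 y3 : bits).
Local Notation xs := [:: x; y1; y2; y3].
Local Notation N := (bnd xs).
Variables (Rl : seq (seq term)) (l0 l' : seq celem) (ls : seq (seq celem)) (g : bits)
  (sgn : bool) (k : bits).
Hypothesis ex : x = enc_input Rl l0 l' ls g sgn k.

Lemma bound0 : 8 * size x + 8 <= N. Proof. exact: (size_str xs 0). Qed.
Lemma bound1 : 8 * size y1 + 8 <= N. Proof. exact: (size_str xs 1). Qed.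
Lemma bound3 : 8 * size y3 + 8 <= N. Proof. exact: (size_str xs 3). Qed.

Lemma parsed_input : parsed N x Rl l0 l' ls g sgn k.
Proof. by case: (parsed_enc bound0 ex). Qed.

Lemma base_codeE : base_code xs = enc_relations (filtered Rl (set_of l0)) ++ y1.
Proof.
congr (_ ++ _); apply: (filtered_codeE bound0 parsed_input) => j b t c.
by rewrite in_fset; apply: cmemP c (at_base parsed_input); apply: bound0.
Qed.

Lemma selectedE (i : 'I_(size (map (@set_of celem) ls))) :
  selected xs i = (i \in mask_set (size (map (@set_of celem) ls)) y2 (nat_of_numeral g)).
Proof.
rewrite inE /selected /nsets (slenP codec_celems bound0 (at_sets parsed_input)).
rewrite (numeralP bound0 (at_gamma parsed_input)) -(size_map (@set_of celem) ls).
(* The count is at most the number of listed sets, which is below [N]; saturating $\Gamma$ at [N]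
   therefore does not affect the comparison. *)
congr (_ && _); set c := count _ _.
have : c <= size (map (@set_of celem) ls) by rewrite -[X in _ <= X](size_iota 0) count_size.
have : size (map (@set_of celem) ls) < N.
  rewrite size_map.
  have szx : size x <= N by have := bound0; lia.
  apply: leq_trans (size_enc_seq enc_celems ls) (leq_trans _ szx).
  apply: leq_trans (leq_addl _ _) (coded_at_size _ (at_sets parsed_input)).
  exact: leq_ltn_trans (leq0n _) (size_enc_seq enc_celems ls).
by move=> lt le; lia.
Qed.

Lemma recovery_codeE : recovery_code xs =
  enc_relations (filtered Rl (sigma_of l' ls y2 (nat_of_numeral g))) ++ drop (solution_pos xs) y3.
Proof.
congr (_ ++ _); apply: (filtered_codeE bound0 parsed_input) => j b t c.
have mem p l : coded_at enc_celems x p l -> cmem N x j b x p = ((j, t) \in l).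
  by move=> cl; apply: cmemP c cl; apply: bound0.
rewrite /recovery_active /sigma_of in_fsetU in_fset (mem _ _ (at_common parsed_input)).
congr (_ || _).
have sz : nsets xs = size (map (@set_of celem) ls).
  by rewrite size_map; apply: (slenP codec_celems bound0 (at_sets parsed_input)).
have elts i : i < size ls -> cmem N x j b x (elt (send cend) N x (pos3 N x) i) =
    ((j, t) \in nth fset0 (map (@set_of celem) ls) i).
  move=> lt; rewrite (nth_map [::]) // in_fset; apply: mem.
  exact: (eltP codec_celems bound0 (at_sets parsed_input)).
apply/hasP/bigfcupP => [[i]|[i]].
  rewrite mem_iota add0n sz => /= lt /andP[si mi].
  exists (Ordinal lt); rewrite ?mem_index_enum -?selectedE //=.
  by rewrite -elts // -(size_map (@set_of celem)).
rewrite mem_index_enum -selectedE /= => si mi; exists (nat_of_ord i).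
  by rewrite mem_iota add0n sz /=.
by rewrite si elts // -(size_map (@set_of celem)).
Qed.

Lemma static_checkE : static_check xs <->
  [/\ is_instance (relations_of Rl), {subset set_of l0 <= celems (relations_of Rl)} &
      gamma_encoding_ok (relations_of Rl) (set_of l') (map (@set_of celem) ls)].
Proof.
rewrite /static_check; have [_ ->] := parsed_enc bound0 ex; rewrite andTb.
split=> [/and3P[]|[]].
  move=> /(instance_checkE bound0 parsed_input) H1.
  move=> /(elements_checkE bound0 parsed_input (at_base parsed_input)) H2.
  by move=> /(gamma_checkE bound0 parsed_input).
move=> /(instance_checkE bound0 parsed_input) H1.
move=> /(elements_checkE bound0 parsed_input (at_base parsed_input)) H2.
by move=> /(gamma_checkE bound0 parsed_input) H3; apply/and3P.
Qed.

Lemma distance_checkE s0 s : coded_at enc_celems y1 0 s0 ->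
  coded_at enc_celems y3 (solution_pos xs) s ->
  distance_check xs = ((hamming (set_of s0) (set_of s))%:Z <= int_of_numeral sgn k)%R.
Proof.
move=> c0 c; rewrite /distance_check (at_sign parsed_input).
rewrite (numeralP bound0 (at_kappa parsed_input)).
rewrite (hcountP bound1 bound3 c0 c) (hcountP bound3 bound1 c c0) -hammingE.
(* Both differences are counted within listed elements, of which there are fewer than bits in [y1]
   and [y3]. *)
have le : hamming (set_of s0) (set_of s) <= N.
  rewrite hammingE -(hcountP bound1 bound3 c0 c) -(hcountP bound3 bound1 c c0).
  have le u p l u' p' : 8 * size u + 8 <= N -> coded_at enc_celems u p l ->
      hcount N u p u' p' <= size u.
    move=> Nu cu; apply: leq_trans (count_size _ _) _.
    rewrite size_iota (slenP codec_celem Nu cu).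
    have := size_enc_seq enc_celem l.
    have := coded_at_size (leq_ltn_trans (leq0n _) (size_enc_seq enc_celem l)) cu.
    by lia.
  have := le _ _ _ y3 (solution_pos xs) bound1 c0.
  have := le _ _ _ y1 0 bound3 c.
  by have := bound1; have := bound3; lia.
have N0 : 0 < N by have := bound0; lia.
rewrite /int_of_numeral (minn_idPr le); move: (hamming _ _) (nat_of_numeral k) le => h K le.
by case: sgn => /=; lia.
Qed.

End VerifierSpec.

(** * Lengths of codes *)

Lemma size_enc_seqE (T : Type) (f : T -> bits) s :
  size (enc_seq f s) = (\sum_(y <- s) (size (f y)).+1).+1.
Proof. by elim: s => [|y s IH] /=; rewrite ?big_nil ?big_cons // size_cat IH; lia. Qed.

Lemma size_enc_filter (T : Type) (f : T -> bits) (P : pred T) s :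
  size (enc_seq f (filter P s)) <= size (enc_seq f s).
Proof.
elim: s => //= y s IH; case: (P y) => /=; rewrite !size_cat; first by lia.
by apply: leq_trans IH _; lia.
Qed.

Lemma size_filtered Rl act :
  size (enc_relations (filtered Rl act)) <= size (enc_relations Rl).
Proof.
rewrite !size_enc_seqE ltnS /filtered /mkseq big_map (big_nth [::]) /index_iota subn0.
by apply: leq_sum => j _; rewrite ltnS size_enc_filter.
Qed.

Lemma size_enc_bits w : size (enc_bits w) = (2 * size w).+1.
Proof.
by rewrite /enc_bits; elim: w => //= b w ->; lia.
Qed.

Definition all_celems (Rl : seq (seq term)) : seq celem :=
  flatten [seq [seq (j, t) | t <- nth [::] Rl j] | j <- iota 0 (size Rl)].

Lemma mem_all_celems Rl c : (c \in all_celems Rl) = (c \in celems (relations_of Rl)).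
Proof.
rewrite [in RHS]inE mem_rel_at; apply/flatten_mapP/idP => [[j _ /mapP[t tj ->]] //|].
case: c => j t /= tj; exists j; last exact: map_f.
by rewrite mem_iota add0n /= ltnNge; apply/negP => le; rewrite nth_default in tj.
Qed.

(** The unary index of a relation is below [n], so passing from a term to a combinatorial element
    multiplies the cost by at most [n.+1], while all terms together cost at most [n]. *)
Lemma size_all_celems Rl (n := size (enc_relations Rl)) :
  size (enc_celems (all_celems Rl)) <= n * n.+1 + 1.
Proof.
rewrite size_enc_seqE /all_celems big_flatten big_map addn1 ltnS.
have szR : size Rl < n by apply: size_enc_seq.
have en : \sum_(j <- iota 0 (size Rl)) \sum_(t <- nth [::] Rl j) (size (enc_term t)).+1 <= n.
  rewrite /n size_enc_seqE (big_nth [::]) /index_iota subn0; apply: leqW.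
  by apply: leq_sum => j _; rewrite size_enc_seqE; lia.
rewrite mulnC; apply: leq_trans (leq_mul (leqnn _) en).
rewrite big_distrr /= big_seq [X in _ <= X]big_seq; apply: leq_sum => j.
rewrite mem_iota add0n => /andP[_ lt]; rewrite big_map big_distrr /=.
apply: leq_sum => t _; rewrite /enc_celem size_cat size_nseq /=.
have : n.+1 + n.+1 * size (enc_term t) <= n.+1 * (size (enc_term t)).+1 by rewrite mulnS.
by have := leq_addr (n * size (enc_term t)) (size (enc_term t)); rewrite -mulSn; lia.
Qed.

(** A solution has listings of any length, through repetitions. Filtering the list of all elements
    gives one of length polynomial in the input, as the bounded quantifiers demand. *)
Definition listing Rl (s : {fset celem}) : seq celem := [seq c <- all_celems Rl | c \in s].

Lemma set_of_listing Rl (s : {fset celem}) :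
  {subset s <= celems (relations_of Rl)} -> set_of (listing Rl s) = s.
Proof.
move=> H; apply/fsetP => c; rewrite in_fset mem_filter mem_all_celems.
by case cs: (c \in s) => //=; apply: H.
Qed.

Lemma scenario_celems R act : {subset celems (scenario R act) <= celems R}.
Proof.
move=> [j t]; rewrite !inE /= /rel_at /scenario; case: (ltnP j (size R)) => lt.
  by rewrite nth_mkseq // !inE => /andP[].
by rewrite nth_default // size_mkseq.
Qed.

(** * Soundness and completeness of the verifier *)

Section Correctness.
Variables (P : problem) (Vs : seq bits -> Prop) (p : {poly nat}).
Hypothesis HVs : forall w, solution_language P w <-> alternation true 1 p.[size w]%R Vs [:: w].

(** The code of the relations is prefix-free, so the word splits in only one way and the undecoded
    part [y] must be the code of a solution. *)
Lemma feasible_code Rl act y :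
  solution_language P (enc_relations (filtered Rl act) ++ y) <->
  exists2 sl, y = enc_celems sl & feasible P (scenario (relations_of Rl) act) (set_of sl).
Proof.
have [pR _ _ _ _] := codec_relations.
split=> [[Rl' [sl [e f]]]|[sl -> f]].
  by have [eR ey] := pR _ _ _ _ e; exists sl => //; rewrite -relations_of_filtered eR.
by exists (filtered Rl act), sl; rewrite relations_of_filtered.
Qed.

Definition verifies (xs : seq bits) : Prop :=
  [/\ full_check xs p,
      Vs [:: base_code xs; cert (bnd xs) (str xs 3) 0] &
      Vs [:: recovery_code xs; cert (bnd xs) (str xs 3) (cert2 xs)]].

Lemma polytime_verifies : polytime 2 Vs -> polytime 4 verifies.
Proof.
move=> HV.
exact: (polytime_definable 4 HV (definable_full_check p) definable_base_code
  (definable_cert 3 (@definable_const 0 isT)) definable_recovery_code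
  (definable_cert 3 definable_cert2)).
Qed.

Lemma shortE xs u q c : size u <= bnd xs -> coded_at enc_bits (str xs 3) q c ->
  short xs p u q = (size c <= p.[size u]%R)%N.
Proof.
move=> le cq; rewrite /short (slenP codec_bit (size_str xs 3) cq) (minn_idPr le).
have : size c <= bnd xs.
  have := coded_at_size (leq_ltn_trans (leq0n _) (size_enc_seq _ c)) cq.
  have := size_str xs 3; rewrite size_enc_bits; lia.
by move=> lc; rewrite leq_min lc.
Qed.

Variables (x y1 y2 y3 : bits).
Local Notation xs := [:: x; y1; y2; y3].
Variables (Rl : seq (seq term)) (l0 l' : seq celem) (ls : seq (seq celem)) (g : bits)
  (sgn : bool) (k : bits).
Hypothesis ex : x = enc_input Rl l0 l' ls g sgn k.
Local Notation R := (relations_of Rl).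
Local Notation sigma := (sigma_of l' ls y2 (nat_of_numeral g)).

(** Deactivation only shortens the code of the instance, so the word is no longer than all inputs
    together and its saturated length is its length. *)
Lemma size_code act y : size y <= size y1 + size y3 ->
  size (enc_relations (filtered Rl act) ++ y) <= bnd xs.
Proof.
move=> le; rewrite size_cat; have := size_filtered Rl act.
have : size (enc_relations Rl) <= size x by rewrite ex /enc_input size_cat leq_addr.
rewrite /bnd !big_cons big_nil; lia.
Qed.

Lemma verifies_sound : verifies xs ->
  [/\ is_instance R, {subset set_of l0 <= celems R} &
      gamma_encoding_ok R (set_of l') (map (@set_of celem) ls)] /\
  exists s0 s, [/\ y1 = enc_celems s0, feasible P (scenario R (set_of l0)) (set_of s0),
    feasible P (scenario R sigma) (set_of s) &
    ((hamming (set_of s0) (set_of s))%:Z <= int_of_numeral sgn k)%R].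
Proof.
case=> /and5P[/(static_checkE y1 y2 y3 ex) Hs lt sh0 sh1 dist] V0 V1; split=> //.
have b3 := bound3 x y1 y2 y3.
(* A successful decoding up to [solution_pos] shows that [y3] starts with the codes of two
   certificates. *)
have [c [cc _ dc]] := prev_code b3 codec_bits lt.
have lt0 : send bit_end (bnd xs) y3 0 < bnd xs.
  have : send bit_end (bnd xs) y3 0 < size y3 by case: (prev_code b3 codec_bits lt) => ? [].
  by lia.
have [c0 [cc0 _ dc0]] := prev_code b3 codec_bits lt0.
rewrite (base_codeE y1 y2 y3 ex) (certP b3 cc0) in V0.
rewrite (recovery_codeE y1 y2 y3 ex) (certP b3 cc) in V1.
rewrite (base_codeE y1 y2 y3 ex) (shortE (xs := xs) _ cc0) in sh0; last by apply: size_code; lia.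
rewrite (recovery_codeE y1 y2 y3 ex) (shortE (xs := xs) _ cc) in sh1; last first.
  by apply: size_code; rewrite size_drop; lia.
have /feasible_code[s0 e1 f0] : solution_language P (enc_relations (filtered Rl (set_of l0)) ++ y1).
  by apply/HVs; exists c0.
have /feasible_code[s e3 f] : solution_language P
    (enc_relations (filtered Rl sigma) ++ drop (solution_pos xs) y3).
  by apply/HVs; exists c.
exists s0, s; split=> //.
rewrite -(@distance_checkE x y1 y2 y3 _ _ _ _ _ _ _ ex s0 s) //.
  by exists [::]; rewrite drop0 cats0.
by exists [::]; rewrite cats0.
Qed.

Lemma verifies_complete s0 s c0 c :
  [/\ is_instance R, {subset set_of l0 <= celems R} &
      gamma_encoding_ok R (set_of l') (map (@set_of celem) ls)] ->
  y1 = enc_celems s0 -> y3 = enc_bits c0 ++ enc_bits c ++ enc_celems s ->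
  let w0 := enc_relations (filtered Rl (set_of l0)) ++ enc_celems s0 in
  let w := enc_relations (filtered Rl sigma) ++ enc_celems s in
  size c0 <= p.[size w0]%R -> Vs [:: w0; c0] -> size c <= p.[size w]%R -> Vs [:: w; c] ->
  ((hamming (set_of s0) (set_of s))%:Z <= int_of_numeral sgn k)%R ->
  verifies xs.
Proof.
move=> Hs e1 e3 w0 w le0 V0 le V dist.
have b3 := bound3 x y1 y2 y3.
have [cc0 d1] := next_code b3 codec_bits (etrans (drop0 y3) e3).
have [cc d2] := next_code b3 codec_bits d1.
have ew0 : base_code xs = w0 by rewrite (base_codeE y1 y2 y3 ex) e1.
have ew : recovery_code xs = w.
  by rewrite (recovery_codeE y1 y2 y3 ex) /solution_pos d2.
rewrite /verifies ew0 ew (certP b3 cc0) (certP b3 cc); split=> //.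
apply/and5P; split.
- exact/(static_checkE y1 y2 y3 ex).
- have : size (drop (solution_pos xs) y3) > 0.
    by rewrite d2; apply: leq_ltn_trans (size_enc_seq _ s).
  by rewrite size_drop; lia.
- by rewrite ew0 (shortE (xs := xs) _ cc0) //; apply: size_code; rewrite e1; lia.
- rewrite ew (shortE (xs := xs) _ cc) //; apply: size_code.
  by rewrite e3 !size_cat; lia.
rewrite (@distance_checkE x y1 y2 y3 _ _ _ _ _ _ _ ex s0 s) //.
  by exists [::]; rewrite drop0 cats0.
by exists [::]; rewrite cats0.
Qed.

End Correctness.

Lemma size_listing Rl s n : size (enc_relations Rl) <= n ->
  size (enc_celems (listing Rl s)) <= n * n.+1 + 1.
Proof.
move=> le; apply: leq_trans (size_enc_filter _ _ _) _.
apply: leq_trans (size_all_celems Rl) _.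
by rewrite leq_add2r leq_mul.
Qed.

Theorem theorem17 (P : problem) :
  problem_in_NP P -> SigmaP 3 (HDRR_gamma_language P).
Proof.
case=> _ [Vs [p [HV HVs]]].
(* [B] bounds the code of a listed solution. [C] bounds the code of a certificate for a word of
   length at most [n + B n], where [enc_bits] doubles the length and adds one. *)
pose B n := n * n.+1 + 1.
pose C n := (2 * p.[n + B n]%R).+1.
(* One bound for all three strings: [B n] suffices for [y1], [n] for a mask with one bit per listed
   set, and [B n + (C n + C n)] for [y3]. *)
have [q Hq] : polybound (fun n => B n + n + (C n + C n)).
  have pB : polybound B.
    apply: (@polybound_le _ (fun n => n * (n + 1) + 1)) => [n|]; first by rewrite [n + 1]addn1.
    by polybound.
  have pC : polybound C.
    apply: (@polybound_le _ (fun n => 2 * p.[n + B n]%R + 1)) => [n|]; first by rewrite addn1.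
    apply: polybound_add (polybound_const 1); apply: polybound_mul (polybound_const 2) _.
    by apply: polybound_comp; [exists p | apply: polybound_add polybound_id pB].
  exact: polybound_add (polybound_add pB polybound_id) (polybound_add pC pC).
exists (verifies Vs p), q; split; first exact: polytime_verifies.
move=> x; have {Hq}le := Hq (size x); set n := size x in le *; rewrite /=.
split=> [[Rl [l0 [l' [ls [g [sgn [k [ex [iR sub0 gok [s0 [f0 rec]]]]]]]]]]]|].
  have leR : size (enc_relations Rl) <= n by rewrite /n ex size_cat leq_addr.
  have short act s : feasible P (scenario (relations_of Rl) act) s ->
      exists c, [/\ set_of (listing Rl s) = s,
        size c <= p.[size (enc_relations (filtered Rl act) ++ enc_celems (listing Rl s))]%R,
        Vs [:: enc_relations (filtered Rl act) ++ enc_celems (listing Rl s); c] &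
        size (enc_bits c) <= C n].
    move=> f; have es : set_of (listing Rl s) = s.
      apply: set_of_listing => c cs; apply: (@scenario_celems _ act).
      by case: (feasible_sub f) => _; apply.
    have /HVs[c [lc Vc]] : solution_language P
        (enc_relations (filtered Rl act) ++ enc_celems (listing Rl s)).
      by apply/feasible_code; exists (listing Rl s); rewrite ?es.
    exists c; split=> //; rewrite size_enc_bits /C ltnS leq_mul2l /=.
    apply: leq_trans lc _; apply: horner_mono; rewrite size_cat leq_add //.
      exact: leq_trans (size_filtered _ _) leR.
    exact: size_listing.
  have [c0 [e0 lc0 Vc0 szc0]] := short _ _ f0.
  exists (enc_celems (listing Rl s0)); split.
    by apply: leq_trans (size_listing s0 leR) _; rewrite /B in le; lia.
  move=> y2 ly2.
  (* Every string is an admissible mask, so the hypothesis on all scenarios applies to any [y2]. *)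
  have [s [f dist]] : exists s, feasible P (scenario (relations_of Rl)
      (sigma_of l' ls y2 (nat_of_numeral g))) s /\
      ((hamming s0 s)%:Z <= int_of_numeral sgn k)%R.
    apply: rec; exists (mask_set (size (map (@set_of celem) ls)) y2 (nat_of_numeral g)).
    by split; first exact: card_mask_set.
  have [c [e lc Vc szc]] := short _ _ f.
  exists (enc_bits c0 ++ enc_bits c ++ enc_celems (listing Rl s)); split.
    rewrite !size_cat; apply: leq_trans le; have := size_listing s leR; rewrite -/(B n); lia.
  by apply: (verifies_complete (s0 := listing Rl s0) (s := listing Rl s) ex _ erefl erefl
    lc0 Vc0 lc Vc); rewrite ?e0 ?e.
case=> y1 [ly1 H].
(* The check of the input and the feasibility of $s_0$ lie under the universal quantifier; any [y2]
   gives access to them, for instance the empty one. *)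
have [y3 [_ V]] := H [::] isT.
have [Rl [l0 [l' [ls [g [sgn [k ex]]]]]]] : exists Rl l0 l' ls g sgn k,
    x = enc_input Rl l0 l' ls g sgn k.
  case: V => /and5P[/and4P[wf _ _ _] _ _ _ _] _ _.
  exact: (well_formed_enc (size_str [:: x; y1; [::]; y3] 0) wf).
have sound := verifies_sound HVs ex.
have [[iR sub0 gok] [s0 [_ [ey1 f0 _ _]]]] := sound _ _ _ V.
exists Rl, l0, l', ls, g, sgn, k; split=> //; split=> //.
exists (set_of s0); split=> // sigma [J [lJ ->]].
have szJ : size (mask_of J) = size ls by rewrite size_mask_of size_map.
(* The mask is within the range of the quantifier: each listed set contributes at least one bit to
   the input. *)
have lt2 : size (mask_of J) <= q.[n]%R.
  apply: leq_trans le; rewrite szJ.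
  have : size ls < size (enc_seq enc_celems ls) by apply: size_enc_seq.
  have : size (enc_seq enc_celems ls) <= n by rewrite /n ex /enc_input !size_cat; lia.
  by lia.
have [z3 [_ Vz]] := H _ lt2.
have [_ [s0' [s [ey1' _ f dist]]]] := sound _ _ _ Vz.
exists (set_of s); split.
  by move: f; rewrite /sigma_of mask_ofK.
(* The base solution must not depend on the scenario: both lists are decoded from the same [y1], and
   decoding is unique. *)
have es : s0 = s0'.
  have [pc _ _ _ _] := codec_celems.
  by have [] := pc s0 s0' [::] [::]; rewrite ?cats0 -?ey1 -?ey1'.
by rewrite es.
Qed.
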